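(* Let $X$ be a Hadamard space. Let $(\mu_t)_{t\ge0}$ and $(\sigma_t)_{t\ge0}$ be two geodesic rays of $\mathscr{W}_2(X)$, let $\mu$ and $\sigma$ be any displacement interpolations of $(\mu_t)$ and $(\sigma_t)$ respectively, and let $\mu_\infty=(e_\infty)_\#\mu$ and $\sigma_\infty=(e_\infty)_\#\sigma$ be the corresponding asymptotic measures. Then $(\mu_t)$ and $(\sigma_t)$ are asymptotic if and only if $\mu_\infty=\sigma_\infty$, and $$\lim_{t\to\infty}\frac{\mathrm{W}(\mu_t,\sigma_t)}{t}=\mathrm{W}_\infty(\mu_\infty,\sigma_\infty).$$
   Context: A geodesic in a metric space $Y$ is a curve $\gamma:I\to Y$ on an interval such that $d(\gamma_t,\gamma_{t'})=v|t-t'|$ for all $t,t'$ and some constant speed $v\ge 0$. A geodesic ray is a geodesic on $[0,+\infty)$; $\mathscr{R}(Y)$ is the set of geodesic rays (constant rays included) with the topology of uniform convergence on compact sets. A Hadamard space is a complete separable, locally compact, geodesic, globally $\mathrm{CAT}(0)$ metric space. Two rays are asymptotic if they stay at bounded distance as $t\to+\infty$. The boundary $\partial X$ is the set of asymptote classes of unit speed rays of $X$, with its cone topology (for any base point $x_0\in X$, each class contains exactly one unit ray from $x_0$, and the topology is that of uniform convergence on compact sets of these rays). The cone $c\partial X$ is the topological quotient of $\partial X\times[0,+\infty)$ by $(\xi,0)\sim(\xi',0)$ for all $\xi,\xi'\in\partial X$. $\mathscr{W}_2(X)$ is the set of Borel probability measures on $X$ with finite second moment, with the quadratic Wasserstein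 metric $\mathrm{W}$. A displacement interpolation of a geodesic ray $(\mu_t)_{t\ge 0}$ of $\mathscr{W}_2(X)$ is a probability measure $\mu$ on $\mathscr{R}(X)$ with $(e_t)_\#\mu=\mu_t$ for all $t\ge0$, where $e_t(\gamma)=\gamma_t$. The map $e_\infty:\mathscr{R}(X)\to c\partial X$ sends $\gamma$ to $([\gamma^1],s(\gamma))$, where $s(\gamma)$ is the speed of $\gamma$ and $[\gamma^1]$ is the asymptote class of its unit speed reparametrization (arbitrary if $s(\gamma)=0$); it identifies asymptote classes of rays with points of $c\partial X$. For rays $\gamma,\beta$ of $X$, $d_\infty(\gamma,\beta)=\lim_{t\to+\infty}d(\gamma_t,\beta_t)/t$; this depends only on the asymptote classes and defines a metric $d_\infty$ on $c\partial X$, which is lower semicontinuous with respect to the topology of $c\partial X$ above (but does not induce it). For Borel probability measures $\alpha,\beta$ on $c\partial X$ (Borel for the topology above) with $\int s^2$ finite, where $s$ is the speed coordinate, $\mathrm{W}_\infty(\alpha,\beta)=\left(\min_\Pi\int d_\infty^2\,d\Pi\right)^{1/2}$, the minimum being over all transport plans $\Pi$ (probability measures on $c\partial X\times c\partial X$ with marginals $\alpha,\beta$). *)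

(* Defs.v *)
From HB Require Import structures.
From mathcomp Require Import all_boot all_order all_algebra.
From mathcomp Require Import all_classical all_reals all_analysis.

Set Implicit Arguments.
Unset Strict Implicit.
Unset Printing Implicit Defensive.

Import Order.TTheory GRing.Theory Num.Theory.
Import numFieldNormedType.Exports.

Local Open Scope classical_set_scope.
Local Open Scope ring_scope.

(* The distinguished point of a pointed metric space serves as the base point
   of its boundary; a statement about all such structures is therefore a
   statement about all base points. *)
#[short(type="completeMetricType")]
HB.structure Definition CompleteMetric (K : numDomainType) :=
  {M of Metric K M & Complete M}.

Section geodesics.
Context {R : realType} {T : Type} (d : T -> T -> R).

Definition geodesic_on (I : set R) (g : R -> T) : Prop :=
  exists2 v : R, 0 <= v &
    forall t t', I t -> I t' -> d (g t) (g t') = v * `|t - t'|.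

Definition geodesic_ray (g : R -> T) : Prop := geodesic_on `[0, +oo[ g.

Definition geodesic_segment (p q : T) (g : R -> T) : Prop :=
  [/\ geodesic_on `[0, 1] g, g 0 = p & g 1 = q].

Definition asymptotic (g h : R -> T) : Prop :=
  exists C : R, forall t, 0 <= t -> d (g t) (h t) <= C.

End geodesics.

Section hadamard.
Context {R : realType}.

Definition euclid (P Q : 'rV[R]_2) : R :=
  Num.sqrt (\sum_(i < 2) (P 0 i - Q 0 i) ^+ 2).

(* Any two sides of a geodesic triangle share a vertex: it is called p below.
   Two points on the same side are at the same distance as their comparison
   points. *)
Definition cat0 (X : metricType R) : Prop :=
  forall (p q r : X) (g h k : R -> X),
    geodesic_segment mdist p q g -> geodesic_segment mdist p r h ->
    geodesic_segment mdist q r k ->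
  forall P Q S : 'rV[R]_2,
    euclid P Q = mdist p q -> euclid P S = mdist p r ->
    euclid Q S = mdist q r ->
  forall s t : R, 0 <= s <= 1 -> 0 <= t <= 1 ->
    mdist (g s) (h t) <= euclid (P + s *: (Q - P)) (P + t *: (S - P)).

Record hadamard (X : completeMetricType R) : Prop := Hadamard {
  hadamard_separable : exists2 D : set X, countable D & dense D;
  hadamard_locally_compact : locally_compact [set: X];
  hadamard_geodesic : forall p q : X, exists g, geodesic_segment mdist p q g;
  hadamard_cat0 : cat0 X }.

End hadamard.

Section rays.
Context {R : realType} (X : completeMetricType R).

(* A geodesic ray is a map on [0, +oo[; it is extended to a total function by
   its value at 0, so that distinct elements of [ray] are distinct rays, and
   uniform convergence on the compact subsets of R and of [0, +oo[ agree. *)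
Definition ray : Type :=
  [set g : {family compact, R -> X} |
    geodesic_ray mdist g /\ forall t, t <= 0 -> g t = g 0].

HB.instance Definition _ := Topological.on ray.

Definition ray_fun (g : ray) : R -> X := set_val g.
Coercion ray_fun : ray >-> Funclass.

Lemma cst_rayP (x : X) :
  [set g : {family compact, R -> X} |
    geodesic_ray mdist g /\ forall t, t <= 0 -> g t = g 0] (cst x).
Proof.
split=> //; exists 0 => // t t' _ _.
by rewrite mul0r mdistxx.
Qed.

Definition cst_ray (x : X) : ray := SigSub (mem_set (cst_rayP x)).

HB.instance Definition _ := isPointed.Build ray (cst_ray point).

Definition speed (g : ray) : R := mdist (g 0) (g 1).

Lemma speedP (g : ray) t t' : 0 <= t -> 0 <= t' ->
  mdist (g t) (g t') = speed g * `|t - t'|.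
Proof.
have [[v v0 gv] _] := set_valP g; rewrite /speed /ray_fun => t0 t'0.
rewrite !gv/= ?in_itv/= ?andbT ?lexx ?ler01//.
by rewrite sub0r normrN normr1 mulr1.
Qed.

Lemma unit_reparam_subproof (g : ray) : 0 < speed g ->
  [set g : {family compact, R -> X} |
    geodesic_ray mdist g /\ forall t, t <= 0 -> g t = g 0]
  (fun t => g (t / speed g)).
Proof.
move=> s0; split=> /=.
  exists 1 => // t t'; rewrite /= !in_itv/= !andbT => t0 t'0.
  rewrite speedP ?divr_ge0 ?(ltW s0)// -mulrBl normrM normfV (gtr0_norm s0).
  by rewrite mul1r mulrCA divff ?mulr1// gt_eqF.
move=> t t0; rewrite mul0r; have [_ +] := set_valP g; apply.
by rewrite pmulr_lle0// invr_gt0.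
Qed.

Definition unit_reparam (g : ray) (g0 : 0 < speed g) : ray :=
  SigSub (mem_set (unit_reparam_subproof g0)).

Lemma speed_unit_reparam (g : ray) (g0 : 0 < speed g) :
  speed (unit_reparam g0) = 1.
Proof.
rewrite /speed /ray_fun/= speedP ?divr_ge0 ?(ltW g0)// mul0r mul1r sub0r.
by rewrite normrN ger0_norm ?invr_ge0 ?(ltW g0)// divff// gt_eqF.
Qed.

End rays.

Section boundary.
Context {R : realType} (X : completeMetricType R).

Definition unit_ray : set (ray X) := [set g | speed g = 1].

Definition asymptote_class (g : ray X) : set (ray X) :=
  [set h | unit_ray h /\ asymptotic mdist g h].

Definition boundary : Type := [set asymptote_class g | g in unit_ray].

HB.instance Definition _ := Choice.on boundary.

(* In a Hadamard space each class contains exactly one ray from [point]. *)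
Definition based_ray (xi : boundary) : ray X :=
  xget point [set g | set_val xi g /\ g 0 = point].

HB.instance Definition _ :=
  Topological.copy boundary (initial_topology based_ray).

Definition boundary_class (g : ray X) (g1 : unit_ray g) : boundary :=
  SigSub (mem_set (imageP asymptote_class g1)).

(* [None] is the apex. When [boundary] is not empty this is the quotient of
   boundary * [0, +oo[ by boundary * {0}; when it is empty (X is bounded), the
   cone is reduced to its apex, which is the class of the constant rays. *)
Definition cone : Type := option (boundary * {s : R | 0 < s}).

HB.instance Definition _ := Choice.on cone.
HB.instance Definition _ := isPointed.Build cone None.

Definition cone_proj (p : boundary * [set` `[0%R, +oo[ : interval R]) : cone :=
  omap (pair p.1) (insub (set_val p.2)).

Definition cone_open (U : set cone) : Prop := open (cone_proj @^-1` U).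

Lemma cone_openT : cone_open setT.
Proof. exact: openT. Qed.

Lemma cone_openI : setI_closed cone_open.
Proof. by move=> A B; exact: openI. Qed.

Lemma cone_open_bigcup (I : Type) (f : I -> set cone) :
  (forall i, cone_open (f i)) -> cone_open (\bigcup_i f i).
Proof. by move=> fo; apply: bigcup_open => i _; exact: fo. Qed.

HB.instance Definition _ :=
  isOpenTopological.Build cone cone_openT cone_openI cone_open_bigcup.

Definition e_infty (g : ray X) : cone :=
  match pselect (0 < speed g) with
  | left g0 => Some (boundary_class (speed_unit_reparam g0), exist (fun s : R => 0 < s) _ g0)
  | right _ => None
  end.

Definition ray_d_infty (g h : ray X) : R :=
  lim (mdist (g t) (h t) / t @[t --> +oo]).

(* [e_infty] is onto, and [ray_d_infty] only depends on the asymptote classes: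
   the choice of the representatives is immaterial. *)
Definition cone_ray (x : cone) : ray X := xget point [set g | e_infty g = x].

Definition d_infty (x y : cone) : R := ray_d_infty (cone_ray x) (cone_ray y).

End boundary.

Definition borel (T : ptopologicalType) := g_sigma_algebraType (@open T).

Section wasserstein.
Context {R : realType}.

(* Set functions that represent the same measure are only required to agree on
   measurable sets. *)
Definition same_measure d (T : measurableType d) (P Q : set T -> \bar R) : Prop :=
  forall A, measurable A -> P A = Q A.

Definition transport_plans d (T : measurableType d) (P Q : set T -> \bar R) :
    set (probability (T * T)%type R) :=
  [set Pi | same_measure (pushforward Pi fst) P /\
            same_measure (pushforward Pi snd) Q].

(* The infimum is a minimum for the costs used here, which are lower
   semicontinuous. *)
Definition wasserstein d (T : measurableType d) (c : T -> T -> R)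
    (P Q : set T -> \bar R) : \bar R :=
  sqrte (ereal_inf [set (\int[Pi]_x ((c x.1 x.2) ^+ 2)%:E)%E
                   | Pi in transport_plans P Q]).

Definition W2 (X : completeMetricType R) : Type :=
  [set P : probability (borel X) R |
    exists x0 : X, (\int[P]_x (mdist x0 (x : X) ^+ 2)%:E < +oo)%E].

Definition W2_prob (X : completeMetricType R) (P : W2 X) :
  probability (borel X) R := set_val P.
Coercion W2_prob : W2 >-> probability.

(* [wasserstein] is finite between measures with finite second moment. *)
Definition W (X : completeMetricType R) (P Q : W2 X) : R :=
  fine (@wasserstein _ (borel X) (@mdist R X) P Q).

Definition displacement_interpolation (X : completeMetricType R)
    (mu_ : R -> W2 X) (mu : probability (borel (ray X)) R) : Prop :=
  forall t, 0 <= t ->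
    same_measure
      (pushforward mu (fun g : borel (ray X) => (g : ray X) t : borel X))
      (mu_ t).

Definition W_infty (X : completeMetricType R)
    (alpha beta : set (borel (cone X)) -> \bar R) : \bar R :=
  @wasserstein _ (borel (cone X)) (@d_infty R X) alpha beta.

Definition asymptotic_measure (X : completeMetricType R)
    (mu : probability (borel (ray X)) R) : set (borel (cone X)) -> \bar R :=
  pushforward mu (@e_infty R X : borel (ray X) -> borel (cone X)).

End wasserstein.

(* Main.v *)
(* Rays asymptotic to g and issued from x0 stay within d(g 0, x0) of g, and for
   two rays issued from x0 the ratio d(g t, h t) / t increases to d_infty.

   Upper bound: a plan Pi on the cone lifts to a coupling of mu and sigma,
   gluing along the cells of a countable partition of X into sets of bounded
   diameter that contain the positions at time t. Its cost at time t is at most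
   (1 + e)^2 t^2 \int d_infty^2 dPi + C, where C depends on e but not on t. When
   mu_infty = sigma_infty the diagonal plan gives a bounded distance.

   Lower bound: near-optimal plans between mu_t and sigma_t at times t_k -> oo
   lift to couplings V_k of mu and sigma; let V be their ultralimit. By convexity
   of t |-> d(g t, h t), the cost of V_k at time m is at most (m / t_k)^2 times
   its cost at time t_k, up to a bounded error, and this passes to V. Letting
   m -> oo, Fatou's lemma bounds the cost of the image of V on the cone. If the
   rays of measures are asymptotic this cost vanishes, so that the image lives
   on the diagonal and mu_infty = sigma_infty.

   The ultralimit exists because rays are coded measurably by binary sequences:
   limits of the probabilities of words are realised by cutting [0, 1[ into
   intervals of the prescribed lengths. *)

Require Import Defs.
From HB Require Import structures.
From mathcomp Require Import all_boot all_order all_algebra.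
From mathcomp Require Import all_classical all_reals all_analysis.
From mathcomp Require Import measurable_realfun.
From mathcomp Require Import lra ring.

Set Implicit Arguments.
Unset Strict Implicit.
Unset Printing Implicit Defensive.

Import Order.TTheory GRing.Theory Num.Theory.
Import numFieldNormedType.Exports.

Local Open Scope classical_set_scope.
Local Open Scope ring_scope.

(** * CAT(0) convexity and asymptotic rays *)

(** Convexity compares the positions of two fixed rays at different times, so it says nothing about
    plans between [mu_ t] and [sigma_ t] until these are lifted to couplings of whole rays. Lifting
    exactly would call for disintegration. Lifting up to a bounded error only takes a countable sum
    of normalized product measures, and a bounded error is negligible against t^2. Errors are
    absorbed by Young's inequality with a parameter e, which keeps the factor of the main term close
    to 1.

    The coding serves compactness: limits of probabilities on binary sequences always exist, without
    tightness or a weak topology on rays. The obstacle is that such a limit could charge sequences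
    that code no pair of rays. The marginals exclude this: they are the same for all couplings of
    the sequence, so the limit has them too. The limit is only known through single bits of the
    codes, hence the cost is first replaced by one that is constant on cells, again at the price of
    a bounded error. *)

Section comparison_triangle.
Context {R : realType}.

Definition plane_point (x y : R) : 'rV[R]_2 := \row_i (if i == 0 then x else y).

Lemma euclid_plane_point x y x' y' :
  euclid (plane_point x y) (plane_point x' y') =
  Num.sqrt ((x - x') ^+ 2 + (y - y') ^+ 2).
Proof. by rewrite /euclid big_ord_recl big_ord1 !mxE/=. Qed.

Lemma comparison_triangle (a b c : R) : 0 <= a -> 0 <= b -> 0 <= c ->
  a <= b + c -> b <= a + c -> c <= a + b ->
  exists P Q S : 'rV[R]_2, [/\ euclid P Q = a, euclid P S = b & euclid Q S = c].
Proof.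
move=> a0 b0 c0 abc bac cab; have [az|an] := eqVneq a 0.
  have bc : b = c by apply/eqP; rewrite eq_le; lra.
  exists (plane_point 0 0), (plane_point 0 0), (plane_point b 0).
  rewrite !euclid_plane_point az bc; split; last 1 first.
  - by rewrite subrr expr0n/= addr0 sub0r sqrrN sqrtr_sqr ger0_norm.
  - by rewrite subrr expr0n/= addr0 sqrtr0.
  - by rewrite subrr expr0n/= addr0 sub0r sqrrN sqrtr_sqr ger0_norm.
have ap : 0 < a by rewrite lt_neqAle eq_sym an.
(* Law of cosines: with the side of length [a] on the axis, [x] is the abscissa of the third vertex.
   Below, [2a(b - x) = c^2 - (a - b)^2] and [2a(b + x) = (a + b)^2 - c^2] are nonnegative by the
   triangle inequalities. *)
pose x := (a ^+ 2 + b ^+ 2 - c ^+ 2) / (2 * a).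
have xa : 2 * a * x = a ^+ 2 + b ^+ 2 - c ^+ 2.
  by rewrite /x mulrC divfK// mulf_neq0// pnatr_eq0.
have y0 : 0 <= b ^+ 2 - x ^+ 2.
  have h1 : 0 <= b - x by rewrite -(@pmulr_rge0 _ (2 * a)); nra.
  have h2 : 0 <= b + x by rewrite -(@pmulr_rge0 _ (2 * a)); nra.
  by rewrite subr_sqr mulr_ge0.
exists (plane_point 0 0), (plane_point a 0), (plane_point x (Num.sqrt (b ^+ 2 - x ^+ 2))).
rewrite !euclid_plane_point; split.
- by rewrite subrr expr0n/= addr0 sub0r sqrrN sqrtr_sqr ger0_norm.
- by rewrite !sub0r !sqrrN sqr_sqrtr// addrC subrK sqrtr_sqr ger0_norm.
- rewrite sub0r sqrrN sqr_sqrtr// (_ : _ + _ = c ^+ 2).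
    by rewrite sqrtr_sqr ger0_norm.
  by rewrite sqrrB; lra.
Qed.

Lemma euclid_homothety (P Q S : 'rV[R]_2) (t : R) : 0 <= t ->
  euclid (P + t *: (Q - P)) (P + t *: (S - P)) = t * euclid Q S.
Proof.
move=> t0; rewrite /euclid -[X in X * _](ger0_norm t0) -sqrtr_sqr -sqrtrM ?sqr_ge0//.
congr Num.sqrt; rewrite mulr_sumr; apply: eq_bigr => i _.
by rewrite !mxE; ring.
Qed.

End comparison_triangle.

Section metric_limits.
Context {R : realType} (X : completeMetricType R).

Lemma mdist_lipschitz (a b c e : X) :
  `|mdist a b - mdist c e| <= mdist a c + mdist b e.
Proof.
have h1 := metric_triangle a c b; have h2 := metric_triangle c e b.
have h3 := metric_triangle c a e; have h4 := metric_triangle a b e.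
have := metric_sym e b; have := metric_sym c a => ca eb.
by rewrite ler_norml; apply/andP; split; lra.
Qed.

Lemma cvg_mdist (I : Type) (F : set_system I) (FF : Filter F) (u v : I -> X) (a b : X) :
  u @ F --> a -> v @ F --> b -> mdist (u x) (v x) @[x --> F] --> mdist a b.
Proof.
move=> /metricType_numDomainType.cvgrPdist_lt ua /metricType_numDomainType.cvgrPdist_lt vb.
apply/cvgrPdist_lt => e e0; have e20 : 0 < e / 2 by rewrite divr_gt0.
near=> x; apply: le_lt_trans (mdist_lipschitz _ _ _ _) _.
by rewrite [e]splitr ltrD//; near: x; [exact: ua | exact: vb].
Unshelve. all: by end_near. Qed.

Lemma cvg_mdistl (I : Type) (F : set_system I) (FF : Filter F) (u : I -> X) (a b : X) :
  u @ F --> a -> mdist (u x) b @[x --> F] --> mdist a b.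
Proof. by move=> ua; apply: cvg_mdist => //; exact: cvg_cst. Qed.

Lemma cauchy_mdist_cvg (u : nat -> X) :
  (forall e : R, 0 < e -> exists N, forall m n, (N <= m)%N -> (N <= n)%N ->
    mdist (u m) (u n) < e) -> exists l : X, u @ \oo --> l.
Proof.
move=> cu; exists (lim (u @ \oo)); apply/cauchy_cvgP/cauchyP => e e0.
have [N uN] := cu _ e0; exists (u N); exists N => // n /= Nn.
by rewrite ballEmdist/=; exact: uN.
Qed.

End metric_limits.

Section hadamard_convexity.
Context {R : realType} (X : completeMetricType R).
Implicit Types (p q r x : X) (g h : R -> X).

Lemma geodesic_segment_dist p q g s t : geodesic_segment mdist p q g ->
  0 <= s <= 1 -> 0 <= t <= 1 -> mdist (g s) (g t) = mdist p q * `|s - t|.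
Proof.
move=> [[v v0 gv] <- <-] s01 t01; rewrite !gv/= ?in_itv/= ?lexx ?ler01//.
by rewrite sub0r normrN1 mulr1.
Qed.

Lemma geodesic_segment_rev p q g : geodesic_segment mdist p q g ->
  geodesic_segment mdist q p (fun t => g (1 - t)).
Proof.
move=> [[v v0 gv] <- <-]; split; rewrite ?subr0 ?subrr//; exists v => // t t'.
rewrite /= !in_itv/= => /andP[? ?] /andP[? ?].
rewrite gv/= ?in_itv/=; try (apply/andP; split; lra).
by congr (_ * _); rewrite -normrN; congr (`| _ |); ring.
Qed.

Hypothesis hX : hadamard X.

(** At equal parameters on both sides, the comparison points are the images of Q and S under the
    homothety of centre P and ratio t. *)
Lemma geodesic_fan p q r g h t : geodesic_segment mdist p q g ->
  geodesic_segment mdist p r h -> 0 <= t <= 1 ->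
  mdist (g t) (h t) <= t * mdist q r.
Proof.
move=> sg sh t01; have [k sk] := hadamard_geodesic hX q r.
have [P [Q [S [PQ PS QS]]]] : exists P Q S : 'rV[R]_2,
    [/\ euclid P Q = mdist p q, euclid P S = mdist p r & euclid Q S = mdist q r].
  by apply: comparison_triangle; rewrite ?mdist_ge0//;
    [rewrite (metric_sym q r)|idtac|rewrite (metric_sym p q)]; exact: metric_triangle.
have := hadamard_cat0 hX sg sh sk PQ PS QS t01 t01.
by rewrite euclid_homothety ?QS//; case/andP: t01.
Qed.

(** The diagonal from p to q' cuts the quadrilateral into two fans. The second one has its apex at
    q', hence the reversed geodesics and the parameter 1 - t. *)
Lemma geodesic_convex p q p' q' g h t : geodesic_segment mdist p q g ->
  geodesic_segment mdist p' q' h -> 0 <= t <= 1 ->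
  mdist (g t) (h t) <= (1 - t) * mdist p p' + t * mdist q q'.
Proof.
move=> sg sh /andP[t0 t1]; have [k sk] := hadamard_geodesic hX p q'.
have t01 : 0 <= 1 - t <= 1 by apply/andP; split; lra.
have h1 := geodesic_fan sg sk (introT andP (conj t0 t1)).
have h2 := geodesic_fan (geodesic_segment_rev sk) (geodesic_segment_rev sh) t01.
rewrite subKr in h2; have := metric_triangle (g t) (k t) (h t); lra.
Qed.

End hadamard_convexity.

Section rays.
Context {R : realType} (X : completeMetricType R).
Implicit Types (g h : ray X).

Lemma ray_neg g t : t <= 0 -> g t = g 0.
Proof. by have [_ +] := set_valP g; exact. Qed.

Lemma speed_ge0 g : 0 <= speed g. Proof. exact: mdist_ge0. Qed.

Lemma ray_exists (f : R -> X) : geodesic_ray mdist f ->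
  exists g : ray X, forall t : R, 0 <= t -> g t = f t.
Proof.
move=> [v v0 fv]; pose f' t := f (Num.max t 0).
have fP : [set g : {family compact, R -> X} |
    geodesic_ray mdist g /\ forall t, t <= 0 -> g t = g 0] f'.
  split=> [|t t0]; last by rewrite /f' (max_idPr t0) maxxx.
  exists v => // t t'; rewrite /= !in_itv/= !andbT /f' => t0 t'0.
  by rewrite (max_idPl t0) (max_idPl t'0) fv//= in_itv/= andbT.
exists (SigSub (mem_set fP)) => t t0.
by rewrite -[LHS]/(f' t) /f' (max_idPl t0).
Qed.

Lemma ray_scale_exists g (s : R) : 0 <= s ->
  exists h : ray X, forall t : R, 0 <= t -> h t = g (s * t).
Proof.
move=> s0; apply: ray_exists; exists (speed g * s); first by rewrite mulr_ge0 ?speed_ge0.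
move=> t t'; rewrite /= !in_itv/= !andbT => t0 t'0.
by rewrite speedP ?mulr_ge0// -mulrBr normrM (ger0_norm s0) mulrA.
Qed.

Lemma ray_segment g a : 0 <= a ->
  geodesic_segment mdist (g 0) (g a) (fun s => g (s * a)).
Proof.
move=> a0; split; rewrite ?mul0r ?mul1r//; exists (speed g * a).
  by rewrite mulr_ge0 ?speed_ge0.
move=> t t'; rewrite /= !in_itv/= => /andP[t0 _] /andP[t'0 _].
by rewrite speedP ?mulr_ge0// -mulrBl normrM (ger0_norm a0) -mulrA (mulrC a).
Qed.

(** Consecutive samples are joined by segments. Between different segments, the path through the
    samples bounds the distance from above, and a shorter distance would contradict the prescribed
    distance of the outer samples. This is how a ray is recovered from its code, which only records
    integer times. *)
Lemma ray_samples_exists (y : nat -> X) (s : R) : hadamard X -> 0 <= s ->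
  (forall m n, mdist (y m) (y n) = s * `|m%:R - n%:R|) ->
  exists g : ray X, forall n, g n%:R = y n.
Proof.
move=> hX s0 ys.
have [seg segP] := choice (fun n => hadamard_geodesic hX (y n) (y n.+1)).
have yS n : mdist (y n) (y n.+1) = s.
  by rewrite ys -natr1 opprD addNKr normrN1 mulr1.
pose f (t : R) := seg (Num.truncn t) (t - (Num.truncn t)%:R).
have trP (t : R) : 0 <= t ->
    0 <= t - (Num.truncn t)%:R <= 1 /\ t < (Num.truncn t)%:R + 1.
  move=> t0; have /andP[ha hb] := Num.Theory.truncn_itv t0.
  rewrite -natr1 in hb; split=> //.
  by apply/andP; split; lra.
have fl (t : R) : 0 <= t -> mdist (y (Num.truncn t)) (f t) = s * (t - (Num.truncn t)%:R).
  move=> t0; have [/andP[h0 h1] _] := trP _ t0; have [_ <- _] := segP (Num.truncn t).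
  rewrite (geodesic_segment_dist (segP _)) ?lexx ?ler01 ?h0//.
  by rewrite yS sub0r normrN ger0_norm.
have fr (t : R) : 0 <= t ->
    mdist (f t) (y (Num.truncn t).+1) = s * ((Num.truncn t)%:R + 1 - t).
  move=> t0; have [/andP[h0 h1] ?] := trP _ t0; have [_ _ <-] := segP (Num.truncn t).
  rewrite (geodesic_segment_dist (segP _)) ?lexx ?ler01 ?h0//.
  by rewrite yS distrC ger0_norm; [congr (_ * _); ring | lra].
have fgeo (t t' : R) : 0 <= t -> t <= t' -> mdist (f t) (f t') = s * (t' - t).
  move=> t0 tt'; have t'0 := le_trans t0 tt'.
  have [/andP[h0 h1] h2] := trP _ t0; have [/andP[h'0 h'1] h'2] := trP _ t'0.
  have : (Num.truncn t <= Num.truncn t')%N by exact: Num.Theory.le_truncn.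
  rewrite leq_eqVlt => /predU1P[e|mm'].
    rewrite /f -e in h'0 h'1 *; rewrite (geodesic_segment_dist (segP _)) ?h0 ?h'0//.
    by rewrite yS distrC ger0_norm; [congr (_ * _); ring | lra].
  apply/eqP; rewrite eq_le; apply/andP; split.
    have := metric_triangle (f t) (y (Num.truncn t).+1) (f t').
    have := metric_triangle (y (Num.truncn t).+1) (y (Num.truncn t')) (f t').
    rewrite fr// fl// ys distrC ger0_norm; last by rewrite subr_ge0 ler_nat.
    by rewrite -natr1 => *; nra.
  have := metric_triangle (y (Num.truncn t)) (f t) (y (Num.truncn t').+1).
  have := metric_triangle (f t) (f t') (y (Num.truncn t').+1).
  rewrite fr// fl// ys distrC ger0_norm; last by rewrite subr_ge0 ler_nat ltnW// ltnS ltnW.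
  by rewrite -natr1 => *; nra.
have [|g gf] := @ray_exists f; last first.
  exists g => n; rewrite gf// /f natrK subrr.
  by have [_ <- _] := segP n.
exists s => // t t'; rewrite /= !in_itv/= !andbT => t0 t'0.
have [tt'|/ltW tt'] := leP t t'; first by rewrite fgeo// distrC ger0_norm ?subr_ge0.
by rewrite metric_sym fgeo// ger0_norm ?subr_ge0.
Qed.

End rays.

(** * Asymptotic rays: equal speeds, nonexpansion, existence from any origin *)

Section asymptotic_rays.
Context {R : realType} (X : completeMetricType R).
Implicit Types (g h b : ray X).

Lemma asymptotic_refl g : asymptotic mdist g g.
Proof. by exists 0 => t _; rewrite mdistxx. Qed.

Lemma asymptotic_sym g h : asymptotic mdist g h -> asymptotic mdist h g.
Proof. by move=> [C gh]; exists C => t /gh; rewrite metric_sym. Qed.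

Lemma asymptotic_trans h g b :
  asymptotic mdist g h -> asymptotic mdist h b -> asymptotic mdist g b.
Proof.
move=> [C gh] [D hb]; exists (C + D) => t t0.
by rewrite (le_trans (metric_triangle _ (h t) _))// lerD ?gh ?hb.
Qed.

Lemma asymptotic_speed_le g h : asymptotic mdist g h -> speed g <= speed h.
Proof.
move=> [C gh]; rewrite leNgt; apply/negP => hg.
have C0 : 0 <= C by apply: le_trans (gh 0 _); rewrite ?mdist_ge0.
pose t := (C + mdist (h 0) (g 0) + 1) / (speed g - speed h).
have d0 := mdist_ge0 (h 0) (g 0).
have t0 : 0 <= t by rewrite divr_ge0 ?subr_ge0 ?(ltW hg)//; lra.
have tE : t * (speed g - speed h) = C + mdist (h 0) (g 0) + 1.
  by rewrite divfK// subr_eq0 gt_eqF.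
have := gh _ t0; have h1 := metric_triangle (g 0) (h 0) (g t).
have h2 := metric_triangle (h 0) (h t) (g t).
move: h1 h2; rewrite (metric_sym (g 0) (h 0)) (metric_sym (h t) (g t)).
rewrite !speedP ?lexx// !sub0r !normrN (ger0_norm t0).
by rewrite mulrBr in tE; move=> *; lra.
Qed.

Lemma asymptotic_speed g h : asymptotic mdist g h -> speed g = speed h.
Proof.
move=> gh; apply/eqP; rewrite eq_le !asymptotic_speed_le//.
exact: asymptotic_sym.
Qed.

Lemma speed0_cst g (t : R) : speed g = 0 -> 0 <= t -> g t = g 0.
Proof. by move=> s0 t0; apply: mdist_positivity; rewrite speedP// s0 mul0r. Qed.

Hypothesis hX : hadamard X.

Lemma ray_convex0 g h (t T : R) : 0 <= t -> t <= T ->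
  T * mdist (g t) (h t) <= (T - t) * mdist (g 0) (h 0) + t * mdist (g T) (h T).
Proof.
move=> t0 tT; have T0 := le_trans t0 tT.
have [T_eq0|Tn0] := eqVneq T 0.
  have -> : t = 0 by apply: le_anti; rewrite t0 -T_eq0 tT.
  by rewrite T_eq0 !mul0r subrr mul0r addr0 lexx.
have Tp : 0 < T by rewrite lt_neqAle eq_sym Tn0.
have t01 : 0 <= t / T <= 1 by rewrite divr_ge0// ler_pdivrMr// mul1r.
have := geodesic_convex hX (ray_segment g T0) (ray_segment h T0) t01.
rewrite divfK// -(ler_pM2l Tp) => /le_trans; apply.
suff -> : T * ((1 - t / T) * mdist (g 0) (h 0) + t / T * mdist (g T) (h T)) =
  (T - t) * mdist (g 0) (h 0) + t * mdist (g T) (h T) by [].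
by field.
Qed.

(** A bounded convex function on a half-line never exceeds its initial value: convexity up to T
    would give [T * e <= t * C], and T is chosen to violate this. *)
Lemma asymptotic_dist g h (t : R) : asymptotic mdist g h -> 0 <= t ->
  mdist (g t) (h t) <= mdist (g 0) (h 0).
Proof.
move=> [C gh] t0; rewrite leNgt; apply/negP => lt0.
have C0 : 0 <= C by apply: le_trans (gh 0 _); rewrite ?mdist_ge0.
pose e := mdist (g t) (h t) - mdist (g 0) (h 0).
have e0 : 0 < e by rewrite subr_gt0.
pose T := t + t * C / e + 1.
have tCe : 0 <= t * C / e by rewrite divr_ge0 ?mulr_ge0// ltW.
have tT : t <= T by rewrite /T; lra.
have TE : T * e = t * e + t * C + e.
  by rewrite /T mulrDl mulrDl mul1r divfK// gt_eqF.
have T0 := le_trans t0 tT; have := gh _ T0; have := ray_convex0 g h t0 tT.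
by have := mdist_ge0 (g 0) (h 0); rewrite /e in e0 TE *; nra.
Qed.

(* By convexity the segments from x to g n and to g m, n <= m, are within
   (t / n) d(x, g 0) of each other at time t, so they converge to a ray. *)
Lemma asymptotic_based_exists g (x : X) :
  exists b, b 0 = x /\ asymptotic mdist g b.
Proof.
(* The targets are taken at times n + 1 so that no denominator vanishes. *)
have [seg segP] := choice (fun n : nat => hadamard_geodesic hX x (g n.+1%:R)).
pose a := mdist x (g 0); have a0 : 0 <= a := mdist_ge0 _ _.
have near_g (n : nat) (t : R) : 0 <= t -> t <= n.+1%:R ->
    mdist (seg n (t / n.+1%:R)) (g t) <= a.
  move=> t0 tn; have t01 : 0 <= t / n.+1%:R <= 1.
    by rewrite divr_ge0// ler_pdivrMr// mul1r.
  have := geodesic_convex hX (segP n) (ray_segment g (ler0n _ n.+1)) t01.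
  rewrite divfK// mdistxx mulr0 addr0 => /le_trans; apply.
  by rewrite ler_piMl// gerBl; case/andP: t01.
have near_seg (m n : nat) (t : R) : (n <= m)%N -> 0 <= t -> t <= n.+1%:R ->
    mdist (seg n (t / n.+1%:R)) (seg m (t / m.+1%:R)) <= t / n.+1%:R * a.
  move=> nm t0 tn; have t01 : 0 <= t / n.+1%:R <= 1.
    by rewrite divr_ge0// ler_pdivrMr// mul1r.
  have nm' : n.+1%:R <= m.+1%:R :> R by rewrite ler_nat ltnS.
  pose q := n.+1%:R / m.+1%:R : R.
  have q01 : 0 <= q <= 1 by rewrite divr_ge0// ler_pdivrMr// mul1r.
  (* The initial part of the segment to [g m.+1%:R], rescaled to [0, 1]; by [near_g] its end is
     within [a] of [g n.+1%:R], which makes a fan with [seg n]. *)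
  have sm : geodesic_segment mdist x (seg m q) (fun s => seg m (s * q)).
    have [[v v0 gv] gx _] := segP m; split; rewrite ?mul0r ?mul1r//.
    exists (v * q) => [|s s']; first by rewrite mulr_ge0//; case/andP: q01.
    rewrite /= !in_itv/= => /andP[s0 s1] /andP[s'0 s'1].
    rewrite gv/= ?in_itv/=.
    - by case/andP: q01 => q0 _; rewrite -mulrBl normrM (ger0_norm q0) -mulrA (mulrC q).
    - by case/andP: q01 => q0 q1; rewrite mulr_ge0// mulr_ile1.
    - by case/andP: q01 => q0 q1; rewrite mulr_ge0// mulr_ile1.
  have := geodesic_fan hX (segP n) sm t01.
  rewrite /q mulrA divfK// => /le_trans; apply.
  rewrite ler_wpM2l//; first by case/andP: t01.
  by rewrite metric_sym near_g.
have cvg_seg (t : R) : 0 <= t -> exists l : X, (seg n (t / n.+1%:R)) @[n --> \oo] --> l.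
  move=> t0; apply: cauchy_mdist_cvg => e e0.
  pose N := Num.truncn (t + t * a * 2 / e); exists N.
  have ta0 : 0 <= t * a * 2 / e by rewrite divr_ge0 ?mulr_ge0// ltW.
  have /andP[_ hN] : (N%:R : R) <= t + t * a * 2 / e < N.+1%:R.
    by rewrite Num.Theory.truncn_itv// addr_ge0.
  have tN : t <= N.+1%:R by lra.
  have tNa : t / N.+1%:R * a < e / 2.
    have : t * a * 2 / e < N.+1%:R by lra.
    rewrite ltr_pdivrMr// => h; rewrite mulrAC ltr_pdivrMr//; lra.
  move=> m n Nm Nn; apply: le_lt_trans (metric_triangle _ (seg N (t / N.+1%:R)) _) _.
  rewrite [e]splitr ltrD//; last exact: le_lt_trans (near_seg _ _ _ _ _ _) _.
  by rewrite metric_sym; exact: le_lt_trans (near_seg _ _ _ _ _ _) _.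
pose lim_seg (t : R) l := 0 <= t -> (seg n (t / n.+1%:R)) @[n --> \oo] --> (l : X).
have exP (t : R) : exists l, lim_seg t l.
  have [t0|t0] := leP 0 t; last by exists x => t0'; lra.
  by have [l ?] := cvg_seg t t0; exists l.
have [b0 b0P] := choice exP.
have b00 : b0 0 = x.
  apply: (@cvg_unique X _ (seg n (0 / n.+1%:R) @[n --> \oo])).
  - exact: metric_hausdorff.
  - exact: b0P.
  - have -> : (fun n => seg n (0 / n.+1%:R)) = (fun=> x).
      by apply/funext => n; rewrite mul0r; have [_ ->] := segP n.
    exact: cvg_cst.
(* The n-th segment has length [n.+1 * speed g] up to [a], so the limit curve moves at the speed of
   g. *)
have len (n : nat) : `|mdist x (g n.+1%:R) / n.+1%:R - speed g| <= a / n.+1%:R.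
  rewrite -[X in `|_ - X|](mulfK (_ : n.+1%:R != 0 :> R))// -mulrBl normrM normfV.
  rewrite (ger0_norm (ler0n _ _)) ler_wpM2r// ?invr_ge0//.
  have -> : speed g * n.+1%:R = mdist (g 0) (g n.+1%:R).
    by rewrite speedP// sub0r normrN ger0_norm.
  by have := mdist_lipschitz x (g n.+1%:R) (g 0) (g n.+1%:R); rewrite mdistxx addr0.
have cvg_len : mdist x (g n.+1%:R) / n.+1%:R @[n --> \oo] --> speed g.
  apply/cvgrPdist_le => e e0; near=> n; rewrite distrC (le_trans (len n))//.
  rewrite ler_pdivrMr// mulrC -ler_pdivrMr//.
  rewrite (@le_trans _ _ n%:R)// ?ler_nat//; near: n; exact: nbhs_infty_ger.
have [|b bb0] := @ray_exists _ X b0.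
  exists (speed g) => [|t t']; first exact: speed_ge0.
  rewrite /= !in_itv/= !andbT => t0 t'0.
  apply: (@cvg_unique R^o _ ((mdist x (g n.+1%:R) / n.+1%:R * `|t - t'|) @[n --> \oo])).
  - exact: Rhausdorff.
  - apply: cvg_trans (cvg_mdist _ (b0P _ t0) (b0P _ t'0)).
    apply: near_eq_cvg; near=> n.
    have tn : 0 <= t / n.+1%:R <= 1.
      rewrite divr_ge0// ler_pdivrMr// mul1r.
      rewrite (@le_trans _ _ n%:R)// ?ler_nat//; near: n; exact: nbhs_infty_ger.
    have t'n : 0 <= t' / n.+1%:R <= 1.
      rewrite divr_ge0// ler_pdivrMr// mul1r.
      rewrite (@le_trans _ _ n%:R)// ?ler_nat//; near: n; exact: nbhs_infty_ger.
    rewrite (geodesic_segment_dist (segP n))// -mulrBl normrM normfV.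
    by rewrite (ger0_norm (ler0n _ _)); ring.
  - by apply: cvgM => //; exact: cvg_cst.
exists b; split; first by rewrite bb0.
exists a => t t0; rewrite metric_sym bb0//.
have bg : mdist (seg n (t / n.+1%:R)) (g t) @[n --> \oo] --> mdist (b0 t) (g t).
  by apply: cvg_mdistl; exact: b0P.
rewrite -(cvg_lim _ bg)//; apply: limr_le; first by apply/cvg_ex; eexists; exact: bg.
near=> n; apply: near_g => //.
rewrite (@le_trans _ _ n%:R)// ?ler_nat//; near: n; exact: nbhs_infty_ger.
Unshelve. all: by end_near. Qed.

End asymptotic_rays.

(** * Points of the cone as asymptote classes *)

Section boundary_cone.
Context {R : realType} (X : completeMetricType R).
Implicit Types (g h b : ray X) (xi : boundary X) (x y : cone X).

Lemma unit_reparamE g (g0 : 0 < speed g) (t : R) :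
  unit_reparam g0 t = g (t / speed g).
Proof. by []. Qed.

Lemma asymptotic_unit_reparam g h (g0 : 0 < speed g) (h0 : 0 < speed h) :
  speed g = speed h ->
  asymptotic mdist (unit_reparam g0) (unit_reparam h0) <-> asymptotic mdist g h.
Proof.
move=> gh; split=> -[C hC]; exists C => t t0.
  have := hC (t * speed g); rewrite !unit_reparamE -gh !mulfK ?gt_eqF//; apply.
  by rewrite mulr_ge0// ltW.
by rewrite !unit_reparamE -gh; apply: hC; rewrite divr_ge0// ltW.
Qed.

Lemma asymptote_classE g h : unit_ray g -> unit_ray h ->
  asymptote_class g = asymptote_class h <-> asymptotic mdist g h.
Proof.
move=> ug uh; split=> [e|gh].
  have : asymptote_class g h by rewrite e; split => //; exact: asymptotic_refl.
  by case.
apply/seteqP; split=> b [ub gb]; split=> //; last exact: asymptotic_trans gh gb.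
exact: asymptotic_trans (asymptotic_sym gh) gb.
Qed.

Lemma boundary_class_eq g h (ug : unit_ray g) (uh : unit_ray h) :
  boundary_class ug = boundary_class uh <-> asymptotic mdist g h.
Proof.
rewrite -asymptote_classE//; split=> [/(congr1 set_val)//|e].
exact: val_inj.
Qed.

Lemma e_infty_eq g h : e_infty g = e_infty h <-> asymptotic mdist g h.
Proof.
rewrite /e_infty; case: pselect => [g0|ng]; case: pselect => [h0|nh].
- split=> [e|gh].
    have /boundary_class_eq e1 := congr1 (fun o : cone X =>
      if o is Some p then p.1 else boundary_class (speed_unit_reparam g0)) e.
    have e2 := congr1 (fun o : cone X => if o is Some p then sval p.2 else 0) e.
    by apply/(asymptotic_unit_reparam g0 h0).
  have e := asymptotic_speed gh; congr (Some (_, _)); last first.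
    by apply: eq_exist.
  by apply/boundary_class_eq/asymptotic_unit_reparam.
- by split=> // /asymptotic_speed e; move: nh; rewrite -e.
- by split=> // /asymptotic_speed e; move: ng; rewrite e.
- split=> // _; exists (mdist (g 0) (h 0)) => t t0.
  have s0 (f : ray X) : ~ (0 < speed f) -> speed f = 0.
    by move=> /negP; rewrite -leNgt => f0; apply: le_anti; rewrite f0 speed_ge0.
  by rewrite (speed0_cst (s0 g ng) t0) (speed0_cst (s0 h nh) t0).
Qed.

Lemma boundaryP xi : exists g (ug : unit_ray g), xi = boundary_class ug.
Proof.
have [g ug gxi] := set_valP xi; exists g, ug; exact/val_inj/esym.
Qed.

Lemma e_infty_surj x : exists g, e_infty g = x.
Proof.
case: x => [[xi [s s0]]|]; last first.
  exists (cst_ray point); rewrite /e_infty; case: pselect => // h.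
  by exfalso; move: h; rewrite /speed mdistxx ltxx.
have [g [ug ->]] := boundaryP xi; have [h hg] := ray_scale_exists g (ltW s0).
have sh : speed h = s.
  by rewrite /speed !hg// mulr0 mulr1 speedP ?(ltW s0)// ug mul1r sub0r normrN gtr0_norm.
exists h; rewrite /e_infty; case: pselect => [h0|]; last by rewrite sh.
congr (Some (_, _)); last by apply: eq_exist.
apply/boundary_class_eq; exists 0 => t t0; rewrite unit_reparamE hg ?divr_ge0 ?(ltW h0)//.
by rewrite sh mulrC divfK ?gt_eqF// mdistxx.
Qed.

Lemma cone_rayK x : e_infty (cone_ray x) = x.
Proof.
rewrite /cone_ray; case: xgetP => [g _ //|/= nx].
by have [g gx] := e_infty_surj x; have := nx g; rewrite /= gx.
Qed.

Hypothesis hX : hadamard X.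

Lemma based_rayP g (ug : unit_ray g) (b := based_ray (boundary_class ug)) :
  [/\ b 0 = point, unit_ray b & asymptotic mdist g b].
Proof.
rewrite /b /based_ray; case: xgetP => [f _ /=[[uf gf] f0]//|/= nx].
have [f [f0 gf]] := asymptotic_based_exists hX g point.
have := nx f; case; split=> //; split=> //.
by rewrite /unit_ray/= -(asymptotic_speed gf).
Qed.

(** A canonical representative of each class. As all of them start at [point], two of them are at
    distance at most [t * d_infty] at time t, with no additive constant. *)
Definition cone_point x (t : R) : X :=
  if x is Some (xi, s) then based_ray xi (sval s * t) else point.

Lemma cone_point_e_infty g : exists b,
  [/\ b 0 = point, asymptotic mdist g b &
      forall t, 0 <= t -> cone_point (e_infty g) t = b t].
Proof.
rewrite /e_infty; case: pselect => [g0|ng]; last first.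
  exists (cst_ray point); split => //; exists (mdist (g 0) point) => t t0.
  rewrite speed0_cst//; apply: le_anti; rewrite speed_ge0 andbT leNgt; exact/negP.
have [f0 uf gf] := based_rayP (speed_unit_reparam g0).
have [b bf] := ray_scale_exists (based_ray (boundary_class (speed_unit_reparam g0))) (ltW g0).
exists b; split; first by rewrite bf// mulr0.
  have [C hC] := gf; exists C => t t0; rewrite bf//.
  have := hC (speed g * t); rewrite unit_reparamE.
  by rewrite [X in g X]mulrAC divff ?gt_eqF// mul1r; apply; rewrite mulr_ge0// ltW.
by move=> t t0; rewrite bf.
Qed.

End boundary_cone.

(** * The asymptotic distance as a limit of slopes *)

Section asymptotic_distance.
Context {R : realType}.

Lemma cvg_inv_pinfty (C : R) : C / t @[t --> +oo] --> (0 : R).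
Proof.
apply/cvgrPdist_le => e e0; near=> t.
have t0 : 0 < t by near: t; exact: nbhs_pinfty_gt.
rewrite sub0r normrN normrM normfV (gtr0_norm t0) ler_pdivrMr// mulrC.
by rewrite -ler_pdivrMr.
Unshelve. all: by end_near. Qed.

Context (X : completeMetricType R).
Hypothesis hX : hadamard X.
Implicit Types (g h b : ray X).

Lemma ray_slope_ge g h (t T : R) : 0 < t -> t <= T ->
  (mdist (g t) (h t) - mdist (g 0) (h 0)) / t <=
  (mdist (g T) (h T) - mdist (g 0) (h 0)) / T.
Proof.
move=> t0 tT; have T0 := lt_le_trans t0 tT.
rewrite ler_pdivrMr// mulrAC ler_pdivlMr//.
by have := ray_convex0 hX g h (ltW t0) tT; lra.
Qed.

Lemma ray_dist_growth g h (t : R) : 0 <= t ->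
  mdist (g t) (h t) <= mdist (g 0) (h 0) + t * (speed g + speed h).
Proof.
move=> t0; have := metric_triangle (g t) (g 0) (h t).
have := metric_triangle (g 0) (h 0) (h t).
by rewrite !speedP// subr0 sub0r normrN ger0_norm// => *; lra.
Qed.

Lemma ray_slope_cvg g h : exists2 l : R,
  (forall t : R, 0 < t -> (mdist (g t) (h t) - mdist (g 0) (h 0)) / t <= l) &
  (mdist (g t) (h t) - mdist (g 0) (h 0)) / t @[t --> +oo] --> l.
Proof.
pose f t := (mdist (g t) (h t) - mdist (g 0) (h 0)) / t.
(* The slope is monotone for positive times only; freezing it below 1 makes it monotone on the whole
   line and does not affect the limit. *)
pose f1 t := f (Num.max 1 t).
have p1 (t : R) : 0 < Num.max 1 t by rewrite lt_max ltr01.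
have ndf : nondecreasing_fun f1.
  by move=> s t st; apply: ray_slope_ge => //; rewrite ge_max !le_max lexx st orbT.
have ubf : has_ubound (range f1).
  exists (speed g + speed h) => _ [t _ <-]; rewrite /f1 /f ler_pdivrMr//.
  by have := ray_dist_growth g h (ltW (p1 t)); lra.
have cf := nondecreasing_cvgr ndf ubf.
exists (sup (range f1)).
  move=> t t0; apply: (@le_trans _ _ (f1 t)).
    by apply: ray_slope_ge => //; rewrite le_max lexx orbT.
  by apply: sup_ubound => //; exists t.
apply: cvg_trans cf; apply: near_eq_cvg; near=> t.
rewrite /f1 max_r//; near: t; exact: nbhs_pinfty_ge.
Unshelve. all: by end_near. Qed.

Lemma ray_d_infty_cvg g h :
  mdist (g t) (h t) / t @[t --> +oo] --> ray_d_infty g h.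
Proof.
have [l _ fl] := ray_slope_cvg g h; apply/cvg_ex; exists l => /=.
rewrite -[l]addr0; apply: cvg_trans (cvgD fl (@cvg_inv_pinfty (mdist (g 0) (h 0)))).
by apply: near_eq_cvg; near=> t; rewrite fctE -mulrDl subrK.
Unshelve. all: by end_near. Qed.

Lemma ray_d_infty_ge0 g h : 0 <= ray_d_infty g h.
Proof.
apply: limr_ge; first by apply/cvg_ex; eexists; exact: ray_d_infty_cvg.
near=> t; rewrite divr_ge0 ?mdist_ge0//; near: t; exact: nbhs_pinfty_ge.
Unshelve. all: by end_near. Qed.

(** The slopes increase to their limit, and this limit is [ray_d_infty] because
    [mdist (g 0) (h 0) / t] tends to 0. *)
Lemma ray_dist_le g h (t : R) : 0 <= t ->
  mdist (g t) (h t) <= mdist (g 0) (h 0) + t * ray_d_infty g h.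
Proof.
rewrite le_eqVlt => /predU1P[<-|t0]; first by rewrite mul0r addr0.
have [l fle fl] := ray_slope_cvg g h.
have fd : (mdist (g t) (h t) - mdist (g 0) (h 0)) / t @[t --> +oo] --> ray_d_infty g h.
  rewrite -[ray_d_infty _ _]subr0.
  apply: cvg_trans (cvgB (@ray_d_infty_cvg g h) (@cvg_inv_pinfty (mdist (g 0) (h 0)))).
  by apply: near_eq_cvg; near=> u; rewrite fctE -mulrBl.
have -> : ray_d_infty g h = l by exact: (cvg_unique (@Rhausdorff R) fd fl).
by have := fle t t0; rewrite ler_pdivrMr//; lra.
Unshelve. all: by end_near. Qed.

Lemma ray_d_infty_le g h : ray_d_infty g h <= speed g + speed h.
Proof.
rewrite -[leRHS]addr0.
have c : (speed g + speed h) + mdist (g 0) (h 0) / t @[t --> +oo] -->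
    speed g + speed h + 0.
  by apply: cvgD; [exact: cvg_cst | exact: cvg_inv_pinfty].
rewrite -(cvg_lim _ c)//.
apply: ler_lim; [by apply/cvg_ex; eexists; exact: ray_d_infty_cvg|by apply/cvg_ex; eexists; exact: c|].
near=> t; have t0 : 0 < t by near: t; exact: nbhs_pinfty_gt.
rewrite ler_pdivrMr// mulrDl divfK ?gt_eqF//.
by have := ray_dist_growth g h (ltW t0); lra.
Unshelve. all: by end_near. Qed.

Lemma ray_d_infty_asymptotic g h g' h' :
  asymptotic mdist g g' -> asymptotic mdist h h' ->
  ray_d_infty g h = ray_d_infty g' h'.
Proof.
move=> [C gC] [D hD].
apply: (@cvg_unique R^o _ (mdist (g' t) (h' t) / t @[t --> +oo])).
- exact: Rhausdorff.
- rewrite -[ray_d_infty _ _]addr0.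
  have d0 : mdist (g' t) (h' t) / t - mdist (g t) (h t) / t @[t --> +oo] --> (0 : R).
    apply/cvgrPdist_le => e e0; near=> t.
    have t0 : 0 < t by near: t; exact: nbhs_pinfty_gt.
    rewrite sub0r normrN -mulrBl normrM normfV (gtr0_norm t0) ler_pdivrMr//.
    rewrite (@le_trans _ _ (C + D))//.
      rewrite distrC (le_trans (mdist_lipschitz _ _ _ _))//.
      by rewrite lerD ?gC ?hD// ltW.
    by rewrite mulrC -ler_pdivrMr.
  apply: cvg_trans (cvgD (@ray_d_infty_cvg g h) d0).
  by apply: near_eq_cvg; near=> t; rewrite fctE addrC subrK.
- exact: ray_d_infty_cvg.
Unshelve. all: by end_near. Qed.

Lemma d_infty_e_infty g h : d_infty (e_infty g) (e_infty h) = ray_d_infty g h.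
Proof.
by apply: ray_d_infty_asymptotic; apply/e_infty_eq; rewrite cone_rayK.
Qed.

Lemma d_infty_ge0 (x y : cone X) : 0 <= d_infty x y.
Proof. exact: ray_d_infty_ge0. Qed.

Lemma d_inftyxx (x : cone X) : d_infty x x = 0.
Proof.
have c : mdist (cone_ray x t) (cone_ray x t) / t @[t --> +oo] --> (0 : R).
  have -> : (fun t : R => mdist (cone_ray x t) (cone_ray x t) / t) = cst 0.
    by apply/funext => t; rewrite mdistxx mul0r.
  exact: cvg_cst.
exact: (cvg_unique (@Rhausdorff R) (@ray_d_infty_cvg _ _) c).
Qed.

Lemma d_infty_eq0 (x y : cone X) : d_infty x y = 0 -> x = y.
Proof.
move=> d0; rewrite -(cone_rayK x) -(cone_rayK y); apply/e_infty_eq.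
exists (mdist (cone_ray x 0) (cone_ray y 0)) => t t0.
by rewrite (le_trans (ray_dist_le _ _ t0))// [ray_d_infty _ _]d0 mulr0 addr0.
Qed.

Lemma cone_point_dist_le (x y : cone X) (t : R) : 0 <= t ->
  mdist (cone_point x t) (cone_point y t) <= t * d_infty x y.
Proof.
move=> t0; have [g <-] := e_infty_surj x; have [h <-] := e_infty_surj y.
have [b [b0 gb ->//]] := cone_point_e_infty hX g.
have [c [c0 hc ->//]] := cone_point_e_infty hX h.
rewrite d_infty_e_infty (ray_d_infty_asymptotic gb hc).
by have := ray_dist_le b c t0; rewrite b0 c0 mdistxx add0r.
Qed.

Lemma cone_point_near g (t : R) : 0 <= t ->
  mdist (g t) (cone_point (e_infty g) t) <= mdist (g 0) point.
Proof.
move=> t0; have [b [b0 gb ->//]] := cone_point_e_infty hX g.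
by rewrite -b0; exact: asymptotic_dist.
Qed.

Lemma cone_point_d_infty_cvg (x y : cone X) :
  mdist (cone_point x t) (cone_point y t) / t @[t --> +oo] --> d_infty x y.
Proof.
have [g <-] := e_infty_surj x; have [h <-] := e_infty_surj y.
have [b [b0 gb bE]] := cone_point_e_infty hX g.
have [c [c0 hc cE]] := cone_point_e_infty hX h.
rewrite d_infty_e_infty (ray_d_infty_asymptotic gb hc).
apply: cvg_trans (@ray_d_infty_cvg b c); apply: near_eq_cvg; near=> t.
have t0 : 0 <= t by near: t; exact: nbhs_pinfty_ge.
by rewrite bE// cE.
Unshelve. all: by end_near. Qed.

End asymptotic_distance.

(** * The topologies of the space of rays and of the cone *)

Section borel_maps.

Lemma borel_measurable_continuous (T S : ptopologicalType) (f : T -> S) :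
  continuous f -> measurable_fun [set: borel T] (f : borel T -> borel S).
Proof.
move=> /continuousP cf; apply: (@measurability _ _ (borel T) (borel S) setT f open) => //.
by move=> _ [U oU <-]; rewrite setTI; apply: sub_sigma_algebra; exact: cf.
Qed.

Context {R : realType} (X : completeMetricType R).

Lemma open_mdist_lt (x : X) (e : R) : open [set y | mdist x y < e].
Proof. 
rewrite openE => y /= xy; rewrite /interior -filter_from_ballE.
exists (e - mdist x y); first by rewrite /= subr_gt0.
move=> z; rewrite ballEmdist/= => yz.
by rewrite (le_lt_trans (metric_triangle _ y _))// -ltrBrDl.
Qed.

Lemma dense_seq_exists : (exists2 D : set X, countable D & dense D) ->
  exists q : nat -> X, forall (x : X) (e : R), 0 < e -> exists i, mdist (q i) x < e.
Proof.
move=> [D /countable_injP[f] fi dD].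
exists (fun n => xget point [set x | D x /\ f x = n]) => x e e0.
have [||y [/= xy Dy]] := dD [set y | mdist x y < e].
- by exists x; rewrite /= mdistxx.
- exact: open_mdist_lt.
exists (f y); rewrite metric_sym; case: xgetP => [z _ /= [Dz fzy]|/= /(_ y)[]//].
by have -> : z = y by apply: fi => //; rewrite inE.
Qed.

End borel_maps.

Section separable_metric.
Context {R : realType} (X : completeMetricType R) (q : nat -> X).
Hypothesis qd : forall (x : X) (e : R), 0 < e -> exists i, mdist (q i) x < e.

Lemma open_bigcup_balls (U : set X) : open U ->
  U = \bigcup_(p in [set p : nat * nat | [set y | mdist (q p.1) y < p.2.+1%:R^-1] `<=` U])
      [set y | mdist (q p.1) y < p.2.+1%:R^-1].
Proof.
move=> oU; apply/seteqP; split=> [x Ux|x [p /= pU px]]; last exact: pU.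
have [e /= e0 eU] : exists2 e : R, 0 < e & [set y | mdist x y < e] `<=` U.
  move: oU; rewrite openE => /(_ _ Ux).
  rewrite /interior -filter_from_ballE => -[e e0 eU].
  by exists e => //; rewrite -ballEmdist.
have [k ke] : exists k, k.+1%:R^-1 < e / 2.
  have e20 : 0 < e / 2 by rewrite divr_gt0.
  near \oo => k; exists k; near: k; exact: near_infty_natSinv_lt (PosNum e20).
have k0 : 0 < k.+1%:R^-1 :> R by rewrite invr_gt0.
have [i ix] := qd x k0.
exists (i, k) => //= y /= iy; apply: eU => /=.
apply: le_lt_trans (metric_triangle _ (q i) _) _; rewrite metric_sym [e]splitr.
by rewrite ltrD//; [exact: lt_trans ix ke | exact: lt_trans iy ke].
Unshelve. all: by end_near. Qed.

Context d (T : measurableType d).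

Lemma countable_bigcup_measurable (I : countType) (P : set I) (F : I -> set T) :
  (forall i, P i -> measurable (F i)) -> measurable (\bigcup_(i in P) F i).
Proof.
move=> mF; rewrite bigcup_mkcond; apply: countable_bigcupT_measurable => // i.
by case: ifPn => // /set_mem; exact: mF.
Qed.

Lemma measurable_lt_cst (f : T -> R) (c : R) :
  measurable_fun setT f -> measurable [set x | f x < c].
Proof.
move=> mf; have := mf measurableT `]-oo, c[%classic (measurable_itv _).
by rewrite setTI; congr measurable; apply/seteqP; split=> x; rewrite /= in_itv.
Qed.

Lemma measurable_borel_mdist (f : T -> X) :
  (forall i, measurable_fun setT (fun x => mdist (q i) (f x))) ->
  measurable_fun setT (f : T -> borel X).
Proof.
move=> mf; apply: (@measurability _ _ T (borel X) setT f open) => //.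
move=> _ [U oU <-]; rewrite setTI (open_bigcup_balls oU) preimage_bigcup.
apply: countable_bigcup_measurable => -[i k] _.
exact: measurable_lt_cst.
Qed.

Lemma borel_measurable_mdist (a : X) :
  measurable_fun [set: borel X] (fun y : borel X => mdist a (y : X)).
Proof.
apply: (measurability _ (RGenInftyO.measurableE R)) => //.
move=> _ [_ [c ->] <-]; rewrite setTI; apply: sub_sigma_algebra.
suff -> : (fun y : borel X => mdist a (y : X)) @^-1` `]-oo, c[ =
  [set y | mdist a y < c] by exact: open_mdist_lt.
by apply/seteqP; split=> x; rewrite /= in_itv.
Qed.

(** The distance is below c exactly when some dense point has distances to [f x] and [g x] of sum
    below c: take it within half the gap of [f x]. Only distances to fixed points are then involved,
    and no Borel structure on the product. *)
Lemma measurable_mdist (f g : T -> X) :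
  measurable_fun setT (f : T -> borel X) -> measurable_fun setT (g : T -> borel X) ->
  measurable_fun setT (fun x => mdist (f x) (g x)).
Proof.
move=> mf mg; apply: (measurability _ (RGenInftyO.measurableE R)) => //.
move=> _ [_ [c ->] <-]; rewrite setTI.
suff -> : (fun x => mdist (f x) (g x)) @^-1` `]-oo, c[ =
    \bigcup_i [set x | mdist (q i) (f x) + mdist (q i) (g x) < c].
  apply: countable_bigcup_measurable => i _.
  apply: measurable_lt_cst; apply: measurable_funD.
    exact: measurableT_comp (borel_measurable_mdist (q i)) mf.
  exact: measurableT_comp (borel_measurable_mdist (q i)) mg.
apply/seteqP; split=> x /=; rewrite in_itv/=.
  move=> fgc; have c0 : 0 < (c - mdist (f x) (g x)) / 2 by rewrite divr_gt0// subr_gt0.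
  have [i ifx] := qd (f x) c0; exists i => //=.
  by have := metric_triangle (q i) (f x) (g x); lra.
move=> [i _ /=]; apply: le_lt_trans.
by rewrite (metric_sym (q i) (f x)) metric_triangle.
Qed.

End separable_metric.

(** * Uniform convergence of rays on compact sets *)

Section ray_topology.
Context {R : realType} (X : completeMetricType R).
Implicit Types (g h : ray X).

Lemma near_ray_eval g (t e : R) : 0 < e -> \forall h \near g, mdist (g t) (ray_fun h t) < e.
Proof.
move=> e0; pose E := [set p : X * X | mdist p.1 p.2 < e].
have entE : entourage E.
  by rewrite -entourage_ballE; exists e => // -[x y] /=; rewrite ballEmdist.
have := @fam_nbhs R X compact [set t] E (set_val g) entE (@compact_set1 _ t).
move=> /(@initial_continuous _ _ (set_val : ray X -> {family compact, R -> X}) g) H.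
by apply: (@filterS _ (nbhs g) (nbhs_filter g) _ _ _ H) => h /= /(_ t erefl).
Qed.

Lemma ray_eval_continuous (t : R) : continuous (fun g => (g : ray X) t : X).
Proof.
move=> g.
apply/(@metricType_numDomainType.cvgrPdist_lt _ _ _ (nbhs g) (nbhs_filter g)) => e e0.
exact: near_ray_eval.
Qed.

Hypothesis hX : hadamard X.

(** By convexity, closeness at times 0 and n is closeness on all of [0, n]. Two evaluations thus
    generate the neighbourhoods of a ray, although the topology is one of uniform convergence. *)
Definition ray_close (n : nat) (e : R) g : set (ray X) :=
  [set h | mdist (g 0) (h 0) < e /\ mdist (g n%:R) (h n%:R) < e].

Lemma ray_close_le n e g h (t : R) : ray_close n e g h -> t <= n%:R ->
  mdist (g t) (h t) < e.
Proof.
move=> [c0 cn] tn; have [t0|/ltW t0] := leP 0 t; last by rewrite !(ray_neg _ t0).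
have [n0|nn0] := posnP n.
  by have -> : t = 0 by apply: le_anti; rewrite t0 (le_trans tn)// n0.
have np : 0 < n%:R :> R by rewrite ltr0n.
have [M [M0 Mn Me]] : exists M,
    [/\ mdist (g 0) (h 0) <= M, mdist (g n%:R) (h n%:R) <= M & M < e].
  by exists (Num.max (mdist (g 0) (h 0)) (mdist (g n%:R) (h n%:R)));
    rewrite !le_max !lexx orbT gt_max c0 cn.
apply: le_lt_trans Me; rewrite -(ler_pM2l np).
apply: le_trans (ray_convex0 hX g h t0 tn) _.
rewrite (_ : n%:R * M = (n%:R - t) * M + t * M); last by ring.
by rewrite lerD// ler_wpM2l// subr_ge0.
Qed.

Lemma nbhs_ray_close g (U : set (ray X)) : nbhs g U ->
  exists n, exists2 e : R, 0 < e & ray_close n e g `<=` U.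
Proof.
move=> [_ [[W oW <-] Wg WU]].
(* The filter generated by the traces of the sets [ray_close], on functions rather than rays, where
   uniform convergence on compact sets is defined. It suffices that it converges to g. *)
pose F : set_system (R -> X) := [set A | exists n, exists2 e : R, 0 < e &
  forall h : ray X, ray_close n e g h -> A (set_val h)].
have FF : Filter F.
  split.
  - by exists 0%N, 1.
  - move=> A B [n [e e0 nA]] [m [f f0 mB]].
    exists (maxn n m), (Num.min e f); first by rewrite lt_min e0.
    move=> h hc; split.
      apply: nA; split.
        by apply: lt_le_trans (ray_close_le hc _) _; rewrite ?ge_min ?lexx.
      apply: lt_le_trans (ray_close_le hc _) _; last by rewrite ge_min lexx.
      by rewrite ler_nat leq_maxl.
    apply: mB; split.
      by apply: lt_le_trans (ray_close_le hc _) _; rewrite ?ge_min ?lexx ?orbT.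
    apply: lt_le_trans (ray_close_le hc _) _; last by rewrite ge_min lexx orbT.
    by rewrite ler_nat leq_maxr.
  - by move=> A B AB [n [e e0 nA]]; exists n, e => // h /nA /AB.
have Fg : {family compact, F --> (set_val g : R -> X)}.
  apply/fam_cvgP => A cA P /uniform_nbhs [E [entE EP]].
  have [M [_ AM]] := compact_bounded cA.
  pose n := (Num.truncn (M + 1)).+1.
  move: entE; rewrite -entourage_ballE => -[e e0 eE].
  exists n, e => // h hc; apply: EP => y Ay; apply: eE => /=.
  (* Only an upper bound on the times in A is required: [ray_close_le] covers negative times, where
     rays are constant. *)
  rewrite ballEmdist; apply: (ray_close_le hc).
  have := AM (M + 1); rewrite ltrDl => /(_ ltr01 y Ay)/= yM.
  rewrite (le_trans (ler_norm y))// (le_trans yM)// ltW// /n.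
  exact: Num.Theory.truncnS_gt.
have [n [e e0 nW]] : F W by apply: Fg; move: oW; rewrite openE; exact.
by exists n, e => // h /nW Wh; exact: WU.
Qed.

Variable q : nat -> X.
Hypothesis qd : forall (x : X) (e : R), 0 < e -> exists i, mdist (q i) x < e.

(** A countable base made of conditions on two integer times; Borel measurability of a map into rays
    thereby reduces to its evaluations at integers. *)
Lemma open_bigcup_ray (U : set (ray X)) (V := fun p : (nat * nat) * (nat * nat) =>
    [set h : ray X | mdist (q p.2.1) (h 0) < p.1.2.+1%:R^-1 /\
                     mdist (q p.2.2) (h p.1.1%:R) < p.1.2.+1%:R^-1]) : open U ->
  U = \bigcup_(p in [set p | V p `<=` U]) V p.
Proof.
move=> oU; apply/seteqP; split=> [x Ux|x [p /= pU px]]; last exact: pU.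
have [n [e e0 eU]] : exists n, exists2 e : R, 0 < e & ray_close n e x `<=` U.
  by apply: nbhs_ray_close; move: oU; rewrite openE; exact.
have [k ke] : exists k, k.+1%:R^-1 < e / 2.
  have e20 : 0 < e / 2 by rewrite divr_gt0.
  near \oo => k; exists k; near: k; exact: near_infty_natSinv_lt (PosNum e20).
have k0 : 0 < k.+1%:R^-1 :> R by rewrite invr_gt0.
have [i ix] := qd (x 0) k0; have [j jx] := qd (x n%:R) k0.
exists ((n, k), (i, j)) => //= y [/= iy jy]; apply: eU; split.
  apply: le_lt_trans (metric_triangle _ (q i) _) _; rewrite metric_sym [e]splitr.
  by rewrite ltrD//; [exact: lt_trans ix ke | exact: lt_trans iy ke].
apply: le_lt_trans (metric_triangle _ (q j) _) _; rewrite metric_sym [e]splitr.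
by rewrite ltrD//; [exact: lt_trans jx ke | exact: lt_trans jy ke].
Unshelve. all: by end_near. Qed.

Lemma measurable_ray_eval (t : R) :
  measurable_fun [set: borel (ray X)] (fun g : borel (ray X) => (g : ray X) t : borel X).
Proof. apply: borel_measurable_continuous; exact: ray_eval_continuous. Qed.

Lemma measurable_borel_ray d (T : measurableType d) (f : T -> ray X) :
  (forall n : nat, measurable_fun setT (fun x => f x n%:R : borel X)) ->
  measurable_fun setT (f : T -> borel (ray X)).
Proof.
move=> mf; apply: (@measurability _ _ T (borel (ray X)) setT f open) => //.
move=> _ [U oU <-]; rewrite setTI (open_bigcup_ray oU) preimage_bigcup.
apply: countable_bigcup_measurable => -[[n k] [i j]] _.
have mq a m : measurable_fun setT (fun x => mdist (q a) (f x m%:R)).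
  exact: measurableT_comp (borel_measurable_mdist (q a)) (mf m).
rewrite [X in measurable X](_ : _ = [set x | mdist (q i) (f x 0%:R) < k.+1%:R^-1] `&`
  [set x | mdist (q j) (f x n%:R) < k.+1%:R^-1])//.
by apply: measurableI; exact: measurable_lt_cst.
Qed.

End ray_topology.

(** * The quotient topology of the cone and the map to infinity *)

Section cone_topology.
Context {R : realType} (X : completeMetricType R).
Hypothesis hX : hadamard X.
Implicit Types (g h b : ray X) (xi : boundary X).

Lemma cone_point_proj (p : boundary X * [set` `[0%R, +oo[ : interval R]) (t : R) :
  cone_point (cone_proj p) t = based_ray p.1 (set_val p.2 * t).
Proof.
rewrite /cone_proj; case: insubP => [u u0 ue|n0] /=; first by rewrite -ue.
have [g [ug e]] := boundaryP p.1; have [b0 _ _] := based_rayP hX ug.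
have s0 : set_val p.2 = 0.
  have := set_valP p.2; rewrite /= in_itv/= andbT => s0.
  by apply: le_anti; rewrite s0 andbT leNgt.
by rewrite s0 mul0r e b0.
Qed.

Lemma based_ray_unit xi : speed (based_ray xi) = 1.
Proof. by have [g [ug ->]] := boundaryP xi; have [_ ->] := based_rayP hX ug. Qed.

Lemma cone_point_continuous (t : R) : 0 <= t ->
  continuous (fun x : cone X => cone_point x t).
Proof.
move=> t0; apply/continuousP => V oV; rewrite /open/= /cone_open.
pose f (p : boundary X * [set` `[0%R, +oo[ : interval R]) :=
  based_ray p.1 (set_val p.2 * t).
suff /continuousP/(_ V oV) : continuous f.
  by congr open; apply/seteqP; split=> p /=; rewrite cone_point_proj.
move=> [xi s]; apply/(@metricType_numDomainType.cvgrPdist_lt _ _ _ _ (nbhs_filter _)).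
move=> e e0; have e2 : 0 < e / 2 by rewrite divr_gt0.
have s0 (u : [set` `[0%R, +oo[ : interval R]) : 0 <= set_val u.
  by have := set_valP u; rewrite /= in_itv/= andbT.
have n1 : \forall z \near xi, mdist (based_ray xi (set_val s * t)) (based_ray z (set_val s * t)) < e / 2.
  have := near_ray_eval (based_ray xi) (set_val s * t) e2.
  exact: (@initial_continuous _ _ (@based_ray R X) xi).
(* Based rays have unit speed, so the position moves by t times the change of the speed coordinate;
   [t + 1] covers t = 0. *)
have d0 : 0 < e / 2 / (t + 1) by rewrite divr_gt0// ltr_wpDl.
have n2 : \forall u \near s, `|set_val s - set_val u| < e / 2 / (t + 1).
  have := @initial_continuous _ _ (set_val : [set` `[0%R, +oo[ : interval R] -> R) s.
  by move=> /cvgrPdist_lt; apply.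
exists ([set z | mdist (based_ray xi (set_val s * t)) (based_ray z (set_val s * t)) < e / 2],
        [set u | `|set_val s - set_val u| < e / 2 / (t + 1)]) => //.
move=> [z u] /= [hz hu]; rewrite /f/=.
apply: le_lt_trans (metric_triangle _ (based_ray z (set_val s * t)) _) _.
rewrite [e]splitr ltrD// (speedP _ (mulr_ge0 (s0 s) t0) (mulr_ge0 (s0 u) t0)).
rewrite based_ray_unit mul1r -mulrBl normrM (ger0_norm t0).
apply: (@le_lt_trans _ _ (`|set_val s - set_val u| * (t + 1))).
  by rewrite ler_wpM2l// lerDl.
by rewrite -ltr_pdivlMr// ltr_wpDl.
Qed.

Lemma speed_near g (e : R) : 0 < e -> \forall h \near g, `|speed g - speed h| < e.
Proof.
move=> e0; have e2 : 0 < e / 2 by rewrite divr_gt0.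
have F := nbhs_filter g.
near=> h; apply: le_lt_trans (mdist_lipschitz _ _ _ _) _; rewrite [e]splitr.
by rewrite ltrD//; near: h; exact: near_ray_eval.
Unshelve. all: by end_near. Qed.

Lemma speed_gt0_near g : 0 < speed g -> \forall h \near g, 0 < speed h.
Proof.
move=> g0; have F := nbhs_filter g; near=> h.
have : `|speed g - speed h| < speed g by near: h; exact: speed_near.
by rewrite ltr_distlC => /andP[+ _]; rewrite subrr.
Unshelve. all: by end_near. Qed.

Definition unit_class g (g0 : 0 < speed g) := boundary_class (speed_unit_reparam g0).

(* If h is close to g up to a large time T, the rays issued from the base point
   are at distance at most 2 a + 2 at time T, where a = d(g 0, point), hence, by
   convexity, at distance at most (n / T) (2 a + 2) up to time n. *)
Lemma based_ray_near g (g0 : 0 < speed g) n (e : R) : 0 < e ->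
  \forall h \near g, forall h0 : 0 < speed h,
    ray_close n e (based_ray (unit_class g0)) (based_ray (unit_class h0)).
Proof.
move=> e0; pose a := mdist (g 0) point; have a0 : 0 <= a := mdist_ge0 _ _.
(* T is beyond n and large enough that [n / T * (2 * a + 2) < e]. *)
pose T := n%:R * (2 * a + 2) / e + n%:R + 1.
have nT0 : 0 <= n%:R * (2 * a + 2) / e.
  by rewrite divr_ge0 ?(ltW e0)// mulr_ge0//; lra.
have nT : n%:R <= T by rewrite /T; lra.
have T0 : 0 < T by rewrite /T; have := ler0n R n; lra.
have Te : n%:R * (2 * a + 2) < T * e.
  have : n%:R * (2 * a + 2) / e < T by rewrite /T; have := ler0n R n; lra.
  by rewrite ltr_pdivrMr.
have F := nbhs_filter g; near=> h => h0.
have [bg0 _ gbg] := based_rayP hX (speed_unit_reparam g0).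
have [bh0 _ hbh] := based_rayP hX (speed_unit_reparam h0).
have c0 : mdist (g 0) (h 0) < 1 by near: h; exact: near_ray_eval.
have cT : mdist (g (T / speed g)) (h (T / speed g)) < 1 / 2.
  by near: h; exact: near_ray_eval.
(* With such close speeds, h travels at most 1 / 2 between the times [T / speed g] and
   [T / speed h], at which unit reparametrizations reach T. *)
have cs : `|speed g - speed h| < speed g / (2 * T).
  by near: h; apply: speed_near; rewrite divr_gt0// mulr_gt0.
rewrite /unit_class; split; first by rewrite bg0 bh0 mdistxx.
set bg := based_ray _ in bg0 gbg *; set bh := based_ray _ in bh0 hbh *.
have := asymptotic_dist hX gbg (ltW T0); have := asymptotic_dist hX hbh (ltW T0).
rewrite !unit_reparamE !mul0r bg0 bh0 => dh dg.
have gh : mdist (g (T / speed g)) (h (T / speed h)) <= 1.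
  suff h2 : mdist (h (T / speed g)) (h (T / speed h)) <= 1 / 2.
    have := metric_triangle (g (T / speed g)) (h (T / speed g)) (h (T / speed h)).
    by move: cT h2; lra.
  have Tg : 0 < T / speed g by rewrite divr_gt0.
  have Th : 0 < T / speed h by rewrite divr_gt0.
  rewrite (speedP _ (ltW Tg) (ltW Th)).
  have -> : speed h * `|T / speed g - T / speed h| =
            `|speed g - speed h| * (T / speed g).
    rewrite -{1}(gtr0_norm h0) -normrM -{2}(gtr0_norm Tg) -normrM -normrN.
    by congr (`| _ |); field; rewrite !gt_eqF.
  rewrite -ler_pdivlMr//; apply: ltW; apply: lt_le_trans cs _.
  by rewrite le_eqVlt; apply/orP; left; apply/eqP; field; rewrite !gt_eqF.
have hp : mdist (h 0) point <= a + 1.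
  have := metric_triangle (h 0) (g 0) point; rewrite (metric_sym (h 0) (g 0)) -/a.
  by move: c0; lra.
have bT : mdist (bg T) (bh T) <= 2 * a + 2.
  have := metric_triangle (bg T) (g (T / speed g)) (bh T).
  have := metric_triangle (g (T / speed g)) (h (T / speed h)) (bh T).
  by rewrite (metric_sym (bg T) (g (T / speed g))); rewrite -/a in dg; move: dg dh gh hp; lra.
have := ray_convex0 hX bg bh (ler0n _ n) nT.
rewrite bg0 bh0 mdistxx mulr0 add0r => cv.
rewrite -(ltr_pM2l T0); apply: le_lt_trans cv _; apply: le_lt_trans _ Te.
by rewrite ler_wpM2l.
Unshelve. all: by end_near. Qed.

Lemma e_infty_Some g (g0 : 0 < speed g) :
  e_infty g = Some (unit_class g0, exist (fun s : R => 0 < s) _ g0).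
Proof.
rewrite /e_infty; case: pselect => // g0'.
by rewrite (Prop_irrelevance g0' g0).
Qed.

Lemma e_infty_None g : ~ (0 < speed g) -> e_infty g = None.
Proof. by rewrite /e_infty; case: pselect. Qed.

(** At positive speed, the class and the speed both depend continuously on the ray, and U pulls back
    to an open set of such pairs. Constant rays are set apart, since arbitrarily close rays may
    point in any direction. *)
Lemma open_e_infty (U : set (cone X)) : open U ->
  open [set g | 0 < speed g /\ U (e_infty g)].
Proof.
rewrite {1}/open/= /cone_open => oU; rewrite openE => g [g0 Ug].
have s0 : `[0%R, +oo[%classic (speed g) by rewrite /= in_itv/= andbT ltW.
pose p : boundary X * [set` `[0%R, +oo[ : interval R] :=
  (unit_class g0, SigSub (mem_set s0)).
have projE h (h0 : 0 < speed h) (u : [set` `[0%R, +oo[ : interval R]) :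
    set_val u = speed h -> cone_proj (unit_class h0, u) = e_infty h.
  move=> us; rewrite (e_infty_Some h0) /cone_proj/= insubT ?us// => h0'.
  by congr (Some (_, _)); exact: eq_exist.
have : nbhs p (@cone_proj R X @^-1` U).
  by move: oU; rewrite openE; apply; rewrite /= (projE _ g0).
move=> [[A B] /= [nA nB] AB].
have [W oW [Wg WA]] : exists2 W : set (ray X), open W &
    W (based_ray (unit_class g0)) /\ @based_ray R X @^-1` W `<=` A.
  by move: nA => [_ [[W oW <-] Wg WA]]; exists W.
have [n [e e0 nW]] : exists n, exists2 e : R, 0 < e &
    ray_close n e (based_ray (unit_class g0)) `<=` W.
  by apply: (nbhs_ray_close hX); move: oW; rewrite openE; exact.
have [d d0 dB] : exists2 d : R, 0 < d & forall u : [set` `[0%R, +oo[ : interval R],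
    `|speed g - set_val u| < d -> B u.
  move: nB => [_ [[V oV <-] Vg VB]].
  move: oV; rewrite openE => /(_ _ Vg); rewrite /interior -filter_from_ballE.
  by move=> -[d d0 dV]; exists d => // u ud; exact/VB/dV.
have F := nbhs_filter g; rewrite /interior; near=> h.
have h0 : 0 < speed h by near: h; exact: speed_gt0_near.
have hc : forall h0 : 0 < speed h,
    ray_close n e (based_ray (unit_class g0)) (based_ray (unit_class h0)).
  by near: h; exact: based_ray_near.
have hd : `|speed g - speed h| < d by near: h; exact: speed_near.
have hs : `[0%R, +oo[%classic (speed h) by rewrite /= in_itv/= andbT ltW.
split=> //; rewrite -(projE _ h0 (SigSub (mem_set hs)))//; apply: (AB (_, _)); split=> /=.
  exact/WA/nW.
exact: dB.
Unshelve. all: by end_near. Qed.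

(** All constant rays go to the apex and they form a closed set. The preimage of an open set is thus
    open, or the complement of a difference of two open sets if it contains the apex. *)
Lemma measurable_e_infty :
  measurable_fun [set: borel (ray X)] (@e_infty R X : borel (ray X) -> borel (cone X)).
Proof.
apply: (@measurability _ _ (borel (ray X)) (borel (cone X)) setT (@e_infty R X) open) => //.
move=> _ [U oU <-]; rewrite setTI.
have mo (V : set (cone X)) : open V ->
    measurable ([set g | 0 < speed g /\ V (e_infty g)] : set (borel (ray X))).
  by move=> oV; apply: sub_sigma_algebra; exact: open_e_infty.
have [UN|UN] := pselect (U None).
  rewrite (_ : _ @^-1` _ = ~` ([set g | 0 < speed g /\ setT (e_infty g)] `\`
    [set g | 0 < speed g /\ U (e_infty g)])); last first.
    apply/seteqP; split=> g /=; first by move=> Ug [[g0 _]]; apply.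
    move=> ng; apply: contrapT => Ug; apply: ng; split; last by move=> [].
    by split=> //; apply: contrapT => /e_infty_None gN; rewrite gN in Ug.
  by apply: measurableC; apply: measurableD; apply: mo => //; exact: openT.
rewrite (_ : _ @^-1` _ = [set g | 0 < speed g /\ U (e_infty g)]); first exact: mo.
apply/seteqP; split=> g /=; last by case.
by move=> Ug; split=> //; apply: contrapT => /e_infty_None gN; rewrite gN in Ug.
Qed.

Lemma measurable_cone_point (t : R) : 0 <= t -> measurable_fun [set: borel (cone X)]
  (fun x : borel (cone X) => cone_point (x : cone X) t : borel X).
Proof. by move=> t0; apply: borel_measurable_continuous; exact: cone_point_continuous. Qed.

End cone_topology.

(** * Measures on binary sequences and ultralimits *)

Section probability_of_measure.
Context {R : realType} d (T : measurableType d).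
Variables (m : {measure set T -> \bar R}) (m1 : m setT = 1%E).

(** A copy of [m] whose extra argument carries the proof of unit mass, so that the structure of
    probability can be attached to it. *)
Definition unit_measure & m setT = 1%E : set T -> \bar R := m.

HB.instance Definition _ := Measure.copy (unit_measure m1) m.
HB.instance Definition _ := Measure_isProbability.Build _ _ _ (unit_measure m1) m1.

Lemma probability_of_measure : exists P : probability T R, forall A, P A = m A.
Proof. by exists (unit_measure m1). Qed.

End probability_of_measure.

Lemma pushforward_probability {R : realType} d (T : measurableType d)
    d' (T' : measurableType d') (P : probability T R) (f : T -> T') :
  measurable_fun setT f ->
  exists Q : probability T' R, (forall A, Q A = P (f @^-1` A)) /\
    forall phi : T' -> \bar R, measurable_fun setT phi -> (forall y, 0 <= phi y)%E ->
      (\int[Q]_y phi y = \int[P]_x phi (f x))%E.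
Proof.
move=> mf; pose mixin := isMeasurableFun.Build _ _ _ _ f mf.
pose mfun : {mfun T >-> T'} := HB.pack f mixin.
exists (distribution P mfun); split=> // phi mphi phi0.
by rewrite ge0_integral_distribution.
Qed.

Lemma ultra_cvg_bounded {R : realType} (I : Type) (U : set_system I) (f : I -> R) (a b : R) :
  UltraFilter U -> (forall k, a <= f k <= b) -> exists l : R, f @ U --> l.
Proof.
move=> UU fab.
have fU : (f @ U) `[a, b]%classic.
  by apply: (@filterS _ U _ setT) => [k _|]; [rewrite /= in_itv/= fab | exact: filterT].
have [p [_ fp]] := @segment_compact R a b (f @ U) _ fU.
(* An ultrafilter converges to each of its cluster points: otherwise the complement of some
   neighbourhood would belong to it. *)
exists p => V nV; have [//|nVU] := in_ultra_setVsetC (f @^-1` V) UU.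
by have [x [/=]] := fp (~` V) V nVU nV.
Qed.

(** * The space of binary sequences *)

Section code_space.

Definition determined (n : nat) (A : set (nat -> bool)) :=
  forall c c' : nat -> bool, (forall i, (i < n)%N -> c i = c' i) -> A c -> A c'.

(** The Borel sets of the Cantor space, generated by its clopen sets. Limits of probabilities are
    taken on these, where additivity is a finite statement. *)
Definition code := g_sigma_algebraType [set A | exists n, determined n A].

Definition cylinder (w : seq bool) : set code := [set c | mkseq c (size w) = w].

Lemma determined_le m n A : (m <= n)%N -> determined m A -> determined n A.
Proof. by move=> mn dA c c' e; apply: dA => i im; apply: e; exact: leq_trans mn. Qed.

Lemma determinedI n A B : determined n A -> determined n B -> determined n (A `&` B).
Proof. by move=> dA dB c c' e [Ac Bc]; split; [exact: dA Ac | exact: dB Bc]. Qed.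

Lemma determined_bit i : determined i.+1 [set c | c i].
Proof. by move=> c c' e /=; rewrite e. Qed.

Lemma determined_cylinder w : determined (size w) (cylinder w).
Proof.
move=> c c' e; rewrite /cylinder/= => <-; rewrite size_mkseq.
apply: (@eq_from_nth _ false); rewrite !size_mkseq// => i isz.
by rewrite !nth_mkseq// e.
Qed.

Lemma measurable_determined n A : determined n A -> measurable (A : set code).
Proof. by move=> dA; apply: sub_sigma_algebra; exists n. Qed.

Lemma measurable_cylinder w : measurable (cylinder w).
Proof. exact: measurable_determined (@determined_cylinder w). Qed.

Lemma cylinder_rcons w : cylinder w = cylinder (rcons w true) `|` cylinder (rcons w false).
Proof.
rewrite /cylinder; apply/seteqP; split=> c /=; rewrite !size_rcons !mkseqS.
  by move=> ->; case: (c (size w)); [left|right].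
by move=> [] /eqP; rewrite eqseq_rcons => /andP[/eqP].
Qed.

Lemma cylinder_rcons_disj w : cylinder (rcons w true) `&` cylinder (rcons w false) = set0.
Proof.
rewrite /cylinder; apply/seteqP; split=> c //= []; rewrite !size_rcons !mkseqS.
by move=> /eqP; rewrite eqseq_rcons => /andP[_ /eqP ->] /eqP; rewrite eqseq_rcons andbF.
Qed.

Lemma measurable_to_code d (T : measurableType d) (f : T -> code) :
  (forall i, measurable [set x | f x i]) -> measurable_fun setT f.
Proof.
move=> mf.
have mcyl w : measurable (f @^-1` cylinder w).
  elim/last_ind: w => [|w b IH].
    by rewrite (_ : _ @^-1` _ = setT)//; apply/seteqP; split.
  rewrite (_ : _ @^-1` _ = f @^-1` cylinder w `&`
    (if b then [set x | f x (size w)] else ~` [set x | f x (size w)])).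
    by apply: measurableI => //; case: b; [exact: mf | apply: measurableC; exact: mf].
  rewrite /cylinder; apply/seteqP; split=> x /=; rewrite size_rcons mkseqS.
    move=> /eqP; rewrite eqseq_rcons => /andP[/eqP e1 /eqP e2]; split=> //.
    by case: {+}b e2 => /= e2; rewrite e2.
  by move=> [-> h]; congr rcons; case: b h => //= /negP/negbTE.
apply: (@measurability _ _ T code setT f [set A | exists n, determined n A]) => //.
move=> _ [A [n dA] <-]; rewrite setTI.
rewrite (_ : _ @^-1` _ =
    \bigcup_(w in [set w : seq bool | size w = n /\ A (nth false w)]) (f @^-1` cylinder w)).
  by rewrite bigcup_mkcond; apply: countable_bigcupT_measurable => // w; case: ifP.
apply/seteqP; split=> x /=.
  move=> Afx; exists (mkseq (f x) n); last by rewrite /cylinder/= size_mkseq.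
  by rewrite /= size_mkseq; split=> //; apply: dA Afx => i isz; rewrite nth_mkseq.
move=> [w /= [sw Aw]]; rewrite /cylinder/= sw => fw; apply: dA Aw => i isz.
by rewrite -fw nth_mkseq.
Qed.

End code_space.

Section code_measure.
Context {R : realType} (q : seq bool -> R).
Hypothesis q_ge0 : forall w, 0 <= q w.
Hypothesis q_nil : q [::] = 1.
Hypothesis q_rcons : forall w, q w = q (rcons w true) + q (rcons w false).

(** The prefix is carried along with the endpoint, because the shift at a digit [false] is the
    length attached to this prefix followed by [true]. *)
Let state (w : seq bool) := foldl (fun p b =>
  (rcons p.1 b, p.2 + if b then 0 else q (rcons p.1 true))) ([::], 0) w.

(* The words of length n, in lexicographic order, cut [0, 1[ into intervals of
   lengths q; this is the left endpoint of the interval of a word. *)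
Let start w := (state w).2.

Let state1 w : (state w).1 = w.
Proof. by elim/last_ind: w => // w b IH; rewrite /state foldl_rcons/= -/(state w) IH. Qed.

Let start_rcons w b : start (rcons w b) = start w + if b then 0 else q (rcons w true).
Proof. by rewrite /start /state foldl_rcons/= -/(state w) state1. Qed.

(** The word of length n whose interval contains u, found by successive cuts; [true] stands for the
    left piece. *)
Let word (u : R) (n : nat) :=
  iter n (fun w => rcons w (u < start w + q (rcons w true))) [::].

Let size_word u n : size (word u n) = n.
Proof. by elim: n => //= n IH; rewrite size_rcons IH. Qed.

Let digits (u : R) : code := fun i => nth false (word u i.+1) i.

Let wordE u n : mkseq (digits u) n = word u n.
Proof.
elim: n => // n IH; rewrite mkseqS IH /digits/=.
by rewrite nth_rcons size_word ltnn eqxx.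
Qed.

Let digits_cylinder w u : 0 <= u < 1 ->
  cylinder w (digits u) <-> start w <= u < start w + q w.
Proof.
move=> u01; elim/last_ind: w => [|w b IH].
  by rewrite /cylinder/= /start/= q_nil add0r; split.
rewrite start_rcons; have q1 := q_ge0 (rcons w true); have q0 := q_ge0 (rcons w false).
transitivity (cylinder w (digits u) /\ (u < start w + q (rcons w true)) = b).
  rewrite /cylinder/= size_rcons !wordE/=; split=> [/eqP|[-> <-]//].
  by rewrite eqseq_rcons => /andP[/eqP -> /eqP <-].
rewrite IH q_rcons; case: b; rewrite ?addr0.
  split=> [[/andP[-> _] ->]//|/andP[h1 h2]]; split=> //; apply/andP; split=> //.
  by rewrite addrA ltr_wpDr.
rewrite addrA; split=> [[/andP[_ ->] /negbT]|/andP[h1 h2]]; first by rewrite -leNgt => ->.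
split; last by apply/negbTE; rewrite -leNgt.
by apply/andP; split=> //; apply: le_trans h1; rewrite lerDl.
Qed.

Let mI : measurable (`[0, 1[ : set (measurableTypeR R)) := measurable_itv _.

Let unitP : exists P : probability (measurableTypeR R) R,
  forall A, P A = lebesgue_measure (A `&` `[0, 1[).
Proof.
have [|P PE] := @probability_of_measure _ _ _
  (mrestr lebesgue_measure mI).
  by rewrite /= /mrestr setTI lebesgue_measure_itv/= lte01 oppr0 addr0.
by exists P => A; rewrite PE.
Qed.

Let measurable_digits : measurable_fun [set: measurableTypeR R] digits.
Proof.
apply: measurable_to_code => i.
have mword n w : measurable ([set u | word u n = w] : set (measurableTypeR R)).
  elim: n w => [|n IH] w /=.
    by case: w => [|b w]; [rewrite [X in measurable X](_ : _ = setT)|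
      rewrite [X in measurable X](_ : _ = set0)]; by [|apply/seteqP; split].
  have [->|[w' [b ->]]] : w = [::] \/ exists w' b, w = rcons w' b.
  - by elim/last_ind: w => [|w' b _]; [left|right; exists w', b].
  - rewrite [X in measurable X](_ : _ = set0)//; apply/seteqP; split=> // u /=.
    by move=> /(congr1 size); rewrite size_rcons.
  - rewrite [X in measurable X](_ : _ = [set u | word u n = w'] `&`
      [set u | (u < start w' + q (rcons w' true)) = b]).
      apply: measurableI; first exact: IH.
      have := @measurable_itv R `]-oo, (start w' + q (rcons w' true))[; case: b => mi.
        by congr measurable: mi; apply/seteqP; split=> u; rewrite /= in_itv.
      move/measurableC in mi; congr measurable: mi.
      apply/seteqP; split=> u; rewrite /= in_itv/=; first by move/negP/negbTE.
      by move=> ->.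
    apply/seteqP; split=> u /=.
      by move=> /eqP; rewrite eqseq_rcons => /andP[/eqP -> /eqP].
    by move=> [-> ->].
rewrite [X in measurable X](_ : _ =
  \bigcup_(w in [set w | nth false w i]) [set u | word u i.+1 = w]).
  by rewrite bigcup_mkcond; apply: countable_bigcupT_measurable => // w; case: ifP.
apply/seteqP; split=> u; first by move=> h; exists (word u i.+1).
by move=> [w hw uw]; move: hw; rewrite -uw.
Qed.

(** The law of the digits of a uniform point of [0, 1[. Countable additivity is inherited from
    Lebesgue measure, so no extension theorem is involved. *)
Lemma code_measure_exists : exists P : probability code R,
  forall w, P (cylinder w) = (q w)%:E.
Proof.
have [P PE] := unitP.
have [Q [QE _]] := pushforward_probability P measurable_digits.
exists Q => w; rewrite QE PE.
have start_ge0 v : 0 <= start v.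
  by elim/last_ind: v => // v b IH; rewrite start_rcons addr_ge0//; case: b.
have end_le1 v : start v + q v <= 1.
  elim/last_ind: v => [|v b]; first by rewrite /start/= q_nil add0r.
  rewrite start_rcons q_rcons; apply: le_trans.
  by case: b; rewrite ?addr0 ?addrA// lerDl.
rewrite (_ : _ `&` _ = `[start w, start w + q w[%classic).
  rewrite lebesgue_measure_itv/= lte_fin ltrDl -EFinB addrAC subrr add0r.
  by have := q_ge0 w; rewrite le_eqVlt => /predU1P[<-|->//]; rewrite ltxx.
apply/seteqP; split=> u /=; rewrite !in_itv/=.
  by move=> [c u01]; exact/(digits_cylinder w u01).
move=> uw; have u01 : 0 <= u < 1.
  case/andP: uw => h1 h2; rewrite (le_trans (start_ge0 w) h1)/=.
  exact: lt_le_trans h2 (end_le1 w).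
by split=> //; exact/(digits_cylinder w u01).
Qed.

End code_measure.

(** * Ultralimits of probabilities on binary sequences *)

Section ultralimit.
Context {R : realType} {I : Type} (U : set_system I) {UU : UltraFilter U}.

Lemma probability_fineK d (T : measurableType d) (P : probability T R) A :
  measurable A -> (fine (P A))%:E = P A.
Proof. by move=> mA; rewrite fineK// fin_num_measure. Qed.

Lemma fine_probability_itv d (T : measurableType d) (P : probability T R) A :
  measurable A -> 0 <= fine (P A) <= 1.
Proof.
move=> mA; rewrite fine_ge0 ?measure_ge0//= -lee_fin probability_fineK//.
exact: probability_le1.
Qed.

Lemma fine_probabilityU d (T : measurableType d) (P : probability T R) A B :
  measurable A -> measurable B -> A `&` B = set0 ->
  fine (P (A `|` B)) = fine (P A) + fine (P B).
Proof. by move=> mA mB AB; rewrite measureU// fineD// fin_num_measure. Qed.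

(** Additivity under splitting a cylinder in two passes to the limits along [U], which are then
    realised by a measure; other determined sets are finite disjoint unions of cylinders. *)
Lemma code_ultralimit (P : I -> probability code R) :
  exists Q : probability code R, forall n A, determined n A ->
    fine (P k A) @[k --> U] --> fine (Q A).
Proof.
have cvgP (w : seq bool) : exists l : R, fine (P k (cylinder w)) @[k --> U] --> l.
  apply: (@ultra_cvg_bounded _ _ _ _ 0 1) => k.
  exact: fine_probability_itv (@measurable_cylinder w).
have [q qP] := choice cvgP.
have uniq (f : I -> R) (a b : R) : f @ U --> a -> f @ U --> b -> a = b.
  by move=> fa fb; exact: (cvg_unique (@Rhausdorff R) fa fb).
have q_ge0 w : 0 <= q w.
  rewrite -(cvg_lim _ (qP w))//; apply: limr_ge; first by apply/cvg_ex; exists (q w).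
  apply: (@filterS _ U _ setT) => [k _|]; last exact: filterT.
  by case/andP: (fine_probability_itv (P k) (measurable_cylinder w)).
have q_nil : q [::] = 1.
  apply: uniq (qP [::]) _.
  rewrite (_ : (fun k => _) = cst 1); first exact: cvg_cst.
  by apply/funext => k; rewrite (_ : cylinder [::] = setT) ?probability_setT//;
    apply/seteqP; split.
have q_rcons w : q w = q (rcons w true) + q (rcons w false).
  apply: uniq (qP w) _.
  have cD := cvgD (qP (rcons w true)) (qP (rcons w false)).
  suff e : (fun k => fine (P k (cylinder w))) = (fun k => fine (P k (cylinder (rcons w true)))) +
      (fun k => fine (P k (cylinder (rcons w false)))) by rewrite e; exact: cD.
  apply/funext => k; rewrite fctE cylinder_rcons fine_probabilityU//.
  - exact: measurable_cylinder.
  - exact: measurable_cylinder.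
  - exact: cylinder_rcons_disj.
have [Q QE] := code_measure_exists q_ge0 q_nil q_rcons.
exists Q => n A dA.
(* Words are lengthened up to n, where A either contains the cylinder or misses it; m counts the
   missing digits. *)
suff H m w : (m + size w)%N = n ->
    fine (P k (A `&` cylinder w)) @[k --> U] --> fine (Q (A `&` cylinder w)).
  have := H n [::] (addn0 n); rewrite (_ : cylinder [::] = setT) ?setIT//.
  by apply/seteqP; split.
elim: m w => [|m IH] w sw.
  rewrite add0n in sw; have [Aw|nAw] := pselect (A (nth false w)).
    have -> : A `&` cylinder w = cylinder w.
      apply: setIidr => c; rewrite /cylinder/= => cw; apply: dA Aw => i isz.
      by rewrite -cw nth_mkseq// sw.
    by rewrite QE; exact: qP.
  rewrite (_ : _ `&` _ = set0).
    by rewrite measure0; under eq_fun do rewrite measure0; exact: cvg_cst.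
  apply/seteqP; split=> // c [Ac]; rewrite /cylinder/= => cw; apply: nAw.
  by apply: dA Ac => i isz; rewrite -cw nth_mkseq// sw.
have mA := measurable_determined dA.
have step (V : probability code R) : fine (V (A `&` cylinder w)) =
    fine (V (A `&` cylinder (rcons w true))) + fine (V (A `&` cylinder (rcons w false))).
  rewrite cylinder_rcons setIUr fine_probabilityU//.
  - by apply: measurableI => //; exact: measurable_cylinder.
  - by apply: measurableI => //; exact: measurable_cylinder.
  - by rewrite setIACA setIid cylinder_rcons_disj setI0.
rewrite step; under eq_fun do rewrite step.
by apply: cvgD; apply: IH; rewrite size_rcons addnS -addSn.
Qed.

End ultralimit.

Lemma probability_eq_off_null {R : realType} d (T : measurableType d)
    (P : probability T R) (A B N : set T) : measurable A -> measurable B ->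
  measurable N -> P N = 0%E -> (forall x, ~ N x -> A x <-> B x) -> P A = P B.
Proof.
move=> mA mB mN N0 AB.
suff H C D : measurable C -> measurable D -> (forall x, ~ N x -> C x <-> D x) ->
    (P C <= P D)%E.
  by apply/eqP; rewrite eq_le !H// => x Nx; split=> /(AB x Nx).
move=> mC mD CD; apply: (@le_trans _ _ (P (D `|` N))).
  apply: le_measure; rewrite ?inE//; first exact: measurableU.
  by move=> x Cx; have [|nNx] := pselect (N x); [right | left; exact/CD].
by apply: (@le_trans _ _ (P D + P N)%E); [exact: measureU2 | rewrite N0 adde0].
Qed.

(** * Transfer of ultralimits to coded spaces *)

Section standard_spaces.

(* The space T is a measurable retract of the space of binary sequences; the
   bits of the code of a point are the indicators of countably many sets. *)
Definition coding d (T : measurableType d) (B : T -> code) (D : code -> T) :=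
  [/\ measurable_fun setT B, measurable_fun setT D & cancel B D].

Lemma measurable_coding_bit d (T : measurableType d) (B : T -> code) i :
  measurable_fun setT B -> measurable [set x | B x i].
Proof.
move=> mB; have := mB measurableT _ (measurable_determined (@determined_bit i)).
by rewrite setTI.
Qed.

Context {R : realType} {I : Type} (U : set_system I) {UU : UltraFilter U}.
Context d (T : measurableType d) d' (S : measurableType d').
Variables (BT : T -> code) (DT : code -> T) (BS : S -> code) (DS : code -> S).
Hypotheses (cT : coding BT DT) (cS : coding BS DS).
Variables (mu : probability T R) (sigma : probability S R).
Variable P : I -> probability (T * S)%type R.
Hypothesis P1 : forall k A, measurable A -> P k (fst @^-1` A) = mu A.
Hypothesis P2 : forall k B, measurable B -> P k (snd @^-1` B) = sigma B.

Let join (p : T * S) : code := fun i => if odd i then BS p.2 i./2 else BT p.1 i./2.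
Let even_bits (c : code) : code := fun i => c i.*2.
Let odd_bits (c : code) : code := fun i => c i.*2.+1.

Let measurable_join : measurable_fun setT join.
Proof.
have [mBT _ _] := cT; have [mBS _ _] := cS.
apply: measurable_to_code => i; rewrite /join; case: odd.
  have := @measurable_snd _ _ T S measurableT _ (measurable_coding_bit i./2 mBS).
  by rewrite setTI.
have := @measurable_fst _ _ T S measurableT _ (measurable_coding_bit i./2 mBT).
by rewrite setTI.
Qed.

Let measurable_even : measurable_fun setT even_bits.
Proof. by apply: measurable_to_code => i; exact: measurable_determined (@determined_bit i.*2). Qed.

Let measurable_odd : measurable_fun setT odd_bits.
Proof. by apply: measurable_to_code => i; exact: measurable_determined (@determined_bit i.*2.+1). Qed.

(** The limit is taken for the interleaved codes, then decoded. Decoding is faithful because the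
    limit has the laws of the codes as marginals, and these are carried by sequences that decoding
    followed by coding preserves, bit by bit. *)
Lemma couplings_ultralimit : exists Q : probability (T * S)%type R,
  [/\ forall A, measurable A -> Q (fst @^-1` A) = mu A,
      forall B, measurable B -> Q (snd @^-1` B) = sigma B &
      forall i j, fine (P k ([set x | BT x i] `*` [set y | BS y j])) @[k --> U] -->
                  fine (Q ([set x | BT x i] `*` [set y | BS y j]))].
Proof.
have [mBT mDT BTK] := cT; have [mBS mDS BSK] := cS.
have [P' P'P] := choice (fun k => pushforward_probability (P k) measurable_join).
have P'E k A : P' k A = P k (join @^-1` A) by have [-> _] := P'P k.
have [Q' Q'lim] := @code_ultralimit _ _ U UU P'.
have mD : measurable_fun setT (fun c => (DT (even_bits c), DS (odd_bits c))).
  by apply: measurable_fun_pair; exact: measurableT_comp.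
have [Q [QE _]] := pushforward_probability Q' mD.
have determined_even n A : determined n A -> determined n.*2 (even_bits @^-1` A).
  by move=> dA c c' e; apply: dA => i isz; apply: e; rewrite ltn_double.
have determined_odd n A : determined n A -> determined n.*2.+1 (odd_bits @^-1` A).
  by move=> dA c c' e; apply: dA => i isz; apply: e; rewrite ltnS ltn_double.
have const_lim n A x : determined n A -> (forall k, P' k A = x) -> Q' A = x.
  move=> dA PA; have mA := measurable_determined dA.
  have [k _] := @filter_ex _ U _ setT filterT.
  rewrite -(probability_fineK Q' mA) -(PA k) -(probability_fineK (P' k) mA).
  have e : (fun l => fine (P' l A)) = cst (fine (P' k A)).
    by apply/funext => l; rewrite /= !PA.
  have c : fine (P' l A) @[l --> U] --> fine (P' k A) by rewrite e; exact: cvg_cst.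
  by rewrite (cvg_unique (@Rhausdorff R) (Q'lim _ _ dA) c).
have uniq (V W : {measure set code -> \bar R}) : (W setT < +oo)%E ->
    (forall n A, determined n A -> W A = V A) -> forall A, measurable A -> W A = V A.
  move=> Wfin WV A mA.
  apply: (@measure_unique _ R code [set A | exists n, determined n A] (fun=> setT) _ _ _ _ W V) => //.
  - move=> C E [n nA] [m mB]; exists (maxn n m); apply: determinedI.
      exact: determined_le (leq_maxl _ _) nA.
    exact: determined_le (leq_maxr _ _) mB.
  - by move=> _; exists 0%N.
  - by apply/seteqP; split=> // x _; exists 0%N.
  - by move=> B [n dB]; exact: WV dB.
(* The first marginal is the same for all k, so the limit has it too, first on determined sets and
   then on all measurable sets. *)
have even_law A : measurable A -> Q' (even_bits @^-1` A) = mu (BT @^-1` A).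
  have [V [VE _]] := pushforward_probability Q' measurable_even.
  have [W [WE _]] := pushforward_probability mu mBT.
  move=> mA; rewrite -VE -WE; apply: uniq => //.
    exact: le_lt_trans (probability_le1 V measurableT) (ltry 1).
  move=> n {A mA} A dA; have mA := measurable_determined dA.
  suff e : V A = W A by exact: e.
  rewrite VE WE.
  apply: const_lim (determined_even _ _ dA) _ => k.
  rewrite P'E -(P1 k); last by rewrite -[X in measurable X]setTI; exact: mBT.
  congr (P k _); apply/seteqP; split=> p /=; rewrite /even_bits /join;
    by under eq_fun do rewrite odd_double doubleK.
have odd_law A : measurable A -> Q' (odd_bits @^-1` A) = sigma (BS @^-1` A).
  have [V [VE _]] := pushforward_probability Q' measurable_odd.
  have [W [WE _]] := pushforward_probability sigma mBS.
  move=> mA; rewrite -VE -WE; apply: uniq => //.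
    exact: le_lt_trans (probability_le1 V measurableT) (ltry 1).
  move=> n {A mA} A dA; have mA := measurable_determined dA.
  suff e : V A = W A by exact: e.
  rewrite VE WE.
  apply: const_lim (determined_odd _ _ dA) _ => k.
  rewrite P'E -(P2 k); last by rewrite -[X in measurable X]setTI; exact: mBS.
  congr (P k _); apply/seteqP; split=> p /=; rewrite /odd_bits /join;
    by under eq_fun do rewrite /= odd_double uphalf_double.
exists Q; split.
- move=> A mA; rewrite QE -[RHS](_ : mu (BT @^-1` (DT @^-1` A)) = _).
    by rewrite -even_law// -[X in measurable X]setTI; exact: mDT.
  by congr (mu _); apply/seteqP; split=> x /=; rewrite BTK.
- move=> A mA; rewrite QE -[RHS](_ : sigma (BS @^-1` (DS @^-1` A)) = _).
    by rewrite -odd_law// -[X in measurable X]setTI; exact: mDS.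
  by congr (sigma _); apply/seteqP; split=> x /=; rewrite BSK.
move=> i j.
pose A : set code := [set c | c i.*2 /\ c j.*2.+1].
have dA : determined (maxn i.*2.+1 j.*2.+2) A.
  apply: (@determinedI _ [set c | c i.*2] [set c | c j.*2.+1]).
    exact: determined_le (leq_maxl _ _) (@determined_bit i.*2).
  exact: determined_le (leq_maxr _ _) (@determined_bit j.*2.+1).
(* Sequences whose i-th bit is altered by decoding and coding again. [NT] and [NS] are null for the
   marginals, and outside them the rectangle is the event [A] on two bits. *)
pose NT := [set c : code | (BT (DT c)) i != c i].
pose NS := [set c : code | (BS (DS c)) j != c j].
have mneq (f g : code -> bool) : measurable [set c | f c] -> measurable [set c | g c] ->
    measurable [set c | f c != g c].
  move=> mf mg; rewrite [X in measurable X](_ : _ =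
    ([set c | f c] `\` [set c | g c]) `|` ([set c | g c] `\` [set c | f c])).
    by apply: measurableU; apply: measurableD.
  apply/seteqP; split=> c /=.
    by case: (f c) (g c) => -[]//= _; [left|right]; split.
  by case: (f c) (g c) => -[]//= [[]|[]].
have mNT : measurable NT.
  apply: mneq; last exact: measurable_determined (@determined_bit i).
  by have := mDT measurableT _ (measurable_coding_bit i mBT); rewrite setTI.
have mNS : measurable NS.
  apply: mneq; last exact: measurable_determined (@determined_bit j).
  by have := mDS measurableT _ (measurable_coding_bit j mBS); rewrite setTI.
have nT : Q' (even_bits @^-1` NT) = 0%E.
  rewrite even_law// (_ : _ @^-1` _ = set0) ?measure0//.
  by apply/seteqP; split=> // x; rewrite /NT /= BTK eqxx.
have nS : Q' (odd_bits @^-1` NS) = 0%E.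
  rewrite odd_law// (_ : _ @^-1` _ = set0) ?measure0//.
  by apply/seteqP; split=> // x; rewrite /NS /= BSK eqxx.
have meT : measurable (even_bits @^-1` NT).
  by rewrite -[X in measurable X]setTI; exact: measurable_even.
have moS : measurable (odd_bits @^-1` NS).
  by rewrite -[X in measurable X]setTI; exact: measurable_odd.
have mE : measurable ([set x | BT x i] `*` [set y | BS y j]).
  by apply: measurableX; exact: measurable_coding_bit.
rewrite QE.
have -> : Q' ((fun c => (DT (even_bits c), DS (odd_bits c))) @^-1`
    ([set x | BT x i] `*` [set y | BS y j])) = Q' A.
  apply: (@probability_eq_off_null _ _ _ _ _ _ (even_bits @^-1` NT `|` odd_bits @^-1` NS)).
  - by rewrite -[X in measurable X]setTI; exact: mD.
  - exact: measurable_determined dA.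
  - exact: measurableU.
  - apply/eqP; rewrite eq_le measure_ge0 andbT.
    by apply: (@le_trans _ _ (Q' (even_bits @^-1` NT) + Q' (odd_bits @^-1` NS))%E);
      [exact: measureU2 | rewrite nT nS adde0].
  - move=> c /not_orP[]; rewrite /NT /NS /A /= => /negP/negPn/eqP -> /negP/negPn/eqP ->.
    by [].
have AE : join @^-1` A = [set x | BT x i] `*` [set y | BS y j].
  by apply/seteqP; split=> p; rewrite /A /join /= !odd_double doubleK uphalf_double.
by have := Q'lim _ _ dA; under eq_fun do rewrite P'E AE.
Qed.

End standard_spaces.

(** * Countable partitions and the coding of rays *)

Section discrete_gluing.
Context {R : realType}.

Lemma measure_level_sets d (T : measurableType d) (P : probability T R)
    (f : T -> nat) (A : set T) : (forall i, measurable [set x | f x = i]) ->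
  measurable A -> (P A = \sum_(i <oo) P (A `&` [set x | f x = i]))%E.
Proof.
move=> mf mA; rewrite -measure_semi_bigcup.
- congr (P _); apply/seteqP; split=> [x Ax|x [i _ []]//].
  by exists (f x).
- by move=> i; exact: measurableI.
- apply/trivIsetP => i j _ _ ij; apply/seteqP; split=> // x [[_ /= fi] [_ /= fj]].
  by move: ij; rewrite -fi fj eqxx.
- by apply: bigcupT_measurable => i; exact: measurableI.
Qed.

(** Conditional independence given the common label: on each product of cells of equal label, the
    product measure is divided by their common mass. *)
Lemma discrete_coupling d (T : measurableType d) d' (S : measurableType d')
    (P : probability T R) (Q : probability S R) (f : T -> nat) (g : S -> nat) :
  (forall i, measurable [set x | f x = i]) ->
  (forall i, measurable [set y | g y = i]) ->
  (forall i, P [set x | f x = i] = Q [set y | g y = i]) ->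
  exists V : probability (T * S)%type R,
    [/\ forall A, measurable A -> V (fst @^-1` A) = P A,
        forall B, measurable B -> V (snd @^-1` B) = Q B &
        V [set p | f p.1 <> g p.2] = 0%E].
Proof.
move=> mf mg PQ.
pose F i := [set x | f x = i]; pose G i := [set y | g y = i].
have mFG i : measurable (F i `*` G i) by exact: measurableX (mf i) (mg i).
(* The inverse of 0 is 0, so that cells of mass 0 contribute nothing. *)
pose c i := (fine (P (F i)))^-1.
have c0 i : 0 <= c i by rewrite invr_ge0 fine_ge0.
pose m i : {measure set (T * S) -> \bar R} :=
  mscale (NngNum (c0 i)) (mrestr (P \x Q)%E (mFG i)).
pose V0 : {measure set (T * S) -> \bar R} := mseries m 0.
have mE i A B : measurable A -> measurable B ->
    m i (A `*` B) = ((c i)%:E * (P (A `&` F i) * Q (B `&` G i)))%E.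
  move=> mA mB; rewrite /m /= /mscale/= /mrestr -setXI.
  have mAF : measurable (A `&` F i) by exact: measurableI _ _ mA (mf i).
  have mBG : measurable (B `&` G i) by exact: measurableI _ _ mB (mg i).
  by rewrite product_measure1E.
have cP i A : measurable A -> ((c i)%:E * (P (A `&` F i) * Q (G i)) = P (A `&` F i))%E.
  move=> mA; rewrite -PQ -/(F i).
  have [p0|pn0] := eqVneq (P (F i)) 0%E.
    rewrite p0 mule0 mule0; apply/esym/eqP; rewrite eq_le measure_ge0 andbT -p0.
    by apply: le_measure; rewrite ?inE//; [exact: measurableI _ _ mA (mf i) | exact: mf].
  rewrite muleCA /c -[X in (_ * (_ * X))%E](probability_fineK P (mf i)) -EFinM.
  rewrite mulVf ?mule1//; apply: contra pn0 => /eqP h.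
  by rewrite -(probability_fineK P (mf i)) h.
have cQ i B : measurable B -> ((c i)%:E * (P (F i) * Q (B `&` G i)) = Q (B `&` G i))%E.
  move=> mB; have [p0|pn0] := eqVneq (P (F i)) 0%E.
    rewrite p0 mul0e mule0; apply/esym/eqP; rewrite eq_le measure_ge0 andbT.
    rewrite -p0 PQ; apply: le_measure; rewrite ?inE//.
      exact: measurableI _ _ mB (mg i).
  rewrite muleA /c -[X in ((_ * X) * _)%E](probability_fineK P (mf i)) -EFinM.
  rewrite mulVf ?mul1e//; apply: contra pn0 => /eqP h.
  by rewrite -(probability_fineK P (mf i)) h.
have V01 A : measurable A -> V0 (fst @^-1` A) = P A.
  move=> mA; rewrite /V0 /= /mseries (measure_level_sets P mf mA).
  apply: eq_eseriesr => i _; have -> : fst @^-1` A = A `*` [set: S].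
    by apply/seteqP; split=> p //= [].
  by rewrite mE// setTI cP.
have V02 B : measurable B -> V0 (snd @^-1` B) = Q B.
  move=> mB; rewrite /V0 /= /mseries (measure_level_sets Q mg mB).
  apply: eq_eseriesr => i _; have -> : snd @^-1` B = [set: T] `*` B.
    by apply/seteqP; split=> p //= [].
  by rewrite mE// setTI cQ.
have [|V VE] := @probability_of_measure _ _ _ V0.
  by rewrite -[setT](_ : fst @^-1` [set: T] = _)// V01// probability_setT.
exists V; split; [by move=> A mA; rewrite VE V01|by move=> B mB; rewrite VE V02|].
rewrite VE /V0 /= /mseries eseries0// => i _ _.
rewrite /m /= /mscale/= /mrestr (_ : _ `&` _ = set0) ?measure0 ?mule0//.
by apply/seteqP; split=> // p [/= fg []]; move=> fi gi; apply: fg; rewrite fi gi.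
Qed.

(** A point x is attached to w along [f'], then y to the pair along [g'], and w is finally
    forgotten. The laws of [f'] and [g'] alone matter, not their joint law. *)
Lemma discrete_gluing d (T : measurableType d) d' (S : measurableType d')
    e (Om : measurableType e) (mu : probability T R) (sigma : probability S R)
    (Pi : probability Om R) (f : T -> nat) (g : S -> nat) (f' g' : Om -> nat) :
  (forall i, measurable [set x | f x = i]) ->
  (forall i, measurable [set y | g y = i]) ->
  (forall i, measurable [set w | f' w = i]) ->
  (forall i, measurable [set w | g' w = i]) ->
  (forall i, Pi [set w | f' w = i] = mu [set x | f x = i]) ->
  (forall i, Pi [set w | g' w = i] = sigma [set y | g y = i]) ->
  exists V : probability (T * S)%type R,
    [/\ forall A, measurable A -> V (fst @^-1` A) = mu A,
        forall B, measurable B -> V (snd @^-1` B) = sigma B &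
        forall (phi : T * S -> \bar R) (psi : Om -> \bar R),
          measurable_fun setT phi -> measurable_fun setT psi ->
          (forall p, 0 <= phi p)%E -> (forall w, 0 <= psi w)%E ->
          (forall x y w, f x = f' w -> g y = g' w -> phi (x, y) <= psi w)%E ->
          (\int[V]_p phi p <= \int[Pi]_w psi w)%E].
Proof.
move=> mf mg mf' mg' Pimu Pisigma.
have [V1 [V1Pi V1mu V1eq]] := discrete_coupling mf' mf Pimu.
have mg1 i : measurable [set p : Om * T | g' p.1 = i].
  by have := @measurable_fst _ _ Om T measurableT _ (mg' i); rewrite setTI.
have V1sigma i : V1 [set p | g' p.1 = i] = sigma [set y | g y = i].
  by rewrite -Pisigma -V1Pi.
have [V2 [V2V1 V2sigma V2eq]] := discrete_coupling mg1 mg V1sigma.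
have mproj : measurable_fun setT (fun p : (Om * T) * S => (p.1.2, p.2)).
  apply: measurable_fun_pair => //.
  exact: measurableT_comp (@measurable_snd _ _ Om T) (@measurable_fst _ _ _ S).
have [V [VE Vint]] := pushforward_probability V2 mproj.
exists V; split.
- move=> A mA; rewrite VE -V1mu// -V2V1//.
  by rewrite -[X in measurable X]setTI; exact: measurable_snd.
- by move=> B mB; rewrite VE -V2sigma.
move=> phi psi mphi mpsi phi0 psi0 phipsi; rewrite Vint//.
have mfst : measurable_fun setT (fun p : (Om * T) * S => p.1.1).
  exact: measurableT_comp (@measurable_fst _ _ Om T) (@measurable_fst _ _ _ S).
have [W [WE Wint]] := pushforward_probability V2 mfst.
have -> : (\int[Pi]_w psi w = \int[V2]_p psi p.1.1)%E.
  rewrite -Wint//; apply: eq_measure_integral => A mA _.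
  suff : Pi A = W A by [].
  rewrite WE -V1Pi// -V2V1//.
  by rewrite -[X in measurable X]setTI; exact: measurable_fst.
(* The pointwise comparison requires matching labels, which holds off the null sets of the two
   couplings. *)
apply: ae_ge0_le_integral => //.
- exact: measurableT_comp mphi mproj.
- exact: measurableT_comp mpsi mfst.
have mneq d1 (T1 : measurableType d1) d2 (T2 : measurableType d2) (a : T1 -> nat) (b : T2 -> nat) :
    (forall i, measurable [set x | a x = i]) -> (forall i, measurable [set x | b x = i]) ->
    measurable [set p : T1 * T2 | a p.1 <> b p.2].
  move=> ma mb; rewrite [X in measurable X](_ : _ = ~` \bigcup_i ([set x | a x = i] `*` [set x | b x = i])).
    by apply/measurableC/bigcupT_measurable => i; apply: measurableX.
  apply/seteqP; split=> p /=; first by move=> ab [i _ [/= ai bi]]; apply: ab; rewrite ai bi.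
  by move=> nab ab; apply: nab; exists (a p.1).
have m1 := mneq _ _ _ _ _ _ mf' mf; have m2 := mneq _ _ _ _ _ _ mg1 mg.
pose N1 := fst @^-1` [set p : Om * T | f' p.1 <> f p.2] : set ((Om * T) * S).
pose N2 := [set p : (Om * T) * S | g' p.1.1 <> g p.2].
have mN1 : measurable N1.
  by rewrite -[X in measurable X]setTI; exact: measurable_fst.
exists (N1 `|` N2); split; first exact: measurableU.
  apply/eqP; rewrite eq_le measure_ge0 andbT.
  apply: (@le_trans _ _ (V2 N1 + V2 N2)%E); first exact: measureU2.
  by rewrite V2V1// V1eq V2eq adde0.
move=> [[w x] y] /= nle; apply: contrapT => /not_orP[/= /contrapT h1 /contrapT h2].
by apply: nle => _; exact: phipsi.
Qed.

End discrete_gluing.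

(** * Small cells, and rays as binary sequences *)

Section separable_index.
Context {R : realType} (X : completeMetricType R) (q : nat -> X).
Hypothesis qd : forall (x : X) (e : R), 0 < e -> exists i, mdist (q i) x < e.

Lemma dense_index_subproof (n : nat) (x : X) : exists j, mdist (q j) x < n.+1%:R^-1.
Proof. by apply: qd; rewrite invr_gt0. Qed.

(** The choice of the least index gives a measurable partition into cells of diameter at most 2 / (n
    + 1). *)
Definition dense_index n x := ex_minn (dense_index_subproof n x).

Lemma dense_indexP n x : mdist (q (dense_index n x)) x < n.+1%:R^-1.
Proof. by rewrite /dense_index; case: ex_minnP. Qed.

Lemma measurable_dense_index d (T : measurableType d) (f : T -> X) n i :
  measurable_fun setT (f : T -> borel X) -> measurable [set x | dense_index n (f x) = i].
Proof.
move=> mf; pose B j := [set x | mdist (q j) (f x) < n.+1%:R^-1].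
have mB j : measurable (B j).
  by apply: measurable_lt_cst; exact: measurableT_comp (borel_measurable_mdist (q j)) mf.
rewrite [X in measurable X](_ : _ = B i `\` \bigcup_(j in [set j | (j < i)%N]) B j).
  by apply: measurableD => //; apply: bigcup_measurable.
apply/seteqP; split=> x /=.
  rewrite /dense_index; case: ex_minnP => m Bm mmin <-; split=> // -[j /= jm /mmin].
  by rewrite leqNgt jm.
move=> [Bi nB]; rewrite /dense_index; case: ex_minnP => m Bm mmin.
apply/eqP; rewrite eqn_leq mmin//= leqNgt; apply/negP => mi.
by apply: nB; exists m.
Qed.

Lemma measurable_forall d (T : measurableType d) (I : countType) (P : I -> T -> Prop) :
  (forall i, measurable [set x | P i x]) -> measurable [set x | forall i, P i x].
Proof.
move=> mP; rewrite [X in measurable X](_ : _ = ~` \bigcup_i ~` [set x | P i x]).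
  apply/measurableC/countable_bigcupT_measurable => // i; exact: measurableC.
apply/seteqP; split=> x /=; first by move=> h [i _]; apply; exact: h.
by move=> h i; apply: contrapT => nP; apply: h; exists i.
Qed.

Section ray_coding.
Hypothesis hX : hadamard X.
Implicit Types (c : code) (g : ray X).

(** One bit for each time m, scale n and cell j. The coding is redundant on purpose: being in a
    given cell at a given time is a single bit, and these are the events whose probabilities the
    ultralimit preserves. *)
Definition ray_code g : code := fun l =>
  if unpickle l is Some (m, n, j) then dense_index n (g m%:R) == j else false.

Definition code_bit c (m n j : nat) : bool := c (pickle (m, n, j)).

Lemma code_bit_ray g m n j : code_bit (ray_code g) m n j = (dense_index n (g m%:R) == j).
Proof. by rewrite /code_bit /ray_code pickleK. Qed.

(** Weaker than [ray_code g = c]: a bit only asserts closeness, by a non-strict inequality that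
    survives limits. It still determines the ray. *)
Definition codes_ray c : set (ray X) :=
  [set g | forall m n, (exists j, code_bit c m n j) /\
     forall j, code_bit c m n j -> mdist (q j) (g m%:R) <= n.+1%:R^-1].

Lemma ray_code_codes g : codes_ray (ray_code g) g.
Proof.
move=> m n; split; first by exists (dense_index n (g m%:R)); rewrite code_bit_ray.
by move=> j; rewrite code_bit_ray => /eqP <-; apply/ltW/dense_indexP.
Qed.

Lemma ray_eq_nat g (h : ray X) : (forall m : nat, g m%:R = h m%:R) -> g = h.
Proof.
move=> gh; apply: val_inj; apply/funext => t; apply: mdist_positivity.
apply/eqP; rewrite eq_le mdist_ge0 andbT; apply/ler_addgt0Pl => e e0; rewrite addr0 ltW//.
apply: (@ray_close_le _ _ hX (Num.truncn t).+1).
  by split; rewrite ?gh ?(gh 0%N) mdistxx.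
exact/ltW/Num.Theory.truncnS_gt.
Qed.

Lemma codes_ray_uniq c g (h : ray X) : codes_ray c g -> codes_ray c h -> g = h.
Proof.
move=> cg ch; apply: ray_eq_nat => m; apply: mdist_positivity.
apply/eqP; rewrite eq_le mdist_ge0 andbT; apply/ler_addgt0Pl => e e0; rewrite addr0.
have [n ne] : exists n, n.+1%:R^-1 < e / 2.
  have e20 : 0 < e / 2 by rewrite divr_gt0.
  near \oo => n; exists n; near: n; exact: near_infty_natSinv_lt (PosNum e20).
have [[j cj] /(_ j cj) gj] := cg m n; have [_ /(_ j cj) hj] := ch m n.
apply: le_trans (metric_triangle _ (q j) _) _; rewrite metric_sym [e]splitr.
by rewrite lerD//; [exact: le_trans gj (ltW ne) | exact: le_trans hj (ltW ne)].
Unshelve. all: by end_near. Qed.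

Definition code_ray c : ray X := xget point (codes_ray c).

Lemma ray_codeK : cancel ray_code code_ray.
Proof.
move=> g; rewrite /code_ray; case: xgetP => [h _ ch|/(_ g)/(_ (ray_code_codes g))//].
exact: codes_ray_uniq ch (ray_code_codes g).
Qed.

Lemma measurable_ray_code : measurable_fun [set: borel (ray X)] (ray_code : borel (ray X) -> code).
Proof.
apply: measurable_to_code => l; rewrite /ray_code.
case: unpickle => [[[m n] j]|]; last by rewrite [X in measurable X](_ : _ = set0)//;
  apply/seteqP; split.
rewrite [X in measurable X](_ : _ = [set g : borel (ray X) | dense_index n ((g : ray X) m%:R) = j]).
  apply: measurable_dense_index; exact: measurable_ray_eval.
by apply/seteqP; split=> g /= /eqP.
Qed.

(** Countably many conditions on bits, equivalent to coding some ray: a cell at each time and scale,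
    coherence between scales, and distances proportional to time differences. The speed is read at
    times 0 and 1. Each of the two distances compared has two approximate ends, whence the error
    [2 + 2 * |m - m'|] at scale n. *)
Let consistent c := [/\ forall m n, exists j, code_bit c m n j,
  forall p : (nat * nat) * (nat * nat * nat),
    code_bit c p.1.1 p.1.2 p.2.1.1 -> code_bit c p.1.1 p.2.1.2 p.2.2 ->
    mdist (q p.2.1.1) (q p.2.2) <= p.1.2.+1%:R^-1 + p.2.1.2.+1%:R^-1 &
  forall p : (nat * nat * nat) * (nat * nat) * (nat * nat),
    code_bit c p.1.1.1.1 p.1.1.2 p.1.2.1 -> code_bit c p.1.1.1.2 p.1.1.2 p.1.2.2 ->
    code_bit c 0 p.1.1.2 p.2.1 -> code_bit c 1 p.1.1.2 p.2.2 ->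
    `|mdist (q p.1.2.1) (q p.1.2.2) -
      mdist (q p.2.1) (q p.2.2) * `|p.1.1.1.1%:R - p.1.1.1.2%:R| | <=
      (2 + 2 * `|p.1.1.1.1%:R - p.1.1.1.2%:R|) * p.1.1.2.+1%:R^-1].

Let measurable_consistent : measurable (consistent : set code).
Proof.
have mbit m n j : measurable [set c | code_bit c m n j].
  exact: measurable_determined (@determined_bit (pickle (m, n, j))).
have mimp (A B : set code) : measurable A -> measurable B ->
    measurable [set c | A c -> B c].
  move=> mA mB; rewrite [X in measurable X](_ : _ = ~` A `|` B).
    by apply: measurableU => //; exact: measurableC.
  apply/seteqP; split=> c /=; last by case.
  by move=> AB; have [Ac|] := pselect (A c); [right; exact: AB | left].
have mcst (P : Prop) : measurable [set c : code | P].
  have [p|np] := pselect P.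
    by rewrite [X in measurable X](_ : _ = setT)//; apply/seteqP; split.
  by rewrite [X in measurable X](_ : _ = set0)//; apply/seteqP; split.
rewrite [X in measurable X](_ : _ = [set c | forall p : nat * nat, exists j, code_bit c p.1 p.2 j] `&`
  ([set c | forall p : (nat * nat) * (nat * nat * nat),
    code_bit c p.1.1 p.1.2 p.2.1.1 -> code_bit c p.1.1 p.2.1.2 p.2.2 ->
    mdist (q p.2.1.1) (q p.2.2) <= p.1.2.+1%:R^-1 + p.2.1.2.+1%:R^-1] `&`
  [set c | forall p : (nat * nat * nat) * (nat * nat) * (nat * nat),
    code_bit c p.1.1.1.1 p.1.1.2 p.1.2.1 -> code_bit c p.1.1.1.2 p.1.1.2 p.1.2.2 ->
    code_bit c 0 p.1.1.2 p.2.1 -> code_bit c 1 p.1.1.2 p.2.2 ->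
    `|mdist (q p.1.2.1) (q p.1.2.2) -
      mdist (q p.2.1) (q p.2.2) * `|p.1.1.1.1%:R - p.1.1.1.2%:R| | <=
      (2 + 2 * `|p.1.1.1.1%:R - p.1.1.1.2%:R|) * p.1.1.2.+1%:R^-1])); last first.
  apply/seteqP; split=> c; first by case=> h1 h2 h3; split=> // -[m n]; exact: h1.
  by case=> h1 [h2 h3]; split=> // m n; exact: (h1 (m, n)).
apply: measurableI.
  apply: measurable_forall => -[m n] /=.
  rewrite [X in measurable X](_ : _ = \bigcup_j [set c | code_bit c m n j]).
    by apply: bigcupT_measurable.
  by apply/seteqP; split=> c /= [j]; [exists j | move=> _ ?; exists j].
apply: measurableI; apply: measurable_forall => p.
  do 2 (apply: (mimp); first exact: (mbit)); exact: mcst.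
do 4 (apply: (mimp); first exact: (mbit)); exact: mcst.
Qed.

Let consistentP c : consistent c <-> exists g, codes_ray c g.
Proof.
split=> [[ex near_q geo]|[g cg]]; last first.
  split=> [m n|p c1 c2|p c1 c2 c3 c4]; first by have [] := cg m n.
    have [_ /(_ _ c1) h1] := cg p.1.1 p.1.2; have [_ /(_ _ c2) h2] := cg p.1.1 p.2.1.2.
    apply: le_trans (metric_triangle _ (g p.1.1%:R) _) _.
    by rewrite lerD// metric_sym.
  have [_ /(_ _ c1) h1] := cg p.1.1.1.1 p.1.1.2; have [_ /(_ _ c2) h2] := cg p.1.1.1.2 p.1.1.2.
  have [_ /(_ _ c3) h3] := cg 0%N p.1.1.2; have [_ /(_ _ c4) h4] := cg 1%N p.1.1.2.
  have := speedP g (ler0n R p.1.1.1.1) (ler0n R p.1.1.1.2).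
  have l1 := mdist_lipschitz (q p.1.2.1) (q p.1.2.2) (g p.1.1.1.1%:R) (g p.1.1.1.2%:R).
  have l2 := mdist_lipschitz (q p.2.1) (q p.2.2) (g 0) (g 1).
  rewrite -/(speed g) in l2; move: l1 l2 h1 h2 h3 h4.
  move: (p.1.1.2.+1%:R^-1 : R) (`|p.1.1.1.1%:R - p.1.1.1.2%:R| : R) (normr_ge0 (p.1.1.1.1%:R - p.1.1.1.2%:R : R)).
  move=> r t t0; rewrite !ler_norml; move=> /andP[l1 l1'] /andP[l2 l2'] h1 h2 h3 h4 gE.
  by rewrite gE in l1 l1'; apply/andP; split; nra.
have ex' m : exists f : nat -> nat, forall n, code_bit c m n (f n).
  by have [f fP] := choice (ex m); exists f.
have [j jP] := choice ex'.
have small (e : R) : 0 < e -> exists N, forall n, (N <= n)%N -> n.+1%:R^-1 < e.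
  move=> e0; have [N _ hN] := near_infty_natSinv_lt (PosNum e0).
  by exists N => n Nn; exact: hN.
have ycvg m : exists y : X, q (j m n) @[n --> \oo] --> y.
  apply: cauchy_mdist_cvg => e e0; have e2 : 0 < e / 2 by rewrite divr_gt0.
  have [N hN] := small _ e2; exists N => k l Nk Nl.
  apply: le_lt_trans (near_q ((m, k), ((j m k, l), j m l)) (jP m k) (jP m l)) _.
  by rewrite [e]splitr ltrD//; exact: hN.
have [y yP] := choice ycvg.
have yq m n k : code_bit c m n k -> mdist (q k) (y m) <= n.+1%:R^-1.
  move=> ck; apply/ler_addgt0Pl => e e0; have e2 : 0 < e / 2 by rewrite divr_gt0.
  have [N hN] := small _ e2.
  have [M _ hM] : \forall l \near \oo, mdist (y m) (q (j m l)) < e / 2.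
    by have /metricType_numDomainType.cvgrPdist_lt := yP m; apply.
  pose l := maxn N M; have rl := hN l (leq_maxl _ _); have dl := hM l (leq_maxr _ _).
  apply: le_trans (metric_triangle _ (q (j m l)) _) _.
  have := near_q ((m, n), ((k, l), j m l)) ck (jP m l) => /= h.
  rewrite metric_sym in dl; move: h rl dl.
  by move: (n.+1%:R^-1 : R) (l.+1%:R^-1 : R) => r r'; lra.
have yy (m m' : nat) : mdist (y m) (y m') = mdist (y 0%N) (y 1%N) * `|m%:R - m'%:R|.
  set t : R := `|m%:R - m'%:R|; have t0 : 0 <= t by exact: normr_ge0.
  apply/eqP; rewrite -subr_eq0 -normr_le0; apply/ler_addgt0Pl => e e0; rewrite addr0.
  (* To the error [2 + 2 * t] in [geo], the passage from approximations to limits adds the same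
     amount. *)
  have d0 : 0 < e / (4 + 4 * t) by rewrite divr_gt0//; lra.
  have [N hN] := small _ d0; have := hN N (leqnn N).
  rewrite ltr_pdivlMr; last by lra.
  have := geo ((((m, m'), N), (j m N, j m' N)), (j 0%N N, j 1%N N))
    (jP _ _) (jP _ _) (jP _ _) (jP _ _).
  have l1 := mdist_lipschitz (q (j m N)) (q (j m' N)) (y m) (y m').
  have l2 := mdist_lipschitz (q (j 0%N N)) (q (j 1%N N)) (y 0%N) (y 1%N).
  have := yq _ _ _ (jP m N); have := yq _ _ _ (jP m' N).
  have := yq _ _ _ (jP 0%N N); have := yq _ _ _ (jP 1%N N).
  move: l1 l2; rewrite /= -/t; move: (N.+1%:R^-1 : R) => r.
  rewrite !ler_norml; move=> /andP[l1 l1'] /andP[l2 l2'] h1 h2 h3 h4 /andP[g1 g2] re.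
  by apply/andP; split; nra.
have [g gy] := ray_samples_exists hX (mdist_ge0 (y 0%N) (y 1%N)) yy.
exists g => m n; rewrite gy; split; first exact: ex.
by move=> k ck; exact: yq.
Qed.

(** For consistent codes, a strict upper bound on the distance from [q i] to the decoded position is
    witnessed by one bit at a fine enough scale. Other codes all decode to the default ray. *)
Lemma measurable_code_ray : measurable_fun setT (code_ray : code -> borel (ray X)).
Proof.
apply: (measurable_borel_ray hX qd) => m; apply: (measurable_borel_mdist qd) => i.
apply: (measurability _ (RGenInftyO.measurableE R)) => //.
move=> _ [_ [a ->] <-]; rewrite setTI.
have mbit n j : measurable [set c | code_bit c m n j].
  exact: measurable_determined (@determined_bit (pickle (m, n, j))).
rewrite [X in measurable X](_ : _ =
  ((consistent : set code) `&` \bigcup_(p in [set p : nat * nat | mdist (q i) (q p.2) + p.1.+1%:R^-1 < a])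
    [set c | code_bit c m p.1 p.2]) `|`
  (~` (consistent : set code) `&` [set c | mdist (q i) ((point : ray X) m%:R) < a])).
  apply: measurableU; apply: measurableI => //.
  - by apply: countable_bigcup_measurable => p _.
  - exact: measurableC.
  - have [p|np] := pselect (mdist (q i) ((point : ray X) m%:R) < a).
      by rewrite [X in measurable X](_ : _ = setT)//; apply/seteqP; split.
    by rewrite [X in measurable X](_ : _ = set0)//; apply/seteqP; split.
have in_cons c : consistent c -> codes_ray c (code_ray c).
  by move=> /consistentP [g cg]; rewrite /code_ray; case: xgetP => [h _//|/(_ g)].
have out_cons c : ~ consistent c -> code_ray c = point.
  move=> nc; rewrite /code_ray; case: xgetP => // h _ ch.
  by exfalso; apply: nc; apply/consistentP; exists h.
apply/seteqP; split=> c; rewrite /= in_itv/=.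
  have [cc|nc] := pselect (consistent c); last by rewrite out_cons//; right.
  move=> lta; left; split=> //.
  have [n ne] : exists n, n.+1%:R^-1 < (a - mdist (q i) (code_ray c m%:R)) / 2.
    have e0 : 0 < (a - mdist (q i) (code_ray c m%:R)) / 2 by rewrite divr_gt0// subr_gt0.
    near \oo => n; exists n; near: n; exact: near_infty_natSinv_lt (PosNum e0).
  have [[j cj] /(_ j cj) dj] := in_cons _ cc m n; exists (n, j) => //=.
  have := metric_triangle (q i) (code_ray c m%:R) (q j).
  rewrite (metric_sym (code_ray c m%:R) (q j)); move: dj ne.
  move: (n.+1%:R^-1 : R) => r; move=> *; lra.
move=> [[cc [[n j] /= lta cj]]|[nc lta]]; last by rewrite out_cons.
apply: le_lt_trans lta; apply: le_trans (metric_triangle _ (q j) _) _.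
by rewrite lerD2l; have [_] := in_cons _ cc m n; apply.
Unshelve. all: by end_near. Qed.

Lemma ray_coding : coding (ray_code : borel (ray X) -> code) (code_ray : code -> borel (ray X)).
Proof. by split; [exact: measurable_ray_code | exact: measurable_code_ray | exact: ray_codeK]. Qed.

End ray_coding.
End separable_index.

(** * Lifting plans to couplings of rays *)

Section integral_bounds.
Context {R : realType} d (T : measurableType d) (V : probability T R).

Lemma measurable_sqr (f : T -> R) : measurable_fun setT f ->
  measurable_fun setT (fun x => (f x ^+ 2)%:E).
Proof. by move=> mf; apply/measurable_EFinP; exact: measurable_funX. Qed.

(* Young's inequality: 2 a b <= e a^2 + b^2 / e. *)
Lemma integral_sqr_le (f a b : T -> R) (e : R) : 0 < e ->
  measurable_fun setT f -> measurable_fun setT a -> measurable_fun setT b ->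
  (forall x, 0 <= f x) -> (forall x, f x <= a x + b x) ->
  (\int[V]_x (f x ^+ 2)%:E <= (1 + e)%:E * \int[V]_x (a x ^+ 2)%:E +
    (1 + e^-1)%:E * \int[V]_x (b x ^+ 2)%:E)%E.
Proof.
move=> e0 mf ma mb f0 fab.
have e1 : 0 <= 1 + e by rewrite addr_ge0// ltW.
have e2 : 0 <= 1 + e^-1 by rewrite addr_ge0// invr_ge0 ltW.
have ma2 := measurable_sqr ma; have mb2 := measurable_sqr mb.
rewrite -ge0_integralZl_EFin//; last by move=> x _; rewrite lee_fin sqr_ge0.
rewrite -ge0_integralZl_EFin//; last by move=> x _; rewrite lee_fin sqr_ge0.
rewrite -ge0_integralD//; last 4 first.
- by move=> x _; rewrite -EFinM lee_fin mulr_ge0// sqr_ge0.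
- exact: measurable_funeM.
- by move=> x _; rewrite -EFinM lee_fin mulr_ge0// sqr_ge0.
- exact: measurable_funeM.
apply: ge0_le_integral => //.
- by move=> x _; rewrite lee_fin sqr_ge0.
- exact: measurable_sqr.
- by apply: emeasurable_funD; exact: measurable_funeM.
move=> x _; rewrite -!EFinM -EFinD lee_fin.
apply: (@le_trans _ _ ((a x + b x) ^+ 2)).
  by rewrite ler_sqr ?nnegrE ?fab ?f0 ?(le_trans (f0 x) (fab x)).
have : 0 <= e * (a x - e^-1 * b x) ^+ 2 by rewrite mulr_ge0 ?sqr_ge0// ltW.
have -> : e * (a x - e^-1 * b x) ^+ 2 = e * a x ^+ 2 - 2 * a x * b x + e^-1 * b x ^+ 2.
  by field; rewrite gt_eqF.
by rewrite sqrrD; move: (e^-1) => e'; lra.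
Qed.

Lemma integral_sqr_le_fin (f a b : T -> R) (e alpha beta : R) : 0 < e ->
  measurable_fun setT f -> measurable_fun setT a -> measurable_fun setT b ->
  (forall x, 0 <= f x) -> (forall x, f x <= a x + b x) ->
  (\int[V]_x (a x ^+ 2)%:E <= alpha%:E)%E -> (\int[V]_x (b x ^+ 2)%:E <= beta%:E)%E ->
  (\int[V]_x (f x ^+ 2)%:E <= ((1 + e) * alpha + (1 + e^-1) * beta)%:E)%E.
Proof.
move=> e0 mf ma mb f0 fab aa bb; apply: le_trans (integral_sqr_le e0 mf ma mb f0 fab) _.
have -> : (((1 + e) * alpha + (1 + e^-1) * beta)%:E =
    (1 + e)%:E * alpha%:E + (1 + e^-1)%:E * beta%:E)%E by [].
apply: leeD; apply: lee_wpmul2l => //.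
  by rewrite lee_fin addr_ge0// ltW.
by rewrite lee_fin addr_ge0// invr_ge0 ltW.
Qed.

Lemma integral_sqr_cst (c : R) : (\int[V]_x (c ^+ 2)%:E = (c ^+ 2)%:E)%E.
Proof.
rewrite integral_cst// [X in (_ * X)%E](_ : _ = 1%E) ?mule1//.
exact: (@probability_setT _ _ _ V).
Qed.

Lemma integral_sqr_scale (f : T -> R) (c : R) : measurable_fun setT f ->
  (\int[V]_x ((c * f x) ^+ 2)%:E = (c ^+ 2)%:E * \int[V]_x (f x ^+ 2)%:E)%E.
Proof.
move=> mf; rewrite -ge0_integralZl_EFin ?sqr_ge0//.
- by apply: eq_integral => x _; rewrite exprMn EFinM.
- by move=> x _; rewrite lee_fin sqr_ge0.
- exact: measurable_sqr.
Qed.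

Lemma integral_le_pointwise_cvg (f : nat -> T -> R) (g : T -> R) (c : R) :
  (forall n, measurable_fun setT (f n)) -> (forall n x, 0 <= f n x) ->
  (forall x, f n x @[n --> \oo] --> g x) ->
  (\forall n \near \oo, (\int[V]_x (f n x)%:E <= c%:E)%E) ->
  (\int[V]_x (g x)%:E <= c%:E)%E.
Proof.
move=> mf f0 fg fc.
have mfE n : measurable_fun setT (fun x => (f n x)%:E) by exact/measurable_EFinP.
have f0E n x : [set: T] x -> (0 <= (f n x)%:E)%E by rewrite lee_fin.
have := fatou V measurableT mfE f0E.
have -> : (\int[V]_x limn_einf (fun n => (f n x)%:E) = \int[V]_x (g x)%:E)%E.
  apply: eq_integral => x _; rewrite limn_einf_lim.
  by apply/cvg_lim => //; apply: cvg_einfs; apply: cvg_EFin; [exact: nearW | exact: fg].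
move=> /le_trans; apply; rewrite limn_einf_lim; apply: lime_le; first exact: is_cvg_einfs.
near=> n; apply: (@le_trans _ _ (\int[V]_x (f n x)%:E)%E); last by near: n.
by apply: ereal_inf_lbound; exists n => /=.
Unshelve. all: by end_near. Qed.

Lemma integral_nat_series (h : T -> nat) (w : nat -> R) :
  (forall i, measurable [set x | h x = i]) -> (forall i, 0 <= w i) ->
  (\int[V]_x (w (h x))%:E = \sum_(i <oo) (w i)%:E * V [set x | h x = i])%E.
Proof.
move=> mh w0.
have mwh : measurable_fun setT (fun x => (w (h x))%:E).
  move=> _ Y mY; rewrite setTI [X in measurable X](_ : _ =
    \bigcup_(i in [set i | Y (w i)%:E]) [set x | h x = i]).
    by apply: bigcup_measurable.
  by apply/seteqP; split=> x /=; [move=> Yx; exists (h x) | move=> [i /= Yi ->]].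
have cover : \bigcup_i [set x | h x = i] = [set: T].
  by apply/seteqP; split=> x //= _; exists (h x).
rewrite -cover ge0_integral_bigcup//.
- apply: eq_eseriesr => i _; rewrite -integral_cst//.
  by apply: eq_integral => x; rewrite inE/= => ->.
- by rewrite cover.
- by move=> x _; rewrite lee_fin.
- apply/trivIsetP => i j _ _ ij; apply/seteqP; split=> // x [/= hi hj].
  by move: ij; rewrite -hi -hj eqxx.
Qed.

End integral_bounds.

(** Lower semicontinuity for costs with countably many values: each partial sum of the series is a
    finite combination of convergent probabilities. *)
Lemma integral_nat_ultralimit_le {R : realType} d (T : measurableType d) (I : Type)
    (U : set_system I) (P : I -> probability T R) (Q : probability T R)
    (h : T -> nat) (w : nat -> R) (b : R) : ProperFilter U ->
  (forall i, measurable [set x | h x = i]) -> (forall i, 0 <= w i) ->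
  (forall i, fine (P k [set x | h x = i]) @[k --> U] --> fine (Q [set x | h x = i])) ->
  (\forall k \near U, (\int[P k]_x (w (h x))%:E <= b%:E)%E) ->
  (\int[Q]_x (w (h x))%:E <= b%:E)%E.
Proof.
move=> UF mh w0 PQ Pb; rewrite integral_nat_series//.
have t0 (V : probability T R) i : (0 <= (w i)%:E * V [set x | h x = i])%E.
  by rewrite mule_ge0// lee_fin.
have sumE (V : probability T R) n : (\sum_(0 <= i < n) (w i)%:E * V [set x | h x = i] =
    (\sum_(0 <= i < n) w i * fine (V [set x | h x = i]))%:E)%E.
  by rewrite -sumEFin; apply: eq_bigr => i _; rewrite EFinM probability_fineK.
apply: lime_le; first by apply: is_cvg_nneseries => n _ _; exact: t0.
apply: nearW => n; rewrite sumE lee_fin.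
have c : \sum_(0 <= i < n) w i * fine (P k [set x | h x = i]) @[k --> U] -->
    \sum_(0 <= i < n) w i * fine (Q [set x | h x = i]).
  elim: n {sumE} => [|n IH]; first by under eq_fun do rewrite big_nil; rewrite big_nil; exact: cvg_cst.
  under eq_fun do rewrite big_nat_recr//=; rewrite big_nat_recr//=.
  by apply: cvgD => //; apply: cvgM; [exact: cvg_cst | exact: PQ].
rewrite -(cvg_lim _ c)//; apply: limr_le; first by apply/cvg_ex; eexists; exact: c.
apply: filterS Pb => k; rewrite integral_nat_series// => h1.
rewrite -lee_fin -sumE; apply: le_trans h1; apply: nneseries_lim_ge => i _ _; exact: t0.
Qed.

Lemma integral_law {R : realType} d (T : measurableType d) d' (S : measurableType d')
    (P : probability T R) (Q : {measure set S -> \bar R}) (f : T -> S) (phi : S -> \bar R) :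
  measurable_fun setT f -> (forall A, measurable A -> P (f @^-1` A) = Q A) ->
  measurable_fun setT phi -> (forall y, 0 <= phi y)%E ->
  (\int[P]_x phi (f x) = \int[Q]_y phi y)%E.
Proof.
move=> mf PQ mphi phi0; have [V [VE <-//]] := pushforward_probability P mf.
apply: eq_measure_integral => A mA _; suff : Q A = V A by [].
by rewrite -PQ// -VE.
Qed.

(** * Couplings of rays and plans at finite times or at infinity *)

Section ray_couplings.
Context {R : realType} (X : completeMetricType R).
Hypothesis hX : hadamard X.
Variable q : nat -> X.
Hypothesis qd : forall (x : X) (e : R), 0 < e -> exists i, mdist (q i) x < e.

Local Notation RX := (borel (ray X)).
Local Notation CX := (borel (cone X)).
(** Scale 0 means cells of radius 1. They need not shrink, because costs are eventually divided by
    t^2. *)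
Local Notation idx := (dense_index qd 0).

Definition ray_at (t : R) (g : RX) : borel X := (g : ray X) t.
Definition cone_at (t : R) (x : CX) : borel X := cone_point (x : cone X) t.
Definition ray_end (g : RX) : CX := e_infty (g : ray X).

Lemma measurable_ray_at t : measurable_fun setT (ray_at t).
Proof. exact: measurable_ray_eval. Qed.

Lemma measurable_cone_at t : 0 <= t -> measurable_fun setT (cone_at t).
Proof. by move=> t0; exact: measurable_cone_point. Qed.

Lemma measurable_ray_end : measurable_fun setT ray_end.
Proof. exact: measurable_e_infty. Qed.

Lemma measurable_preimage d (T : measurableType d) d' (S : measurableType d')
    (f : T -> S) (A : set S) :
  measurable_fun setT f -> measurable A -> measurable (f @^-1` A).
Proof. by move=> mf mA; rewrite -[X in measurable X]setTI; exact: mf. Qed.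

Lemma measurable_dist2 d (T : measurableType d) (f g : T -> borel X) :
  measurable_fun setT f -> measurable_fun setT g ->
  measurable_fun setT (fun x => mdist (f x : X) (g x : X)).
Proof. exact: (measurable_mdist qd). Qed.

Lemma measurable_pair_dist d (T : measurableType d) d' (S : measurableType d')
    (f : T -> borel X) (g : S -> borel X) :
  measurable_fun setT f -> measurable_fun setT g ->
  measurable_fun setT (fun p : T * S => mdist (f p.1 : X) (g p.2 : X)).
Proof.
move=> mf mg; apply: measurable_dist2.
  exact: measurableT_comp mf (@measurable_fst _ _ T S).
exact: measurableT_comp mg (@measurable_snd _ _ T S).
Qed.

(** The cone topology is not the one of [d_infty]; measurability comes from the pointwise limit
    along integer times of distances between positions, which do depend continuously on the
    class. *)
Lemma measurable_d_infty :
  measurable_fun setT (fun p : CX * CX => d_infty (p.1 : cone X) (p.2 : cone X)).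
Proof.
apply: (@measurable_fun_cvg _ _ _ setT
  (fun n p => mdist (cone_at n%:R p.1 : X) (cone_at n%:R p.2 : X) * n%:R^-1)).
  move=> n; apply: measurable_funM => //; apply: measurable_pair_dist;
    exact: measurable_cone_at.
move=> p _; exact: cvg_comp (@cvgr_idn R) (@cone_point_d_infty_cvg _ _ hX p.1 p.2).
Qed.

Lemma mdist_idx (x y : X) : idx x = idx y -> mdist x y <= 2.
Proof.
move=> xy; have h1 := dense_indexP qd 0 x; have h2 := dense_indexP qd 0 y.
rewrite invr1 in h1 h2; rewrite xy in h1.
have := metric_triangle x (q (idx y)) y; rewrite (metric_sym x (q (idx y))).
by move=> *; lra.
Qed.

Lemma mdist_idx2 (x y x' y' : X) : idx x = idx x' -> idx y = idx y' ->
  mdist x y <= mdist x' y' + 4.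
Proof.
move=> /mdist_idx xx /mdist_idx yy.
have := mdist_lipschitz x y x' y'; rewrite ler_norml => /andP[_]; lra.
Qed.

Lemma measurable_idx d (T : measurableType d) (f : T -> borel X) i :
  measurable_fun setT f -> measurable [set x | idx (f x : X) = i].
Proof. exact: measurable_dense_index. Qed.

Section fixed_laws.
Variables (mu sigma : probability RX R).

Definition ray_coupling (V : probability (RX * RX)%type R) :=
  (forall A, measurable A -> V (fst @^-1` A) = mu A) /\
  (forall B, measurable B -> V (snd @^-1` B) = sigma B).

Definition point_dist (t : R) (p : RX * RX) : R :=
  mdist (ray_at t p.1 : X) point + mdist (ray_at t p.2 : X) point.

Let measurable_dist_point t : measurable_fun setT (fun g => mdist (ray_at t g : X) point).
Proof. by apply: measurable_dist2 => //; exact: measurable_ray_at. Qed.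

Lemma measurable_point_dist t : measurable_fun setT (point_dist t).
Proof.
apply: measurable_funD.
  exact: measurableT_comp (measurable_dist_point t) (@measurable_fst _ _ RX RX).
exact: measurableT_comp (measurable_dist_point t) (@measurable_snd _ _ RX RX).
Qed.

Lemma point_dist_ge0 t p : 0 <= point_dist t p.
Proof. by rewrite addr_ge0// mdist_ge0. Qed.

(** This error term splits over the two rays, so its second moment is bounded through the marginals,
    uniformly over all couplings. *)
Lemma integral_point_dist V (t M N : R) : ray_coupling V ->
  (\int[mu]_g (mdist (ray_at t g : X) point ^+ 2)%:E <= M%:E)%E ->
  (\int[sigma]_g (mdist (ray_at t g : X) point ^+ 2)%:E <= N%:E)%E ->
  (\int[V]_p (point_dist t p ^+ 2)%:E <= (2 * (M + N))%:E)%E.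
Proof.
move=> [V1 V2] muM sigmaN.
have -> : 2 * (M + N) = (1 + 1) * M + (1 + 1^-1) * N :> R by rewrite invr1; ring.
apply: (@integral_sqr_le_fin _ _ _ V (point_dist t)
  (fun p => mdist (ray_at t p.1 : X) point) (fun p => mdist (ray_at t p.2 : X) point)) => //.
- exact: measurable_point_dist.
- exact: measurableT_comp (measurable_dist_point t) (@measurable_fst _ _ RX RX).
- exact: measurableT_comp (measurable_dist_point t) (@measurable_snd _ _ RX RX).
- exact: point_dist_ge0.
- rewrite (integral_law (Q := mu) (f := fst)
    (phi := fun g => (mdist (ray_at t g : X) point ^+ 2)%:E))//.
    exact: measurable_sqr.
  by move=> g; rewrite lee_fin sqr_ge0.
- rewrite (integral_law (Q := sigma) (f := snd)
    (phi := fun g => (mdist (ray_at t g : X) point ^+ 2)%:E))//.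
    exact: measurable_sqr.
  by move=> g; rewrite lee_fin sqr_ge0.
Qed.

Variables (M N : R).
Hypothesis muM : (\int[mu]_g (mdist (ray_at 0 g : X) point ^+ 2)%:E <= M%:E)%E.
Hypothesis sigmaN : (\int[sigma]_g (mdist (ray_at 0 g : X) point ^+ 2)%:E <= N%:E)%E.

Local Notation start_dist := (point_dist 0).

Let ray_dist t (p : RX * RX) : R := mdist (ray_at t p.1 : X) (ray_at t p.2 : X).

Lemma measurable_ray_dist t : measurable_fun setT (ray_dist t).
Proof. by apply: measurable_pair_dist; exact: measurable_ray_at. Qed.

(* Lifts a plan on the cone to a plan on rays through the cells cut out by the
   position at time t of the rays issued from the base point. *)
Lemma ray_coupling_of_cone (e : R) : 0 < e -> exists2 C : R, 0 <= C &
  forall (Q : probability (CX * CX)%type R) (A t : R), 0 <= t ->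
  (forall B, measurable B -> Q (fst @^-1` B) = mu (ray_end @^-1` B)) ->
  (forall B, measurable B -> Q (snd @^-1` B) = sigma (ray_end @^-1` B)) ->
  (\int[Q]_p (d_infty (p.1 : cone X) (p.2 : cone X) ^+ 2)%:E <= A%:E)%E ->
  exists2 V, ray_coupling V &
    (\int[V]_p (ray_dist t p ^+ 2)%:E <= ((1 + e) ^+ 2 * t ^+ 2 * A + C)%:E)%E.
Proof.
move=> e0; have ei0 : 0 < e^-1 by rewrite invr_gt0.
have M0 : 0 <= M.
  by rewrite -lee_fin; apply: le_trans muM; apply: integral_ge0 => g _; rewrite lee_fin sqr_ge0.
have N0 : 0 <= N.
  by rewrite -lee_fin; apply: le_trans sigmaN; apply: integral_ge0 => g _; rewrite lee_fin sqr_ge0.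
(* Young's inequality is used twice: for the error 4 due to cells, then for the distance between
   rays and their based representatives, controlled by the starting points. *)
exists ((1 + e) * ((1 + e^-1) * 4 ^+ 2) + (1 + e^-1) * (2 * (M + N))).
  by rewrite addr_ge0 ?mulr_ge0 ?addr_ge0// ?ltW.
move=> Q A t t0 Q1 Q2 QA.
have mct := measurable_cone_at t0; have mre := measurable_ray_end.
have mcr : measurable_fun setT (cone_at t \o ray_end) := measurableT_comp mct mre.
(* The cells are those of the representatives from the base point, not of the rays themselves: these
   labels factor through the cone, so their laws under Q and under [mu], [sigma] agree. *)
have [||||i|i|V [V1 V2 Vint]] := @discrete_gluing _ _ RX _ RX _ (CX * CX)%type mu sigma Q
  (fun g => idx (cone_at t (ray_end g) : X)) (fun g => idx (cone_at t (ray_end g) : X))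
  (fun p => idx (cone_at t p.1 : X)) (fun p => idx (cone_at t p.2 : X)).
- by move=> i; exact: measurable_idx mcr.
- by move=> i; exact: measurable_idx mcr.
- move=> i; apply: measurable_idx; exact: measurableT_comp mct (@measurable_fst _ _ CX CX).
- move=> i; apply: measurable_idx; exact: measurableT_comp mct (@measurable_snd _ _ CX CX).
- by rewrite -(Q1 [set x | idx (cone_at t x : X) = i])//; exact: measurable_idx.
- by rewrite -(Q2 [set x | idx (cone_at t x : X) = i])//; exact: measurable_idx.
exists V => //.
pose f p := mdist (cone_at t (ray_end p.1) : X) (cone_at t (ray_end p.2) : X).
pose b (p : CX * CX) := t * d_infty (p.1 : cone X) (p.2 : cone X).
have mf : measurable_fun setT f := measurable_pair_dist mcr mcr.
have mb : measurable_fun setT b by apply: measurable_funM => //; exact: measurable_d_infty.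
have mb4 : measurable_fun setT (fun p => b p + 4) by exact: measurable_funD.
have b0 p : 0 <= b p by rewrite mulr_ge0// d_infty_ge0.
have fV : (\int[V]_p (f p ^+ 2)%:E <= ((1 + e) * (t ^+ 2 * A) + (1 + e^-1) * 4 ^+ 2)%:E)%E.
  apply: (@le_trans _ _ (\int[Q]_p ((b p + 4) ^+ 2)%:E)%E).
    apply: Vint => //.
    - exact: measurable_sqr.
    - exact: measurable_sqr.
    - by move=> p; rewrite lee_fin sqr_ge0.
    - by move=> p; rewrite lee_fin sqr_ge0.
    move=> g h [x y] /= gx hy; rewrite lee_fin ler_sqr ?nnegrE ?mdist_ge0 ?addr_ge0//.
    by apply: le_trans (mdist_idx2 gx hy) _; rewrite lerD2r cone_point_dist_le.
  apply: (@integral_sqr_le_fin _ _ _ Q (fun p => b p + 4) b (cst 4)) => //.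
  - by move=> p; rewrite addr_ge0.
  - by rewrite integral_sqr_scale ?EFinM ?lee_wpmul2l ?lee_fin ?sqr_ge0//; exact: measurable_d_infty.
  - by rewrite integral_sqr_cst.
have -> : (1 + e) ^+ 2 * t ^+ 2 * A + ((1 + e) * ((1 + e^-1) * 4 ^+ 2) + (1 + e^-1) * (2 * (M + N))) =
  (1 + e) * ((1 + e) * (t ^+ 2 * A) + (1 + e^-1) * 4 ^+ 2) + (1 + e^-1) * (2 * (M + N)).
  by move: (e^-1) => e'; ring.
apply: (@integral_sqr_le_fin _ _ _ V (ray_dist t) f start_dist) => //.
- exact: measurable_ray_dist.
- exact: measurable_point_dist.
- by move=> p; exact: mdist_ge0.
- move=> p; have := cone_point_near hX (p.1 : ray X) t0; have := cone_point_near hX (p.2 : ray X) t0.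
  have := metric_triangle (ray_at t p.1 : X) (cone_at t (ray_end p.1) : X) (ray_at t p.2 : X).
  have := metric_triangle (cone_at t (ray_end p.1) : X) (cone_at t (ray_end p.2) : X) (ray_at t p.2 : X).
  rewrite (metric_sym (cone_at t (ray_end p.2) : X) (ray_at t p.2 : X)).
  rewrite /ray_dist /f /point_dist /ray_at /cone_at /ray_end.
  by move=> *; lra.
- exact: integral_point_dist.
Qed.

(** Rays are attached to a pair of points when they pass through their cells at time t. V is chosen
    before e, so that one sequence of couplings serves all values of e. *)
Lemma ray_coupling_of_plan (t : R) (Pi : probability (borel X * borel X)%type R) : 0 <= t ->
  (forall B, measurable B -> Pi (fst @^-1` B) = mu (ray_at t @^-1` B)) ->
  (forall B, measurable B -> Pi (snd @^-1` B) = sigma (ray_at t @^-1` B)) ->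
  exists2 V, ray_coupling V & forall e c : R, 0 < e ->
    (\int[Pi]_p (mdist (p.1 : X) (p.2 : X) ^+ 2)%:E <= c%:E)%E ->
    (\int[V]_p (ray_dist t p ^+ 2)%:E <= ((1 + e) * c + (1 + e^-1) * 4 ^+ 2)%:E)%E.
Proof.
move=> t0 Pi1 Pi2; have mr := @measurable_ray_at t.
have mid : measurable_fun setT (fun x : borel X => x) by exact: measurable_id.
have [||||i|i|V [V1 V2 Vint]] := @discrete_gluing _ _ RX _ RX _ (borel X * borel X)%type
  mu sigma Pi (fun g => idx (ray_at t g : X)) (fun g => idx (ray_at t g : X))
  (fun p => idx (p.1 : X)) (fun p => idx (p.2 : X)).
- by move=> i; exact: measurable_idx mr.
- by move=> i; exact: measurable_idx mr.
- by move=> i; apply: measurable_idx; exact: measurable_fst.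
- by move=> i; apply: measurable_idx; exact: measurable_snd.
- by rewrite -(Pi1 [set x | idx (x : X) = i])//; exact: measurable_idx mid.
- by rewrite -(Pi2 [set x | idx (x : X) = i])//; exact: measurable_idx mid.
exists V => // e c e0 Pic.
have md : measurable_fun setT (fun p : borel X * borel X => mdist (p.1 : X) (p.2 : X)).
  exact: (measurable_pair_dist mid mid).
have md4 : measurable_fun setT (fun p : borel X * borel X => mdist (p.1 : X) (p.2 : X) + 4).
  exact: measurable_funD.
apply: (@le_trans _ _ (\int[Pi]_p ((mdist (p.1 : X) (p.2 : X) + 4) ^+ 2)%:E)%E).
  apply: Vint => //.
  - by apply: measurable_sqr; exact: measurable_ray_dist.
  - exact: measurable_sqr.
  - by move=> p; rewrite lee_fin sqr_ge0.
  - by move=> p; rewrite lee_fin sqr_ge0.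
  move=> g h [x y] /= gx hy; rewrite lee_fin ler_sqr ?nnegrE ?mdist_ge0 ?addr_ge0 ?mdist_ge0//.
  exact: mdist_idx2.
apply: (@integral_sqr_le_fin _ _ _ Pi (fun p => mdist (p.1 : X) (p.2 : X) + 4)
  (fun p => mdist (p.1 : X) (p.2 : X)) (cst 4)) => //.
- by move=> p; rewrite addr_ge0 ?mdist_ge0.
- by rewrite integral_sqr_cst.
Qed.

(** The distance between centres of cells takes countably many values and is within 2 of the true
    distance; integrals of such functions can be followed along the ultralimit. *)
Let cell_dist (m : nat) (p : RX * RX) : R :=
  mdist (q (idx (ray_at m%:R p.1 : X))) (q (idx (ray_at m%:R p.2 : X))).

Let cell_dist_ray_dist m p : `|cell_dist m p - ray_dist m%:R p| <= 2.
Proof.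
have := mdist_lipschitz (q (idx (ray_at m%:R p.1 : X))) (q (idx (ray_at m%:R p.2 : X)))
  (ray_at m%:R p.1 : X) (ray_at m%:R p.2 : X).
have := dense_indexP qd 0 (ray_at m%:R p.1 : X); have := dense_indexP qd 0 (ray_at m%:R p.2 : X).
by rewrite invr1 /cell_dist /ray_dist => *; lra.
Qed.

Let cell_pair m (p : RX * RX) : nat :=
  pickle (idx (ray_at m%:R p.1 : X), idx (ray_at m%:R p.2 : X)).

Let cell_weight (n : nat) : R :=
  if @pickle_inv (nat * nat)%type n is Some (i, j) then mdist (q i) (q j) ^+ 2 else 0.

Let cell_weightE m p : cell_weight (cell_pair m p) = cell_dist m p ^+ 2.
Proof. by rewrite /cell_weight /cell_pair pickleK_inv. Qed.

(** The event is a rectangle cut out by one bit of each code, the form in which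
    [couplings_ultralimit] gives convergence. *)
Let cell_pair_set m n : [set p | cell_pair m p = n] =
  if @pickle_inv (nat * nat)%type n is Some (i, j) then
    [set g : RX | ray_code qd g (pickle (m, 0%N, i))] `*`
    [set g : RX | ray_code qd g (pickle (m, 0%N, j))] else set0.
Proof.
apply/seteqP; split=> p /=.
  move=> <-; rewrite /cell_pair pickleK_inv /ray_code /=.
  by split; rewrite /= pickleK eqxx.
have := @pickle_invK (nat * nat)%type n; case: pickle_inv => [[i j]|//] /= <-.
by rewrite /ray_code/= !pickleK /cell_pair => -[/eqP -> /eqP ->].
Qed.

Let measurable_cell_dist m : measurable_fun setT (cell_dist m).
Proof.
move=> _ Y mY; rewrite setTI [X in measurable X](_ : _ =
  \bigcup_(ij in [set ij : nat * nat | Y (mdist (q ij.1) (q ij.2))])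
    ([set g : RX | idx (ray_at m%:R g : X) = ij.1] `*` [set g : RX | idx (ray_at m%:R g : X) = ij.2])).
  apply: countable_bigcup_measurable => ij _; apply: measurableX;
    apply: measurable_idx; exact: measurable_ray_at.
apply/seteqP; split=> p /=.
  by move=> Yp; exists (idx (ray_at m%:R p.1 : X), idx (ray_at m%:R p.2 : X)).
by move=> [[i j] /= + [/= gi hj]]; rewrite /cell_dist gi hj.
Qed.

Lemma cone_plan_of_ray_couplings (t : nat -> R) (V : nat -> probability (RX * RX)%type R) (A : R) :
  0 <= A -> (forall k, 0 < t k) -> t k @[k --> \oo] --> +oo ->
  (forall k, ray_coupling (V k)) ->
  (forall a, A < a -> \forall k \near \oo,
    (\int[V k]_p (ray_dist (t k) p ^+ 2)%:E <= (a * t k ^+ 2)%:E)%E) ->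
  exists Q : probability (CX * CX)%type R,
    [/\ forall B, measurable B -> Q (fst @^-1` B) = mu (ray_end @^-1` B),
        forall B, measurable B -> Q (snd @^-1` B) = sigma (ray_end @^-1` B) &
        (\int[Q]_p (d_infty (p.1 : cone X) (p.2 : cone X) ^+ 2)%:E <= A%:E)%E].
Proof.
move=> A0 t0 ty cV VA.
have M0 : 0 <= M.
  by rewrite -lee_fin; apply: le_trans muM; apply: integral_ge0 => g _; rewrite lee_fin sqr_ge0.
have N0 : 0 <= N.
  by rewrite -lee_fin; apply: le_trans sigmaN; apply: integral_ge0 => g _; rewrite lee_fin sqr_ge0.
(* U refines convergence to infinity, so bounds valid for all large k hold along U. *)
have [U [UU subU]] := ultraFilterLemma eventually_filter.
have coding_ray := ray_coding qd hX.
have [P [P1 P2 PU]] := @couplings_ultralimit _ _ U UU _ _ _ _ _ _ _ _ coding_ray coding_ray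
  mu sigma V (fun k => (cV k).1) (fun k => (cV k).2).
have PC : ray_coupling P by [].
have cell_lim m n : fine (V k [set p | cell_pair m p = n]) @[k --> U] -->
    fine (P [set p | cell_pair m p = n]).
  rewrite cell_pair_set; case: pickle_inv => [[i j]|]; first exact: PU.
  by rewrite measure0; under eq_fun do rewrite measure0; exact: cvg_cst.
have cell_meas m n : measurable [set p | cell_pair m p = n].
  rewrite cell_pair_set; case: pickle_inv => [[i j]|//].
  have [mc _ _] := coding_ray.
  by apply: measurableX; exact: measurable_coding_bit.
(* The bound on the scale m is inherited from the scale t k by convexity. *)
have scale (e : R) : 0 < e -> exists C : R, forall m : nat, (0 < m)%N ->
    (\int[P]_p (ray_dist m%:R p ^+ 2)%:E <= ((1 + e) ^+ 2 * (A + e) * m%:R ^+ 2 + C)%:E)%E.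
  move=> e0; have ei0 : 0 < e^-1 by rewrite invr_gt0.
  (* K bounds the errors of cells and starting points along V; the second summand below is the cell
     error for P. Neither depends on m. *)
  pose K := (1 + e^-1) * ((1 + 1) * 2 ^+ 2 + (1 + 1^-1) * (2 * (M + N))).
  exists ((1 + e) * K + (1 + e^-1) * 2 ^+ 2) => m m0.
  have mp : 0 < m%:R :> R by rewrite ltr0n.
  have cellP : (\int[P]_p (cell_dist m p ^+ 2)%:E <= ((1 + e) * ((A + e) * m%:R ^+ 2) + K)%:E)%E.
    rewrite (eq_integral (fun p => (cell_weight (cell_pair m p))%:E)); last first.
      by move=> p _; rewrite cell_weightE.
    apply: (integral_nat_ultralimit_le (P := V) (U := U)) => //.
    - by move=> n; rewrite /cell_weight; case: pickle_inv => [[i j]|//]; rewrite sqr_ge0.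
    - apply: subU; have Ae : A < A + e by rewrite ltrDl.
      have tm : \forall k \near \oo, m%:R <= t k by move/cvgryPge : ty; apply.
      near=> k; rewrite (eq_integral (fun p => (cell_dist m p ^+ 2)%:E)); last first.
        by move=> p _; rewrite cell_weightE.
      have tk0 := t0 k; have mtk : m%:R <= t k by near: k.
      have Vk : (\int[V k]_p (ray_dist (t k) p ^+ 2)%:E <= ((A + e) * t k ^+ 2)%:E)%E.
        by near: k; exact: VA.
      (* By convexity the distance at time m is at most [a] plus the initial distance; the factor
         [m / t k] cancels [t k ^+ 2] in the cost. *)
      pose a p := m%:R / t k * ray_dist (t k) p.
      pose b p := 2 + start_dist p.
      have ma : measurable_fun setT a by apply: measurable_funM => //; exact: measurable_ray_dist.
      have mb : measurable_fun setT b by apply: measurable_funD => //; exact: measurable_point_dist.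
      apply: (@integral_sqr_le_fin _ _ _ (V k) (cell_dist m) a b) => //.
      + by move=> p; exact: mdist_ge0.
      + move=> p; have := cell_dist_ray_dist m p; rewrite ler_norml => /andP[_ h1].
        have h2 : t k * ray_dist m%:R p <= t k * (a p + start_dist p).
          have := ray_convex0 hX (p.1 : ray X) (p.2 : ray X) (ltW mp) mtk.
          rewrite -/(ray_dist m%:R p) -/(ray_dist (t k) p).
          have d0 : mdist ((p.1 : ray X) 0) ((p.2 : ray X) 0) <= start_dist p.
            rewrite /point_dist (metric_sym (ray_at 0 p.2 : X)).
            exact: metric_triangle.
          have := mdist_ge0 ((p.1 : ray X) 0) ((p.2 : ray X) 0).
          have -> : t k * (a p + start_dist p) = m%:R * ray_dist (t k) p + t k * start_dist p.
            by rewrite /a; field; rewrite gt_eqF.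
          by move=> *; nra.
        by rewrite ler_pM2l// in h2; rewrite /b; lra.
      + rewrite integral_sqr_scale; last exact: measurable_ray_dist.
        apply: (@le_trans _ _ (((m%:R / t k) ^+ 2)%:E * ((A + e) * t k ^+ 2)%:E)%E).
          by rewrite lee_wpmul2l// lee_fin sqr_ge0.
        rewrite -EFinM lee_fin le_eqVlt; apply/orP; left; apply/eqP.
        by field; rewrite gt_eqF.
      + apply: (@integral_sqr_le_fin _ _ _ (V k) b (cst 2) start_dist 1) => //.
        * exact: measurable_point_dist.
        * by move=> p; rewrite addr_ge0// point_dist_ge0.
        * by rewrite integral_sqr_cst.
        * exact: integral_point_dist.
  have -> : (1 + e) ^+ 2 * (A + e) * m%:R ^+ 2 + ((1 + e) * K + (1 + e^-1) * 2 ^+ 2) =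
    (1 + e) * ((1 + e) * ((A + e) * m%:R ^+ 2) + K) + (1 + e^-1) * 2 ^+ 2.
    by move: (e^-1) (K) => e' K'; ring.
  apply: (@integral_sqr_le_fin _ _ _ P (ray_dist m%:R) (cell_dist m) (cst 2)) => //.
  - exact: measurable_ray_dist.
  - by move=> p; exact: mdist_ge0.
  - by move=> p; have := cell_dist_ray_dist m p; rewrite ler_norml /= => /andP[]; lra.
  - by rewrite integral_sqr_cst.
have mend : measurable_fun setT (fun p : RX * RX => (ray_end p.1, ray_end p.2)).
  apply: measurable_fun_pair.
    exact: measurableT_comp measurable_ray_end (@measurable_fst _ _ RX RX).
  exact: measurableT_comp measurable_ray_end (@measurable_snd _ _ RX RX).
have [Q [QE Qint]] := pushforward_probability P mend.
exists Q; split.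
- by move=> B mB; rewrite QE -P1//; exact: measurable_preimage measurable_ray_end mB.
- by move=> B mB; rewrite QE -P2//; exact: measurable_preimage measurable_ray_end mB.
rewrite (Qint (fun p => (d_infty (p.1 : cone X) (p.2 : cone X) ^+ 2)%:E)); last 2 first.
- by apply: measurable_sqr; exact: measurable_d_infty.
- by move=> p; rewrite lee_fin sqr_ge0.
have fatou_e (e : R) : 0 < e ->
    (\int[P]_p (d_infty (ray_end p.1 : cone X) (ray_end p.2 : cone X) ^+ 2)%:E <=
      ((1 + e) ^+ 2 * (A + e) + e)%:E)%E.
  move=> e0; have [C HC] := scale _ e0.
  apply: (@integral_le_pointwise_cvg _ _ _ P (fun n p => (n%:R^-1 * ray_dist n%:R p) ^+ 2)).
  - by move=> n; apply: measurable_funX; apply: measurable_funM => //; exact: measurable_ray_dist.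
  - by move=> n p; rewrite sqr_ge0.
  - move=> p; rewrite d_infty_e_infty//.
    have c : n%:R^-1 * ray_dist n%:R p @[n --> \oo] --> ray_d_infty (p.1 : ray X) (p.2 : ray X).
      under eq_fun do rewrite mulrC.
      exact: cvg_comp (@cvgr_idn R) (@ray_d_infty_cvg _ _ hX (p.1 : ray X) (p.2 : ray X)).
    by under eq_fun do rewrite expr2; rewrite expr2; exact: cvgM.
  - near=> n; have n0 : (0 < n)%N by near: n; exact: nbhs_infty_gt.
    have np : 0 < n%:R :> R by rewrite ltr0n.
    have nC : C / e <= n%:R by near: n; exact: nbhs_infty_ger.
    rewrite integral_sqr_scale; last exact: measurable_ray_dist.
    apply: (@le_trans _ _ ((n%:R^-1 ^+ 2)%:E * ((1 + e) ^+ 2 * (A + e) * n%:R ^+ 2 + C)%:E)%E).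
      by rewrite lee_wpmul2l// ?lee_fin ?sqr_ge0//; exact: HC.
    rewrite -EFinM lee_fin mulrDr [X in X + _](_ : _ = (1 + e) ^+ 2 * (A + e)); last first.
      by field; rewrite gt_eqF.
    rewrite lerD2l exprVn mulrC ler_pdivrMr ?exprn_gt0//.
    rewrite ler_pdivrMr// in nC; apply: le_trans nC _.
    rewrite mulrC ler_pM2l// ler_eXnr// ler1n.
    by [].
apply/lee_addgt0Pr => d d0.
(* For [e <= 1] one has [(1 + e)^2 <= 1 + 3 * e], and the bound of [fatou_e] exceeds A by at most
   [e * (3 * A + 5)]. *)
pose e := Num.min 1 (d / (7 * A + 9)).
have A9 : 0 < 7 * A + 9 by lra.
have e0 : 0 < e by rewrite lt_min ltr01 divr_gt0.
have e1 : e <= 1 by rewrite ge_min lexx.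
have ed : e * (7 * A + 9) <= d by rewrite -ler_pdivlMr// ge_min lexx orbT.
apply: le_trans (fatou_e e e0) _; rewrite -EFinD lee_fin.
have h1 : (1 + e) ^+ 2 <= 1 + 3 * e by rewrite sqrrD; nra.
have : (1 + e) ^+ 2 * (A + e) <= (1 + 3 * e) * (A + e) by rewrite ler_wpM2r//; lra.
nra.
Unshelve. all: by end_near. Qed.

End fixed_laws.
End ray_couplings.

(** * The asymptotic formula *)

Section wasserstein_infimum.
Context {R : realType} d (T : measurableType d) (c : T -> T -> R).
Variables (P Q : set T -> \bar R).

Let cost (Pi : probability (T * T)%type R) := (\int[Pi]_x ((c x.1 x.2) ^+ 2)%:E)%E.

(** One plan of finite cost makes the infimum a real number r. Plans that are optimal up to e are
    enough below, so attainment is never invoked. *)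
Lemma wasserstein_fin (Pi0 : probability (T * T)%type R) (b : R) :
  transport_plans P Q Pi0 -> (cost Pi0 <= b%:E)%E ->
  exists r : R, [/\ 0 <= r, wasserstein c P Q = (Num.sqrt r)%:E,
    forall Pi, transport_plans P Q Pi -> (r%:E <= cost Pi)%E &
    forall e, 0 < e -> exists2 Pi, transport_plans P Q Pi & (cost Pi <= (r + e)%:E)%E].
Proof.
move=> plan0 cost0; rewrite /wasserstein; set S := [set _ | _ in _].
have S0 : (0 <= ereal_inf S)%E.
  apply: le_ereal_inf_tmp => _ [Pi _ <-]; apply: integral_ge0 => x _.
  by rewrite lee_fin sqr_ge0.
have Slb Pi : transport_plans P Q Pi -> (ereal_inf S <= cost Pi)%E.
  by move=> pPi; apply: ereal_inf_lbound; exists Pi.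
have Sfin : ereal_inf S \is a fin_num.
  by rewrite ge0_fin_numE// (le_lt_trans (Slb _ plan0))// (le_lt_trans cost0)// ltry.
exists (fine (ereal_inf S)); split.
- exact: fine_ge0.
- by rewrite -[in LHS](fineK Sfin).
- by move=> Pi pPi; rewrite fineK//; exact: Slb.
move=> e e0; have [_ [Pi pPi <-] lt] := lb_ereal_inf_adherent e0 Sfin.
by exists Pi => //; rewrite EFinD fineK// ltW.
Qed.

End wasserstein_infimum.

Section asymptotic_formula.
Context {R : realType} (X : completeMetricType R).
Hypothesis hX : hadamard X.
Variable q : nat -> X.
Hypothesis qd : forall (x : X) (e : R), 0 < e -> exists i, mdist (q i) x < e.
Variables (mu_ sigma_ : R -> W2 X) (mu sigma : probability (borel (ray X)) R).
Hypothesis hmu : displacement_interpolation mu_ mu.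
Hypothesis hsigma : displacement_interpolation sigma_ sigma.

Local Notation RX := (borel (ray X)).
Local Notation CX := (borel (cone X)).

Lemma displacement_second_moment (nu_ : R -> W2 X) (nu : probability RX R) (t : R) :
  displacement_interpolation nu_ nu -> 0 <= t ->
  exists M : R, (\int[nu]_g (mdist (ray_at t g : X) point ^+ 2)%:E <= M%:E)%E.
Proof.
move=> hnu t0; have [x0 fin] := set_valP (nu_ t).
have mr := @measurable_ray_at _ X t.
have md (a : X) : measurable_fun setT (fun g => mdist a (ray_at t g : X)).
  by apply: (measurable_dist2 qd) => //; exact: measurable_cst.
pose M := fine (\int[W2_prob (nu_ t)]_x (mdist x0 (x : X) ^+ 2)%:E).
have nuM : (\int[nu]_g (mdist x0 (ray_at t g : X) ^+ 2)%:E <= M%:E)%E.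
  rewrite (integral_law (Q := W2_prob (nu_ t)) (f := ray_at t)
    (phi := fun x : borel X => (mdist x0 (x : X) ^+ 2)%:E))//; last 3 first.
  - by move=> A mA; exact: hnu.
  - by apply: measurable_sqr; exact: borel_measurable_mdist.
  - by move=> x; rewrite lee_fin sqr_ge0.
  rewrite /M fineK// ge0_fin_numE//; apply: integral_ge0 => x _.
  by rewrite lee_fin sqr_ge0.
exists ((1 + 1) * M + (1 + 1^-1) * mdist x0 point ^+ 2).
apply: (@integral_sqr_le_fin _ _ _ nu (fun g => mdist (ray_at t g : X) point)
  (fun g => mdist x0 (ray_at t g : X)) (cst (mdist x0 point))) => //.
- by apply: (measurable_dist2 qd) => //; exact: measurable_cst.
- by move=> g; exact: mdist_ge0.
- move=> g /=; rewrite (metric_sym x0 (ray_at t g : X)).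
  exact: metric_triangle.
- by rewrite integral_sqr_cst.
Qed.

Lemma plan_of_ray_coupling (V : probability (RX * RX)%type R) (t : R) :
  0 <= t -> ray_coupling mu sigma V ->
  exists2 Pi, transport_plans (mu_ t) (sigma_ t) Pi &
    (\int[Pi]_x (mdist (x.1 : X) (x.2 : X) ^+ 2)%:E =
     \int[V]_p (mdist (ray_at t p.1 : X) (ray_at t p.2 : X) ^+ 2)%:E)%E.
Proof.
move=> t0 [V1 V2]; have mr := @measurable_ray_at _ X t.
have me : measurable_fun setT (fun p : RX * RX => (ray_at t p.1, ray_at t p.2)).
  apply: measurable_fun_pair.
    exact: measurableT_comp mr (@measurable_fst _ _ RX RX).
  exact: measurableT_comp mr (@measurable_snd _ _ RX RX).
have [Pi [PiE Piint]] := pushforward_probability V me.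
exists Pi.
  split=> A mA; rewrite /pushforward PiE.
    by rewrite -(hmu t0 mA) /pushforward -V1//; exact: measurable_preimage mr mA.
  by rewrite -(hsigma t0 mA) /pushforward -V2//; exact: measurable_preimage mr mA.
rewrite (Piint (fun x => (mdist (x.1 : X) (x.2 : X) ^+ 2)%:E))//.
  have mid : measurable_fun setT (fun x : borel X => x) by exact: measurable_id.
  by apply: measurable_sqr; exact: (measurable_pair_dist qd mid mid).
by move=> x; rewrite lee_fin sqr_ge0.
Qed.

(** With a single label for all rays, [discrete_coupling] yields the product coupling. *)
Lemma ray_coupling_exists : exists V, ray_coupling mu sigma V.
Proof.
have mc d (T : measurableType d) i : measurable [set x : T | 0%N = i].
  have [->|ni] := eqVneq i 0%N.
    by rewrite [X in measurable X](_ : _ = setT)//; apply/seteqP; split.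
  rewrite [X in measurable X](_ : _ = set0)//; apply/seteqP; split=> // x /= i0.
  by rewrite i0 eqxx in ni.
have [||i|V [V1 V2 _]] := @discrete_coupling _ _ RX _ RX mu sigma (fun=> 0%N) (fun=> 0%N).
- exact: mc.
- exact: mc.
- have [->|ni] := eqVneq i 0%N.
    have -> : [set x : RX | 0%N = 0%N] = setT by apply/seteqP; split.
    by rewrite (probability_setT mu) (probability_setT sigma).
  have -> : [set x : RX | 0%N = i] = set0.
    by apply/seteqP; split=> // x /= i0; rewrite i0 eqxx in ni.
  by rewrite (measure0 mu) (measure0 sigma).
by exists V.
Qed.

Lemma measurable_ray_end_pair :
  measurable_fun setT (fun p : RX * RX => (@ray_end _ X p.1, @ray_end _ X p.2)).
Proof.
apply: measurable_fun_pair.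
  exact: measurableT_comp (measurable_ray_end hX) (@measurable_fst _ _ RX RX).
exact: measurableT_comp (measurable_ray_end hX) (@measurable_snd _ _ RX RX).
Qed.

Lemma cone_plan_of_ray_coupling (V : probability (RX * RX)%type R) : ray_coupling mu sigma V ->
  exists Q : probability (CX * CX)%type R,
    transport_plans (asymptotic_measure mu) (asymptotic_measure sigma) Q /\
    (\int[Q]_x (d_infty (x.1 : cone X) (x.2 : cone X) ^+ 2)%:E =
     \int[V]_p (ray_d_infty (p.1 : ray X) (p.2 : ray X) ^+ 2)%:E)%E.
Proof.
move=> [V1 V2]; have mr := measurable_ray_end hX.
have [Q [QE Qint]] := pushforward_probability V measurable_ray_end_pair.
exists Q; split.
  split=> A mA; rewrite /pushforward QE.
    by rewrite -[RHS]V1//; exact: measurable_preimage mr mA.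
  by rewrite -[RHS]V2//; exact: measurable_preimage mr mA.
rewrite (Qint (fun x => (d_infty (x.1 : cone X) (x.2 : cone X) ^+ 2)%:E)).
- by apply: eq_integral => p _; rewrite d_infty_e_infty.
- by apply: measurable_sqr; exact: (measurable_d_infty hX qd).
- by move=> x; rewrite lee_fin sqr_ge0.
Qed.

Let Wt t := W (mu_ t) (sigma_ t).

(** Any coupling will do: [d_infty] is at most the sum of the speeds, which is bounded by distances
    to [point] at times 0 and 1, of finite second moment. *)
Lemma finite_cost_cone_plan : exists (Q : probability (CX * CX)%type R) (c : R),
  transport_plans (asymptotic_measure mu) (asymptotic_measure sigma) Q /\
  (\int[Q]_x (d_infty (x.1 : cone X) (x.2 : cone X) ^+ 2)%:E <= c%:E)%E.
Proof.
have [V cV] := ray_coupling_exists; have [Q [planQ QE]] := cone_plan_of_ray_coupling cV.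
have [M0 hM0] := displacement_second_moment hmu (lexx 0).
have [N0 hN0] := displacement_second_moment hsigma (lexx 0).
have [M1 hM1] := displacement_second_moment hmu ler01.
have [N1 hN1] := displacement_second_moment hsigma ler01.
exists Q, ((1 + 1) * (2 * (M0 + N0)) + (1 + 1^-1) * (2 * (M1 + N1))); split=> //.
rewrite QE; apply: (@integral_sqr_le_fin _ _ _ V
  (fun p => ray_d_infty (p.1 : ray X) (p.2 : ray X)) (point_dist 0) (point_dist 1)) => //.
- rewrite (_ : (fun p : RX * RX => _) = (fun p : RX * RX =>
    d_infty (ray_end p.1 : cone X) (ray_end p.2 : cone X))); last first.
    by apply/funext => p; rewrite d_infty_e_infty.
  exact: (measurableT_comp (measurable_d_infty hX qd) measurable_ray_end_pair).
- exact: (measurable_point_dist qd).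
- exact: (measurable_point_dist qd).
- by move=> p; exact: ray_d_infty_ge0.
- move=> p; apply: le_trans (ray_d_infty_le hX _ _) _.
  have h1 := metric_triangle ((p.1 : ray X) 0) point ((p.1 : ray X) 1).
  have h2 := metric_triangle ((p.2 : ray X) 0) point ((p.2 : ray X) 1).
  rewrite (metric_sym point) in h1; rewrite (metric_sym point) in h2.
  by rewrite /speed /point_dist /ray_at; lra.
- exact: (integral_point_dist qd cV).
- exact: (integral_point_dist qd cV).
Qed.

Lemma W_upper (e : R) : 0 < e -> exists2 C : R, 0 <= C &
  forall (Q : probability (CX * CX)%type R) (A t : R), 0 <= t ->
    transport_plans (asymptotic_measure mu) (asymptotic_measure sigma) Q ->
    (\int[Q]_x (d_infty (x.1 : cone X) (x.2 : cone X) ^+ 2)%:E <= A%:E)%E ->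
    exists r, [/\ 0 <= r, Wt t = Num.sqrt r, r <= (1 + e) ^+ 2 * t ^+ 2 * A + C &
      forall d, 0 < d -> exists2 Pi, transport_plans (mu_ t) (sigma_ t) Pi &
        (\int[Pi]_x (mdist (x.1 : X) (x.2 : X) ^+ 2)%:E <= (r + d)%:E)%E].
Proof.
move=> e0.
have [M hM] := displacement_second_moment hmu (lexx 0).
have [N hN] := displacement_second_moment hsigma (lexx 0).
have [C C0 hC] := ray_coupling_of_cone hX qd hM hN e0.
exists C => // Q A t t0 [Q1 Q2] QA.
have [V cV VC] := hC Q A t t0 Q1 Q2 QA.
have [Pi planPi PiE] := plan_of_ray_coupling t0 cV.
rewrite -PiE in VC.
have [r [r0 rW rlb rub]] := wasserstein_fin planPi VC.
exists r; split=> //; first by rewrite /Wt /W rW.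
by rewrite -lee_fin; exact: le_trans (rlb _ planPi) VC.
Qed.

(** [W] is the finite part of an extended real, so near-optimal plans for it exist only once the
    infimum is known to be finite; [W_upper] gives this from any cone plan of finite cost. *)
Lemma W_finite (t : R) : 0 <= t -> 0 <= Wt t /\
  forall d, 0 < d -> exists2 Pi, transport_plans (mu_ t) (sigma_ t) Pi &
    (\int[Pi]_x (mdist (x.1 : X) (x.2 : X) ^+ 2)%:E <= (Wt t ^+ 2 + d)%:E)%E.
Proof.
move=> t0; have [Q [c [planQ Qc]]] := finite_cost_cone_plan.
have [C _ hC] := W_upper ltr01.
have [r [r0 -> _ rub]] := hC Q c t t0 planQ Qc.
by rewrite sqrtr_ge0 sqr_sqrtr.
Qed.

Lemma W_lower (t : nat -> R) (A : R) : 0 <= A -> (forall k, 0 < t k) ->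
  t k @[k --> \oo] --> +oo ->
  (forall a, A < a -> \forall k \near \oo, Wt (t k) ^+ 2 + 1 <= a * t k ^+ 2) ->
  exists2 Q, transport_plans (asymptotic_measure mu) (asymptotic_measure sigma) Q &
    (\int[Q]_x (d_infty (x.1 : cone X) (x.2 : cone X) ^+ 2)%:E <= A%:E)%E.
Proof.
move=> A0 t0 ty WA.
have [M hM] := displacement_second_moment hmu (lexx 0).
have [N hN] := displacement_second_moment hsigma (lexx 0).
have exV k : exists V, ray_coupling mu sigma V /\ forall e : R, 0 < e ->
    (\int[V]_p (mdist (ray_at (t k) p.1 : X) (ray_at (t k) p.2 : X) ^+ 2)%:E <=
      ((1 + e) * (Wt (t k) ^+ 2 + 1) + (1 + e^-1) * 4 ^+ 2)%:E)%E.
  (* Optimality up to 1 suffices against [t k ^+ 2]; this is the [+ 1] of the hypothesis. *)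
  have [_ /(_ 1 ltr01) [Pi [Pi1 Pi2] Pic]] := W_finite (ltW (t0 k)).
  have [||V cV Vc] := @ray_coupling_of_plan _ _ q qd mu sigma (t k) Pi (ltW (t0 k)).
  - by move=> B mB; rewrite [LHS]Pi1// -(hmu (ltW (t0 k)) mB).
  - by move=> B mB; rewrite [LHS]Pi2// -(hsigma (ltW (t0 k)) mB).
  by exists V; split=> // e e0; exact: Vc.
have [V VP] := choice exV.
have [|Q [Q1 Q2 QA]] := @cone_plan_of_ray_couplings _ _ hX q qd mu sigma M N hM hN t V A A0 t0 ty
  (fun k => (VP k).1).
  (* Half of the gap between b and a pays for the factor 1 + e, the other half for the constant K
     once [t k] is large. *)
  move=> a Aa; pose b := (A + a) / 2; have Ab : A < b by rewrite /b; lra.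
  have ba : b < a by rewrite /b; lra.
  have b1 : 0 < 2 * (b + 1) by lra.
  pose e := (a - b) / (2 * (b + 1)); have e0 : 0 < e by rewrite divr_gt0//; lra.
  have eb : e * b <= (a - b) / 2.
    have ee : e * (2 * (b + 1)) = a - b by rewrite divfK// gt_eqF.
    by nra.
  pose K := (1 + e^-1) * 4 ^+ 2; have d0 : 0 < (a - b) / 2 by lra.
  have tK : \forall k \near \oo, Num.max 1 (K / ((a - b) / 2)) <= t k.
    by move/cvgryPge : ty; apply.
  near=> k; have [_ /(_ e e0) Vk] := VP k; apply: le_trans Vk _; rewrite lee_fin -/K.
  have : Num.max 1 (K / ((a - b) / 2)) <= t k by near: k.
  rewrite ge_max => /andP[t1]; rewrite ler_pdivrMr// => tK'.
  have Wk : Wt (t k) ^+ 2 + 1 <= b * t k ^+ 2 by near: k; exact: WA.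
  have t2 : t k <= t k ^+ 2 by rewrite expr2; nra.
  have h1 : (1 + e) * (Wt (t k) ^+ 2 + 1) <= (1 + e) * (b * t k ^+ 2).
    by rewrite ler_wpM2l// addr_ge0// ltW.
  have h2 : e * b * t k ^+ 2 <= (a - b) / 2 * t k ^+ 2 by rewrite ler_wpM2r// sqr_ge0.
  have h3 : t k * ((a - b) / 2) <= t k ^+ 2 * ((a - b) / 2) by rewrite ler_wpM2r// ltW.
  by lra.
by exists Q.
Unshelve. all: by end_near. Qed.

Lemma asymptotic_measure_eq :
  asymptotic (@W R X) mu_ sigma_ ->
  same_measure (asymptotic_measure mu) (asymptotic_measure sigma).
Proof.
move=> [C WC].
have [|||a a0|Q [Q1 Q2] Q0] := @W_lower (fun k => k.+1%:R) 0 => //.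
- apply/cvgryPge => M; near=> k; rewrite (@le_trans _ _ k%:R) ?ler_nat//; near: k.
  exact: nbhs_infty_ger.
- near=> k; have k1 : 1 <= k.+1%:R :> R by rewrite ler1n.
  have kC : (C ^+ 2 + 1) / a <= k.+1%:R.
    rewrite (@le_trans _ _ k%:R) ?ler_nat//; near: k; exact: nbhs_infty_ger.
  have k0 : 0 <= k.+1%:R :> R by [].
  have [W0 _] := W_finite k0; have WCk := WC _ k0.
  have : Wt k.+1%:R ^+ 2 <= C ^+ 2 by rewrite ler_sqr ?nnegrE// (le_trans W0).
  rewrite ler_pdivrMr// in kC.
  have h : k.+1%:R * a <= k.+1%:R ^+ 2 * a by rewrite ler_wpM2r ?(ltW a0)// expr2 ler_peMl.
  by move: kC h; move: (k.+1%:R : R) => x; lra.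
have mc : measurable_fun setT (fun x : CX * CX => (d_infty (x.1 : cone X) (x.2 : cone X) ^+ 2)%:E).
  by apply: measurable_sqr; exact: (measurable_d_infty hX qd).
have [Z [mZ QZ subZ]] : ae_eq Q setT
    (fun x : CX * CX => (d_infty (x.1 : cone X) (x.2 : cone X) ^+ 2)%:E) (cst 0%E).
  apply/(ae_eq_integral_abs Q measurableT mc).
  apply/eqP; rewrite eq_le; apply/andP; split.
    apply: le_trans Q0; rewrite le_eqVlt; apply/orP; left; apply/eqP.
    by apply: eq_integral => x _; rewrite gee0_abs// lee_fin sqr_ge0.
  by apply: integral_ge0 => x _; exact: abse_ge0.
move=> B mB; rewrite -Q1// -Q2// /pushforward.
apply: (@probability_eq_off_null _ _ _ _ _ _ Z) => //.
- exact: measurable_preimage (@measurable_fst _ _ CX CX) mB.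
- exact: measurable_preimage (@measurable_snd _ _ CX CX) mB.
move=> x nZ; have d0 : d_infty (x.1 : cone X) (x.2 : cone X) = 0.
  apply: contrapT => dn; apply/nZ/subZ => /(_ I) /= [] /eqP.
  by rewrite sqrf_eq0 => /eqP.
by rewrite /preimage /= (d_infty_eq0 hX d0).
Unshelve. all: by end_near. Qed.

Lemma W_bounded_of_eq :
  same_measure (asymptotic_measure mu) (asymptotic_measure sigma) ->
  asymptotic (@W R X) mu_ sigma_.
Proof.
move=> musigma; have mr := measurable_ray_end hX.
have mdiag : measurable_fun setT (fun g : RX => (@ray_end _ X g, @ray_end _ X g)).
  exact: measurable_fun_pair.
have [Q [QE Qint]] := pushforward_probability mu mdiag.
(* The value of e is immaterial: the diagonal plan has cost 0, so the term in t^2 disappears and C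
   remains. *)
have [C C0 hC] := W_upper ltr01; exists (Num.sqrt C) => t t0.
have [||r [r0 Wr rC _]] := hC Q 0 t t0.
- by split=> B mB; rewrite /pushforward QE//; exact: musigma.
- rewrite (Qint (fun x => (d_infty (x.1 : cone X) (x.2 : cone X) ^+ 2)%:E)).
  + rewrite integral0_eq// => g _; rewrite d_inftyxx//.
    by rewrite expr0n.
  + by apply: measurable_sqr; exact: (measurable_d_infty hX qd).
  + by move=> x; rewrite lee_fin sqr_ge0.
by rewrite mulr0 add0r in rC; rewrite -[leLHS]/(Wt t) Wr ler_sqrt.
Qed.

Lemma W_over_t_cvg :
  (Wt t / t)%:E @[t --> +oo] --> W_infty (asymptotic_measure mu) (asymptotic_measure sigma).
Proof.
have [Q0 [c [planQ0 Q0c]]] := finite_cost_cone_plan.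
have [A [A0 WA Alb Aub]] := wasserstein_fin planQ0 Q0c.
rewrite /W_infty WA.
apply: cvg_EFin; first exact: nearW.
apply/cvgrPdist_le => e e0.
have L0 : 0 <= Num.sqrt A := sqrtr_ge0 A.
have LA : Num.sqrt A ^+ 2 = A := sqr_sqrtr A0.
have upper : \forall t \near +oo, Wt t / t <= Num.sqrt A + e.
  (* B is the target for [W^2 / t^2]. The parameter d is such that [(1 + d)^2 * (A + d)] uses at
     most half of B - A; large times leave the other half to C. *)
  pose B := (Num.sqrt A + e) ^+ 2; have AB : A < B by rewrite /B sqrrD LA; nra.
  pose d := Num.min 1 ((B - A) / (2 * (4 + 3 * A))).
  have A4 : 0 < 2 * (4 + 3 * A) by lra.
  have d0 : 0 < d by rewrite lt_min ltr01 divr_gt0// subr_gt0.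
  have d1 : d <= 1 by rewrite ge_min lexx.
  have dB : d * (2 * (4 + 3 * A)) <= B - A by rewrite -ler_pdivlMr// ge_min lexx orbT.
  have [Q planQ QA] := Aub _ d0; have [C C0 hC] := W_upper d0.
  near=> t; have t1 : 1 <= t by near: t; exact: nbhs_pinfty_ge.
  have tC : C / ((B - A) / 2) <= t by near: t; exact: (nbhs_pinfty_ge (num_real _)).
  have t0 : 0 < t by lra.
  have [r [r0 -> rC _]] := hC Q _ t (ltW t0) planQ QA.
  have BA0 : 0 < (B - A) / 2 by rewrite divr_gt0// subr_gt0.
  rewrite ler_pdivrMr// in tC.
  have t2 : t <= t ^+ 2 by rewrite expr2; nra.
  have h1 : (1 + d) ^+ 2 <= 1 + 3 * d by rewrite sqrrD; nra.
  have h2 : (1 + d) ^+ 2 * (A + d) <= (1 + 3 * d) * (A + d) by rewrite ler_wpM2r//; lra.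
  have h3 : (1 + 3 * d) * (A + d) <= A + (B - A) / 2 by nra.
  have h4 : (1 + d) ^+ 2 * (A + d) * t ^+ 2 <= (A + (B - A) / 2) * t ^+ 2.
    by rewrite ler_wpM2r ?sqr_ge0//; exact: le_trans h2 h3.
  have h5 : t * ((B - A) / 2) <= t ^+ 2 * ((B - A) / 2) by rewrite ler_wpM2r// ltW.
  have rB : r <= B * t ^+ 2 by lra.
  have Le : 0 <= Num.sqrt A + e by rewrite addr_ge0// ltW.
  rewrite ler_pdivrMr// -(ger0_norm (mulr_ge0 Le (ltW t0))) -sqrtr_sqr exprMn.
  exact: ler_wsqrtr.
have lower : \forall t \near +oo, Num.sqrt A - e <= Wt t / t.
  (* Otherwise the ratio stays below [sqrt A - e] along times tending to infinity, and [W_lower]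
     produces a cone plan of cost less than the infimum A. *)
  apply: contrapT => nlow.
  have ext (k : nat) : exists t : R, k.+1%:R < t /\ Wt t / t < Num.sqrt A - e.
    apply: contrapT => nt; apply: nlow; exists k.+1%:R; split; first exact: num_real.
    move=> t kt; rewrite leNgt; apply/negP => lt; apply: nt; by exists t.
  have [t tP] := choice ext.
  have t0 k : 0 < t k by apply: lt_trans (tP k).1.
  have ty : t k @[k --> \oo] --> +oo.
    apply/cvgryPge => M; near=> k; apply: (@le_trans _ _ k%:R); first by near: k; exact: nbhs_infty_ger.
    by apply: ltW; apply: le_lt_trans (tP k).1; rewrite ler_nat.
  (* It exceeds a nonnegative ratio; this allows inequalities to be squared. *)
  have c0 : 0 < Num.sqrt A - e.
    have [_] := tP 0%N; apply: le_lt_trans; rewrite divr_ge0 ?(ltW (t0 0%N))//.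
    by have [] := W_finite (ltW (t0 0%N)).
  have [|a ca|Q planQ Qc] := @W_lower t ((Num.sqrt A - e) ^+ 2) _ t0 ty.
  - exact: sqr_ge0.
  - near=> k; have [_] := tP k; rewrite ltr_pdivrMr// => Wk.
    have [W0 _] := W_finite (ltW (t0 k)).
    have h1 : Wt (t k) ^+ 2 <= (Num.sqrt A - e) ^+ 2 * t k ^+ 2.
      by rewrite -exprMn ler_sqr ?nnegrE ?mulr_ge0 ?(ltW c0) ?(ltW (t0 k)) ?(ltW Wk).
    have h2 : Num.max 1 (a - (Num.sqrt A - e) ^+ 2)^-1 <= t k.
      by near: k; move/cvgryPge : ty; apply.
    move: h2; rewrite ge_max => /andP[t1 t2].
    have ac : 0 < a - (Num.sqrt A - e) ^+ 2 by rewrite subr_gt0.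
    have h3 : 1 <= t k * (a - (Num.sqrt A - e) ^+ 2) by rewrite -ler_pdivrMr// mul1r.
    have h4 : t k * (a - (Num.sqrt A - e) ^+ 2) <= t k ^+ 2 * (a - (Num.sqrt A - e) ^+ 2).
      by rewrite ler_wpM2r ?(ltW ac)// expr2 ler_peMl// ltW.
    by lra.
  have := le_trans (Alb _ planQ) Qc; rewrite lee_fin leNgt => /negP; apply.
  by rewrite -[ltRHS]LA ltr_sqr ?nnegrE ?(ltW c0)// gtrBl.
near=> t; rewrite ler_distlC; apply/andP; split; near: t; [exact: lower | exact: upper].
Unshelve. all: by end_near. Qed.

End asymptotic_formula.

Theorem theorem4p2 (R : realType) (X : completeMetricType R) (hX : hadamard X)
    (mu_ sigma_ : R -> W2 X)
    (hmu_ : geodesic_ray (@W R X) mu_) (hsigma_ : geodesic_ray (@W R X) sigma_)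
    (mu sigma : probability (borel (ray X)) R)
    (hmu : displacement_interpolation mu_ mu)
    (hsigma : displacement_interpolation sigma_ sigma) :
  let mu_infty := asymptotic_measure mu in
  let sigma_infty := asymptotic_measure sigma in
  (asymptotic (@W R X) mu_ sigma_ <-> same_measure mu_infty sigma_infty) /\
  (W (mu_ t) (sigma_ t) / t)%:E @[t --> +oo] --> W_infty mu_infty sigma_infty.
Proof.
move=> mu_infty sigma_infty.
have [q qd] := dense_seq_exists (hadamard_separable hX).
split; last exact: (W_over_t_cvg hX qd hmu hsigma).
split; first exact: (asymptotic_measure_eq hX qd hmu hsigma).
exact: (W_bounded_of_eq hX qd hmu hsigma).
Qed.
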